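(* Let $\mathcal{S}$ be a set of $n$ records and $\mathbf{p}:\mathcal{S}\to[0,1]$, with $\mu_{\mathcal{S}}=\sum_{v\in\mathcal{S}}\mathbf{p}(v)$. In the External Memory model with memory size $M$ and block size $B$, there is a (static) data structure for the subset sampling problem on $\langle\mathcal{S},\mathbf{p}\rangle$ occupying $\mathcal{O}(n/B)$ space that answers a subset sampling query in $\mathcal{O}\left(\frac{\log^*_B n}{B}+\frac{\mu_{\mathcal{S}}}{B}\log_{M/B}(n/B)\right)$ amortized expected I/Os.
   Context: Subset sampling query: return a random subset $X\subseteq\mathcal{S}$ in which each $v\in\mathcal{S}$ is included independently with probability $\mathbf{p}(v)$, i.e. $\Pr[X=T]=\prod_{v\in T}\mathbf{p}(v)\prod_{v\in\mathcal{S}\setminus T}(1-\mathbf{p}(v))$, independently of previous queries. External Memory model: a machine has $M$ words of memory and an unbounded disk divided into blocks of $B$ words, $M\ge 2B$; an I/O reads one block into memory or writes $B$ words to a block; cost is the number of I/Os (computation is free), space is the number of blocks used. $\log^*_B n$ denotes the smallest $t$ such that applying $\log_2$ to $n$ $t$ times yields a value at most $B$. *)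

(* Defs.v *)
From HB Require Import structures.
From mathcomp Require Import all_boot all_order all_algebra.
From mathcomp Require Import all_classical all_reals all_analysis.
From mathcomp Require Import lra.
Set Implicit Arguments.
Unset Strict Implicit.
Unset Printing Implicit Defensive.
Import Order.TTheory GRing.Theory Num.Theory.
Local Open Scope ring_scope.

Definition log2 {R : realType} (x : R) : R := ln x / ln 2.

Lemma log2_le {R : realType} (x : R) :
  0 < x -> log2 x <= x - (1 - ln 2) / ln 2.
Proof.
move=> x0.
have l2 : 0 < ln 2 :> R by rewrite ln_gt0 // ltr1n.
have hlf : (1 : R) / 2 <= ln 2.
  have := @le_ln1Dx R (- (1 / 2)) ltac:(lra).
  have -> : 1 + - (1 / 2) = 2^-1 :> R by lra.
  by rewrite lnV ?posrE ?ltr0n //; lra.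
have hx : ln x <= x / 2 - 1 + ln 2.
  have := @le_ln1Dx R (x / 2 - 1) ltac:(lra).
  have -> : 1 + (x / 2 - 1) = x / 2 by lra.
  by rewrite ln_div ?posrE ?ltr0n //; lra.
rewrite /log2 ler_pdivrMr // mulrBl divfK ?gt_eqF //.
have : 0 <= x * (ln 2 - 1 / 2) by apply: mulr_ge0; [exact: ltW | rewrite subr_ge0].
lra.
Qed.

Lemma log_star_ex (R : realType) (B n : nat) :
  exists t, iter t log2 (n%:R : R) <= B%:R.
Proof.
set d : R := (1 - ln 2) / ln 2.
have l2 : 0 < ln 2 :> R by rewrite ln_gt0 // ltr1n.
have d0 : 0 < d.
  rewrite divr_gt0 // subr_gt0 -ltr_expR lnK ?posrE ?ltr0n //.
  by have := @expR_gt1Dx R 1 (oner_neq0 _); lra.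
have [//|nE] := pselect (exists t, iter t log2 (n%:R : R) <= B%:R).
have H t : iter t log2 (n%:R : R) <= n%:R - t%:R * d.
  elim: t => [|t IH]; first by rewrite /= mul0r subr0.
  have pos : 0 < iter t log2 (n%:R : R).
    rewrite ltNge; apply/negP => le0; apply: nE; exists t.
    exact: le_trans le0 (ler0n _ _).
  by rewrite iterS (le_trans (log2_le pos)) // -/d -natr1 mulrDl; lra.
exists (Num.truncn (n%:R / d)).+1.
apply: le_trans (H _) (le_trans _ (ler0n _ _)).
by rewrite subr_le0 -ler_pdivrMr // ltW // truncnS_gt.
Qed.

Definition log_star (R : realType) (B n : nat) : nat :=
  ex_minn (log_star_ex R B n).

Definition ceil_div (n B : nat) : nat := (n + B.-1) %/ B.

Definition is_distribution {R : realType} {T : finType} (d : T -> R) : Prop :=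
  (forall x, 0 <= d x) /\ \sum_x d x = 1.

(* M words of memory, K disk blocks of B words each, integers below W. *)
Section Machine.
Variables (R : realType) (M B K W : nat).

(* The B memory cells taking part in a transfer are freely chosen. *)
Inductive io :=
  | Halt
  | Read of 'I_K & {ffun 'I_B -> 'I_M}
  | Write of 'I_K & {ffun 'I_B -> 'I_M}.

Definition io_enc (i : io) : option (bool * 'I_K * {ffun 'I_B -> 'I_M}) :=
  match i with
  | Halt => None
  | Read a f => Some (true, a, f)
  | Write a f => Some (false, a, f)
  end.

Definition io_dec (o : option (bool * 'I_K * {ffun 'I_B -> 'I_M})) : io :=
  match o with
  | None => Halt
  | Some (b, a, f) => if b then Read a f else Write a f
  end.

Lemma io_encK : cancel io_enc io_dec. Proof. by case. Qed.

HB.instance Definition _ := Finite.copy io (can_type io_encK).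

(* One round of free computation followed by an I/O or by the end of the
   query: the cells whose records are reported, the new value of each cell
   (a copy of an old cell or an integer), and the I/O. Records are therefore
   atomic: they can be moved, copied and reported, but neither created nor
   packed together into one word. *)
Definition action : Type :=
  ({set 'I_M} * {ffun 'I_M -> 'I_M + 'I_W} * io)%type.

(* What free computation can depend on: the integers in memory and the
   probabilities of the records in memory. *)
Definition view : Type := {ffun 'I_M -> R + 'I_W}.

Definition program : Type := view -> action -> R.

Definition randomized_program (prog : program) : Prop :=
  forall u, is_distribution (prog u).

Section Execution.
Variables (S : finType) (p : S -> R) (prog : program).

Definition word : Type := (S + 'I_W)%type.
Definition memory : Type := {ffun 'I_M -> word}.
Definition disk : Type := {ffun 'I_K -> {ffun 'I_B -> word}}.
Definition config : Type := (memory * disk)%type.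

Definition view_of (m : memory) : view :=
  [ffun i => match m i with inl v => inl (p v) | inr k => inr k end].

Definition reported (a : action) (m : memory) : {set S} :=
  [set v | [exists i in a.1.1, m i == inl v]].

Definition compute (a : action) (m : memory) : memory :=
  [ffun i => match a.1.2 i with inl j => m j | inr k => inr k end].

Definition do_io (i : io) (c : config) : config :=
  match i with
  | Halt => c
  | Read b f =>
      ([ffun x => if [pick j | f j == x] is Some j then c.2 b j else c.1 x],
       c.2)
  | Write b f =>
      (c.1, [ffun y => if y == b then [ffun j => c.1 (f j)] else c.2 y])
  end.

Definition next_config (a : action) (c : config) : config :=
  do_io a.2 (compute a c.1, c.2).

(* Probability that a query which has reached configuration c and reported A
   so far ends after exactly k further I/Os, in configuration c' and with
   answer X. *)
Fixpoint query_prob (k : nat) (c : config) (A X : {set S}) (c' : config) : R :=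
  \sum_(a : action) prog (view_of c.1) a *
    (let A' := A :|: reported a c.1 in
     match k with
     | 0%N =>
         if a.2 is Halt then ((A' == X) && (next_config a c == c'))%:R else 0
     | k'.+1 =>
         if a.2 is Halt then 0 else query_prob k' (next_config a c) A' X c'
     end).

(* Probability that successive queries started in c have the answers Xs and
   take exactly k I/Os altogether. *)
Fixpoint queries_prob (Xs : seq {set S}) (c : config) (k : nat) : R :=
  match Xs with
  | [::] => (k == 0%N)%:R
  | X :: Xs' =>
      \sum_(i < k.+1) \sum_(c' : config)
        query_prob i c finset.set0 X c' * queries_prob Xs' c' (k - i)
  end.

Definition run_prob (init : config -> R) (Xs : seq {set S}) (k : nat) : R :=
  \sum_(c : config) init c * queries_prob Xs c k.

Definition answers_prob (init : config -> R) (Xs : seq {set S}) : \bar R :=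
  (\sum_(0 <= k <oo) (run_prob init Xs k)%:E)%E.

(* Expectation of the total number of I/Os of the first q queries. It ignores
   non-terminating runs, which have probability 0 whenever answers_prob sums
   to 1 over all sequences of q answers. *)
Definition expected_cost (init : config -> R) (q : nat) : \bar R :=
  (\sum_(0 <= k <oo)
     (k%:R * \sum_(Xs : q.-tuple {set S}) run_prob init Xs k)%:E)%E.

End Execution.
End Machine.

Definition mu {R : realType} {S : finType} (p : S -> R) : R := \sum_v p v.

Definition subset_prob {R : realType} {S : finType} (p : S -> R)
    (T : {set S}) : R :=
  (\prod_(v in T) p v) * \prod_(v in ~: T) (1 - p v).

Definition answers_subset_sampling (R : realType) (M B K W : nat)
    (prog : program R M B K W) (S : finType) (p : S -> R)
    (init : config M B K W S -> R) : Prop :=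
  forall Xs : seq {set S},
    answers_prob p prog init Xs = (\prod_(X <- Xs) subset_prob p X)%:E.

(* log_(M/B) (n/B) is negative when n < B, where it is read as 0. *)
Definition query_bound {R : realType} (M B n : nat) (mu : R) : R :=
  (log_star R B n)%:R / B%:R +
  mu / B%:R * Num.max 0 (ln (n%:R / B%:R) / ln (M%:R / B%:R)).

Definition amortized_expected_cost (R : realType) (M B K W : nat)
    (prog : program R M B K W) (S : finType) (p : S -> R)
    (init : config M B K W S -> R) (bound : R) : Prop :=
  forall q : nat, (expected_cost p prog init q <= (q%:R * bound)%:E)%E.

(* Main.v *)
Require Import Defs.
From mathcomp Require Import all_boot all_order all_algebra.
From mathcomp Require Import all_classical all_reals all_analysis.
From mathcomp Require Import ring lra zify.
Set Implicit Arguments.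
Unset Strict Implicit.
Unset Printing Implicit Defensive.
Import Order.TTheory GRing.Theory Num.Theory.
Local Open Scope ring_scope.
Import numFieldNormedType.Exports.

(** Write [lam v = - ln (1 - p v)]. A light record ([p v <= 1/2]) is in the sample
    iff a Poisson process of rate [lam v] has a point. All light records are laid
    out in a table of [O(n)] slots of equal rate, a record occupying a number of
    slots proportional to its rate, so that a query is: draw a Poisson number of
    uniform table slots, and accept the record of each slot with a probability
    that turns the total rate of [v] into exactly [lam v]. Heavy records, of which
    there are at most [2 mu], are scanned one by one.

    Uniform slots are delivered in batches by a tree of fan-out [M / B] over the
    table, as in a buffer tree turned upside down: a node stores a buffer of
    samples of the slots below it and is refilled by drawing a random child label
    for each position and then replacing the labels of one child after another by
    the next samples of that child, refilling the child recursively when it is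
    exhausted. Each sample thus pays [O(1 / B)] I/Os per level, amortized through
    a potential counting the consumed part of the buffers.

    The number of samples of a query must be bounded, so Poisson numbers above a
    cutoff are lumped into one event, handled by a scan of the whole table that
    realises the conditional law slot by slot; its probability is polynomially
    small. The answers are tested against the functions
    [\prod_Y P(X is contained in Y)], which determine their law, and the number
    of I/Os is carried by a polynomial variable whose derivative at [1] is the
    expected cost. *)

(** * Finitely supported distributions *)

Section FiniteDistributions.
Variable R : numFieldType.
Implicit Types T U : eqType.

Definition fdist (T : Type) : Type := seq (R * T).

Definition expect (T : Type) (d : fdist T) (F : T -> R) : R :=
  \sum_(x <- d) x.1 * F x.2.

Definition outcomes (T : Type) (d : fdist T) : seq T := unzip2 d.

Definition surely T (d : fdist T) (P : T -> Prop) : Prop :=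
  {in outcomes d, forall x, P x}.

Definition is_fdist (T : Type) (d : fdist T) : bool :=
  all (fun x => 0 <= x.1) d && (\sum_(x <- d) x.1 == 1).

Definition dret (T : Type) (x : T) : fdist T := [:: (1, x)].

Definition dmap (T U : Type) (g : T -> U) (d : fdist T) : fdist U :=
  [seq (x.1, g x.2) | x <- d].

Definition dbind (T U : Type) (d : fdist T) (k : T -> fdist U) : fdist U :=
  flatten [seq [seq (x.1 * y.1, y.2) | y <- k x.2] | x <- d].

Lemma expect_ret T (x : T) F : expect (dret x) F = F x.
Proof. by rewrite /expect big_seq1 mul1r. Qed.

Lemma expect_map T U (g : T -> U) d F :
  expect (dmap g d) F = expect d (fun x => F (g x)).
Proof. by rewrite /expect big_map. Qed.

Lemma expect_bind T U (d : fdist T) (k : T -> fdist U) F :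
  expect (dbind d k) F = expect d (fun x => expect (k x) F).
Proof.
rewrite /expect big_flatten big_map; apply: eq_bigr => x _.
by rewrite big_map big_distrr /=; apply: eq_bigr => y _; rewrite mulrA.
Qed.

Lemma eq_expect_in T (d : fdist T) F G :
  surely d (fun x => F x = G x) -> expect d F = expect d G.
Proof.
move=> FG; rewrite /expect !big_seq; apply: eq_bigr => x xd.
by rewrite FG //; exact: map_f.
Qed.

Lemma eq_expect T (d : fdist T) F G : F =1 G -> expect d F = expect d G.
Proof. by move=> FG; apply: eq_expect_in => x _; apply: FG. Qed.

Lemma expect_cst T (d : fdist T) a : is_fdist d -> expect d (fun=> a) = a.
Proof. by case/andP=> _ /eqP d1; rewrite /expect -big_distrl /= d1 mul1r. Qed.

Lemma expectZl T (d : fdist T) a F :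
  expect d (fun x => a * F x) = a * expect d F.
Proof. by rewrite /expect big_distrr; apply: eq_bigr => x _; rewrite mulrCA. Qed.

Lemma expectZr T (d : fdist T) a F :
  expect d (fun x => F x * a) = expect d F * a.
Proof. by rewrite /expect big_distrl; apply: eq_bigr => x _; rewrite mulrA. Qed.

Lemma expectD T (d : fdist T) F G :
  expect d (fun x => F x + G x) = expect d F + expect d G.
Proof. by rewrite /expect -big_split; apply: eq_bigr => x _; rewrite mulrDr. Qed.

Lemma expect_scaler T (V : lmodType R) (d : fdist T) F (w : V) :
  expect d F *: w = \sum_(x <- d) x.1 *: (F x.2 *: w).
Proof.
by rewrite /expect scaler_suml; apply: eq_bigr => x _; rewrite scalerA.
Qed.

Lemma expect_eq0 T (d : fdist T) F : surely d (fun x => F x = 0) -> expect d F = 0.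
Proof.
by move=> F0; rewrite (eq_expect_in F0) /expect big1 // => x _; rewrite mulr0.
Qed.

Lemma expect_sum T (d : fdist T) (I : Type) (r : seq I) (F : I -> T -> R) :
  expect d (fun x => \sum_(i <- r) F i x) = \sum_(i <- r) expect d (F i).
Proof.
by rewrite /expect exchange_big; apply: eq_bigr => x _; rewrite big_distrr.
Qed.

Lemma expect_le T (d : fdist T) F a :
  is_fdist d -> surely d (fun x => F x <= a) -> expect d F <= a.
Proof.
move=> d_fd Fa; rewrite -[leRHS](expect_cst a d_fd) /expect !big_seq.
apply: ler_sum => x xd; have /andP[/allP d0 _] := d_fd.
by apply: ler_wpM2l; [exact: d0 | apply: Fa; exact: map_f].
Qed.

Lemma fdist_ret T (x : T) : is_fdist (dret x).
Proof. by rewrite /is_fdist big_seq1 eqxx /= ler01. Qed.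

Lemma fdist_map T U (g : T -> U) d : is_fdist d -> is_fdist (dmap g d).
Proof. by rewrite /is_fdist all_map big_map. Qed.

Lemma fdist_bind T U (d : fdist T) (k : T -> fdist U) :
  is_fdist d -> (forall x, is_fdist (k x)) -> is_fdist (dbind d k).
Proof.
move=> d_fd k_fd; have /andP[/allP d0 _] := d_fd; apply/andP; split.
  apply/allP => _ /flattenP[_ /mapP[x xd ->] /mapP[y yk ->]].
  have /andP[/allP k0 _] := k_fd x.2.
  by apply: mulr_ge0; [exact: d0 | exact: k0].
apply/eqP; transitivity (expect (dbind d k) (fun=> 1)).
  by apply: eq_bigr => x _; rewrite mulr1.
by rewrite expect_bind (@eq_expect _ _ _ (fun=> 1)) ?expect_cst // => x; rewrite expect_cst.
Qed.

Lemma surely_ret T (x : T) P : P x -> surely (dret x) P.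
Proof. by move=> Px y; rewrite inE => /eqP->. Qed.

Lemma surely_map T U (g : T -> U) d P :
  surely d (fun x => P (g x)) -> surely (dmap g d) P.
Proof.
move=> dP _ /mapP[_ /mapP[x xd ->] ->] /=.
by apply: dP; exact: map_f.
Qed.

Lemma surely_bind T U (d : fdist T) (k : T -> fdist U) P :
  surely d (fun x => surely (k x) P) -> surely (dbind d k) P.
Proof.
move=> dP _ /mapP[_ /flattenP[_ /mapP[x xd ->] /mapP[y yk ->]] ->] /=.
by apply: (dP x.2); exact: map_f.
Qed.

Section Mass.
Variables (T : finType) (d : fdist T).

Definition mass (x : T) : R := \sum_(y <- d) y.1 * (y.2 == x)%:R.

Lemma sum_mass F : \sum_x mass x * F x = expect d F.
Proof.
under eq_bigr do rewrite big_distrl.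
rewrite exchange_big; apply: eq_bigr => y _ /=.
rewrite (bigD1 y.2) //= eqxx mulr1 big1 ?addr0 // => x /negPf ne.
by rewrite eq_sym ne mulr0 mul0r.
Qed.

Lemma mass_neq0 x : mass x != 0 -> x \in outcomes d.
Proof.
apply: contraNT => xd; rewrite /mass big_seq big1 // => y yd.
case: eqP => [yx|_]; last by rewrite mulr0.
by rewrite -yx map_f in xd.
Qed.

End Mass.

Definition or_else (T : Type) (x : T) (d : fdist T) : fdist T :=
  if is_fdist d then d else dret x.

Lemma fdist_or_else T (x : T) d : is_fdist (or_else x d).
Proof. by rewrite /or_else; case: ifP => // _; exact: fdist_ret. Qed.

Lemma or_elseE T (x : T) d : is_fdist d -> or_else x d = d.
Proof. by rewrite /or_else => ->. Qed.

Lemma surely_or_else T (x : T) d P : P x -> surely d P -> surely (or_else x d) P.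
Proof. by move=> Px dP; rewrite /or_else; case: ifP => // _; exact: surely_ret. Qed.

(* [n = 0] is read as [n = 1], so that this is always a distribution. *)
Definition uniform (n : nat) : fdist nat :=
  [seq (n.-1.+1%:R^-1, i) | i <- iota 0 n.-1.+1].

Lemma expect_uniform n F :
  (0 < n)%N -> expect (uniform n) F = n%:R^-1 * \sum_(i < n) F i.
Proof.
move=> n0; rewrite /expect /uniform prednK // big_map big_distrr /=.
by rewrite -[n in iota 0 n]subn0 -/(index_iota 0 n) big_mkord.
Qed.

Lemma fdist_uniform n : is_fdist (uniform n).
Proof.
rewrite /is_fdist all_map big_map; apply/andP; split.
  by apply/allP => i _ /=; rewrite invr_ge0.
rewrite big_const_seq count_predT size_iota iter_addr addr0.
by rewrite -[X in X == 1]mulr_natr mulVf // pnatr_eq0.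
Qed.

Lemma surely_uniform n : (0 < n)%N -> surely (uniform n) (fun i => i < n)%N.
Proof. by move=> n0 _ /mapP[_ /mapP[i + ->] ->]; rewrite mem_iota prednK. Qed.

Fixpoint iid T (k : nat) (d : fdist T) : fdist (seq T) :=
  if k is k'.+1 then dbind d (fun x => dmap (cons x) (iid k' d)) else dret [::].

Lemma fdist_iid T k (d : fdist T) : is_fdist d -> is_fdist (iid k d).
Proof.
move=> d_fd; elim: k => [|k IH]; first exact: fdist_ret.
by apply: fdist_bind => // x; exact: fdist_map.
Qed.

Lemma surely_iid T k (d : fdist T) (a : pred T) :
  surely d a -> surely (iid k d) (fun s => size s = k /\ all a s).
Proof.
move=> da; elim: k => [|k IH] /=; first exact: surely_ret.
apply: surely_bind => x xd; apply: surely_map => s /IH[/= -> ->].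
by rewrite da.
Qed.

Lemma surely_iid_uniform k n : (0 < n)%N ->
  surely (iid k (uniform n)) (fun s => size s = k /\ all (fun i => i < n)%N s).
Proof. by move=> n0; apply: surely_iid; exact: surely_uniform. Qed.

Fixpoint thin T (l : seq (R * T)) : fdist (seq T) :=
  if l is x :: l' then
    dbind (thin l') (fun s => [:: (x.1, x.2 :: s); (1 - x.1, s)])
  else dret [::].

Lemma fdist_thin T (l : seq (R * T)) :
  all (fun x => 0 <= x.1 <= 1) l -> is_fdist (thin l).
Proof.
elim: l => [|x l IH] /=; first by rewrite fdist_ret.
move=> /andP[/andP[x0 x1] /IH l_fd]; apply: fdist_bind => // s.
by rewrite /is_fdist /= x0 subr_ge0 x1 !big_cons big_nil /= addr0 addrC subrK eqxx.
Qed.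

Lemma expect_thin_prod T (l : seq (R * T)) (h : T -> R) :
  expect (thin l) (fun s => \prod_(a <- s) h a) =
  \prod_(x <- l) (1 - x.1 * (1 - h x.2)).
Proof.
elim: l => [|x l IH] /=; first by rewrite expect_ret !big_nil.
rewrite expect_bind big_cons -IH -expectZl; apply: eq_expect => s.
by rewrite /expect !big_cons big_nil /= addr0; ring.
Qed.

Lemma surely_thin T (l : seq (R * T)) (a : pred T) :
  all a (unzip2 l) -> surely (thin l) (fun s => all a s).
Proof.
elim: l => [|x l IH] /=; first by move=> _; exact: surely_ret.
move=> /andP[ax al]; apply: surely_bind => s /(IH al) sa t.
by rewrite !inE => /orP[] /eqP-> /=; rewrite ?ax.
Qed.

End FiniteDistributions.

Lemma mass_distribution (R : realType) (T : finType) (d : fdist R T) :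
  is_fdist d -> is_distribution (mass d).
Proof.
move=> d_fd; split=> [x|]; last first.
  rewrite -(@expect_cst _ _ d 1 d_fd) -sum_mass.
  by apply: eq_bigr => x _; rewrite mulr1.
have /andP[/allP d0 _] := d_fd; rewrite /mass big_seq.
by apply: sumr_ge0 => y yd; rewrite mulr_ge0 ?ler0n ?d0.
Qed.

(** * Generating functions of the I/O counts *)

Section SumWithin.
Variables (R : nzRingType) (S : finType).
Implicit Types (Ys Xs : seq {set S}) (h : seq {set S} -> R).

Fixpoint sum_within Ys h : R :=
  if Ys is Y :: Ys' then
    \sum_(X : {set S} | X \subset Y) sum_within Ys' (fun Xs => h (X :: Xs))
  else h [::].

Lemma eq_sum_within Ys h h' :
  (forall Xs, size Xs = size Ys -> h Xs = h' Xs) ->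
  sum_within Ys h = sum_within Ys h'.
Proof.
elim: Ys h h' => [|Y Ys IH] h h' hh' /=; first exact: hh'.
by apply: eq_bigr => X _; apply: IH => Xs sX; apply: hh'; rewrite /= sX.
Qed.

Lemma exchange_sum_within (I : Type) (r : seq I) Ys (h : I -> seq {set S} -> R) :
  sum_within Ys (fun Xs => \sum_(i <- r) h i Xs) =
  \sum_(i <- r) sum_within Ys (h i).
Proof.
elim: Ys h => [|Y Ys IH] h //=.
by rewrite exchange_big; apply: eq_bigr => X _; rewrite IH.
Qed.

Lemma sum_withinZl Ys a h :
  sum_within Ys (fun Xs => a * h Xs) = a * sum_within Ys h.
Proof.
elim: Ys h => [|Y Ys IH] h //=; rewrite big_distrr.
by apply: eq_bigr => X _; rewrite IH.
Qed.

Lemma sum_within_inj h h' :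
  (forall Ys, sum_within Ys h = sum_within Ys h') -> h =1 h'.
Proof.
move=> hh' Xs; elim: Xs h h' hh' => [|X Xs IH] h h' hh'; first exact: (hh' [::]).
apply: (IH (fun Xs => h (X :: Xs)) (fun Xs => h' (X :: Xs))) => Ys.
have [n] := ubnP #|X|; elim: n => // n IHn in X *; rewrite ltnS => Xn.
have := hh' (X :: Ys); rewrite /= (bigD1 X) //= [in RHS](bigD1 X) //=.
rewrite (eq_bigr (fun X => sum_within Ys (fun Xs => h' (X :: Xs)))).
  exact: addIr.
move=> Z /andP[ZX nZ]; apply: IHn; apply: leq_trans Xn.
by apply: fintype.proper_card; rewrite finset.properEneq nZ ZX.
Qed.

Lemma sum_within_setT q h :
  sum_within (nseq q [set: S]) h = \sum_(Xs : q.-tuple {set S}) h Xs.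
Proof.
elim: q h => [|q IH] h /=.
  rewrite (bigD1 [tuple]) //= big1 ?addr0 // => t.
  by case/eqP; apply: tuple0.
rewrite (eq_bigl xpredT) => [|X]; last by rewrite finset.subsetT.
under eq_bigr => X _ do rewrite IH.
rewrite pair_big /=.
rewrite [RHS](reindex (fun x : {set S} * q.-tuple {set S} =>
   [tuple of x.1 :: x.2])) /=; first exact: eq_bigr.
exists (fun t : q.+1.-tuple {set S} => (thead t, [tuple of behead t])).
  by move=> [X t] _ /=; rewrite theadE; congr (_, _); apply: val_inj.
by move=> t _ /=; rewrite -tuple_eta.
Qed.

End SumWithin.

Section SubsetProb.
Variables (R : realType) (S : finType) (p : S -> R).

Lemma sum_subset_prob (Y : {set S}) :
  \sum_(X : {set S} | X \subset Y) subset_prob p X = \prod_(v in ~: Y) (1 - p v).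
Proof.
transitivity (\prod_v ((v \in Y)%:R * p v + (1 - p v))); last first.
  rewrite (bigID (mem Y)) /= big1 ?mul1r => [|v ->]; last first.
    by rewrite mul1r addrC subrK.
  by apply: eq_big => [v|v /negPf->]; rewrite ?finset.in_setC // mul0r add0r.
rewrite bigA_distr [RHS](bigID (fun X : {set S} => X \subset Y)) /=.
rewrite [X in _ = _ + X]big1 ?addr0; last first.
  move=> X /fintype.subsetPn[v vX nvY].
  by rewrite (bigD1 v) //= vX (negPf nvY) !mul0r.
apply: eq_bigr => X /fintype.subsetP XY; rewrite [RHS](bigID (mem X)) /=.
congr (_ * _); first by apply: eq_bigr => v vX; rewrite vX XY // mul1r.
by apply: eq_big => [v|v]; rewrite finset.in_setC // => /negPf->.
Qed.

Lemma sum_within_subset_prob Ys :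
  sum_within Ys (fun Xs => \prod_(X <- Xs) subset_prob p X) =
  \prod_(Y <- Ys) \prod_(v in ~: Y) (1 - p v).
Proof.
elim: Ys => [|Y Ys IH] /=; first by rewrite !big_nil.
rewrite big_cons -IH -sum_subset_prob big_distrl /=; apply: eq_bigr => X _.
by rewrite -sum_withinZl; apply: eq_sum_within => Xs _; rewrite big_cons.
Qed.

End SubsetProb.

Section BigOrd.
Variables (V : Type) (idx : V) (op : Monoid.law idx).

Lemma big_ord_trunc (F : nat -> V) m n : (m <= n)%N ->
  (forall i, (m <= i)%N -> F i = idx) ->
  \big[op/idx]_(i < n) F i = \big[op/idx]_(i < m) F i.
Proof.
move=> mn F0; rewrite -!(big_mkord xpredT) (big_cat_nat _ mn) //=.
rewrite [X in op _ X]big_nat_cond [X in op _ X]big1 ?Monoid.mulm1 //.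
by move=> i /andP[/andP[/F0]].
Qed.

Lemma big_ord_mul (F : nat -> V) m n :
  \big[op/idx]_(i < m * n) F i =
  \big[op/idx]_(i < m) \big[op/idx]_(j < n) F (i * n + j)%N.
Proof.
elim: m => [|m IH]; first by rewrite mul0n !big_ord0.
rewrite big_ord_recr /= -IH mulSn addnC big_split_ord.
by congr (op _ _); apply: eq_bigr => j _; rewrite /= addnC.
Qed.

Lemma big_ord_nth (T : Type) (x0 : T) (F : T -> V) xs n : F x0 = idx -> (size xs <= n)%N ->
  \big[op/idx]_(i < n) F (nth x0 xs i) = \big[op/idx]_(x <- xs) F x.
Proof.
move=> F0 xs_n; rewrite (big_ord_trunc (F := fun i => F (nth x0 xs i)) xs_n) => [|i le_i].
  by rewrite (big_nth x0) big_mkord.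
by rewrite nth_default.
Qed.

End BigOrd.

Lemma eseries_trunc (R : realType) (u : nat -> R) N :
  (forall k, (N <= k)%N -> u k = 0) ->
  (\sum_(0 <= k <oo) (u k)%:E)%E = (\sum_(k < N) u k)%:E.
Proof.
move=> u0; apply: cvg_lim => //; apply: cvg_near_cst.
exists N => // n /= Nn.
by rewrite big_mkord sumEFin (@big_ord_trunc _ _ _ u N n).
Qed.

Definition samples_subsets (R : realType) (M B K W : nat) (prog : program R M B K W)
    (S : finType) (p : S -> R) (bound : R) : Prop :=
  exists init : config M B K W S -> R, [/\ is_distribution init,
    answers_subset_sampling prog p init & amortized_expected_cost prog p init bound].

Section Programs.
Variables (R : realType) (M B K W : nat).
Variable prog : view R M W -> fdist R (action M B K W).

Definition program_of : program R M B K W := fun u => mass (prog u).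

Lemma program_of_randomized :
  (forall u, is_fdist (prog u)) -> randomized_program program_of.
Proof. by move=> prog_fd u; exact: mass_distribution. Qed.

Definition halts (i : io M B K) : bool := if i is Halt then true else false.

Variables (S : finType) (p : S -> R).
Notation cfg := (config M B K W S).
Notation query_prob := (query_prob p program_of).
Notation next c a := (@next_config M B K W S a c).
Notation steps c := (prog (view_of p c.1)).

Lemma query_prob0 (c : cfg) A X c' :
  query_prob 0 c A X c' =
  expect (steps c) (fun a => (halts a.2)%:R *
     ((A :|: reported a c.1 == X) && (next c a == c'))%:R).
Proof.
rewrite -sum_mass; apply: eq_bigr => a _; congr (_ * _).
by case: a => -[r g] [] * /=; rewrite ?mul1r ?mul0r.
Qed.

Lemma query_probS k (c : cfg) A X c' :
  query_prob k.+1 c A X c' =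
  expect (steps c) (fun a => (~~ halts a.2)%:R *
     query_prob k (next c a) (A :|: reported a c.1) X c').
Proof.
rewrite -sum_mass; apply: eq_bigr => a _; congr (_ * _).
by case: a => -[r g] [] *; rewrite ?mul1r ?mul0r.
Qed.

Lemma query_prob_subset k (c : cfg) (A X : {set S}) c' :
  ~~ (A \subset X) -> query_prob k c A X c' = 0.
Proof.
elim: k c A => [|k IH] c A nAX; rewrite ?query_prob0 ?query_probS;
  apply: expect_eq0 => a _.
  by case: eqP nAX => [<-|_ _]; rewrite ?finset.subsetUl ?mulr0.
rewrite IH ?mulr0 //; apply: contra nAX.
by apply: fintype.subset_trans; exact: finset.subsetUl.
Qed.

Section SumQueryProb.
Variable V : lmodType R.

Lemma sum_query_prob0 (c : cfg) (A Y : {set S}) (F : cfg -> V) : A \subset Y ->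
  \sum_(X : {set S} | X \subset Y) \sum_c' query_prob 0 c A X c' *: F c' =
  \sum_(x <- steps c) x.1 *: (((reported x.2 c.1 \subset Y) && halts x.2.2)%:R *:
    F (next c x.2)).
Proof.
move=> AY.
under eq_bigr => X _ do (under eq_bigr => c' _ do
  rewrite query_prob0 expect_scaler; rewrite exchange_big).
rewrite exchange_big; apply: eq_bigr => x _ /=.
set A' := A :|: reported x.2 c.1.
have -> : (reported x.2 c.1 \subset Y) = (A' \subset Y).
  by rewrite finset.subUset AY.
under eq_bigr => X _ do rewrite -scaler_sumr.
rewrite -scaler_sumr; congr (_ *: _).
have sumF X : \sum_c' ((halts x.2.2)%:R * ((A' == X) && (next c x.2 == c'))%:R) *: F c' =
    ((A' == X) && halts x.2.2)%:R *: F (next c x.2).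
  rewrite (bigD1 (next c x.2)) //= big1 ?addr0 => [|c' /negPf nc].
    by rewrite eqxx andbT -natrM mulnb andbC.
  by rewrite [_ == c']eq_sym nc andbF mulr0 scale0r.
under eq_bigr => X _ do rewrite sumF.
have [A'Y|nA'Y] := boolP (A' \subset Y); last first.
  rewrite scale0r big1 // => X XY.
  by case: eqP => [AX|_]; [rewrite AX XY in nA'Y | rewrite scale0r].
rewrite (bigD1 A') //= eqxx big1 ?addr0 // => X /andP[_ /negPf nX].
by rewrite [_ == X]eq_sym nX scale0r.
Qed.

Lemma sum_query_probS k (c : cfg) (A Y : {set S}) (F : cfg -> V) : A \subset Y ->
  \sum_(X : {set S} | X \subset Y) \sum_c' query_prob k.+1 c A X c' *: F c' =
  \sum_(x <- steps c) x.1 *: (((reported x.2 c.1 \subset Y) && ~~ halts x.2.2)%:R *: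
    \sum_(X : {set S} | X \subset Y) \sum_c'
      query_prob k (next c x.2) (A :|: reported x.2 c.1) X c' *: F c').
Proof.
move=> AY.
under eq_bigr => X _ do (under eq_bigr => c' _ do
  rewrite query_probS expect_scaler; rewrite exchange_big).
rewrite exchange_big; apply: eq_bigr => x _ /=.
have [A'Y|nA'Y] := boolP (reported x.2 c.1 \subset Y).
  rewrite !scaler_sumr; apply: eq_bigr => X _; rewrite !scaler_sumr.
  by apply: eq_bigr => c' _; rewrite !scalerA.
rewrite scale0r scaler0 big1 // => X XY; rewrite big1 // => c' _.
rewrite query_prob_subset ?mulr0 ?scale0r ?scaler0 //.
apply: contra nA'Y => /fintype.subset_trans/(_ XY).
by rewrite finset.subUset => /andP[].
Qed.

End SumQueryProb.

(* The sum, over the runs that end after [i < k] I/Os in a configuration [c'] and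
   report only elements of [Y], of their probability times ['X^i * phi c']. *)
Fixpoint query_gf (k : nat) (c : cfg) (Y : {set S}) (phi : cfg -> {poly R}) :
    {poly R} :=
  if k is k'.+1 then
    \sum_(x <- steps c) (x.1 * (reported x.2 c.1 \subset Y)%:R) *:
      (if halts x.2.2 then phi (next c x.2)
       else 'X * query_gf k' (next c x.2) Y phi)
  else 0.

Lemma query_gfE k (c : cfg) (A Y : {set S}) phi : A \subset Y ->
  query_gf k c Y phi =
  \sum_(i < k) \sum_(X : {set S} | X \subset Y) \sum_c'
     query_prob i c A X c' *: ('X^i * phi c').
Proof.
elim: k c A => [|k IH] c A AY; first by rewrite big_ord0.
rewrite big_ord_recl sum_query_prob0 //.
under [X in _ = _ + X]eq_bigr => i _ do rewrite lift0 sum_query_probS //.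
rewrite [X in _ = _ + X]exchange_big -big_split; apply: eq_bigr => x _ /=.
rewrite -scalerA -scaler_sumr -scalerDr; congr (_ *: _).
have [rY|_] := boolP (reported x.2 c.1 \subset Y); last first.
  by rewrite !scale0r add0r big1 // => i _; rewrite scale0r.
case: (halts x.2.2); rewrite ?scale0r ?scale1r ?mul1r ?add0r -/query_gf.
  by rewrite big1 ?addr0 // => i _; rewrite scale0r.
rewrite (IH _ (A :|: reported x.2 c.1)) ?finset.subUset ?AY ?rY // mulr_sumr.
apply: eq_bigr => i _; rewrite scale1r mulr_sumr; apply: eq_bigr => X _.
by rewrite mulr_sumr; apply: eq_bigr => c' _; rewrite -scalerAr mulrA exprS.
Qed.

Lemma query_gf_at1 k (c : cfg) Y phi :
  (query_gf k.+1 c Y phi).[1] =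
  expect (steps c) (fun a => (reported a c.1 \subset Y)%:R *
    (if halts a.2 then (phi (next c a)).[1]
     else (query_gf k (next c a) Y phi).[1])).
Proof.
rewrite /= horner_sum; apply: eq_bigr => x _.
by rewrite hornerZ mulrA; case: halts; rewrite ?hornerM ?hornerX ?mul1r.
Qed.

Lemma query_gf_deriv_at1 k (c : cfg) phi :
  (query_gf k.+1 c [set: S] phi)^`().[1] =
  expect (steps c) (fun a =>
     if halts a.2 then (phi (next c a))^`().[1] else
     (query_gf k (next c a) [set: S] phi).[1] +
     (query_gf k (next c a) [set: S] phi)^`().[1]).
Proof.
rewrite /= linear_sum horner_sum; apply: eq_bigr => x _.
rewrite /= finset.subsetT mulr1 derivZ hornerZ; congr (_ * _).
by case: halts; rewrite // derivM derivX hornerD !hornerM hornerX !hornerC !mul1r.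
Qed.

Fixpoint stops_within (k : nat) (c : cfg) : Prop :=
  if k is k'.+1 then
    surely (steps c) (fun a => halts a.2 \/ stops_within k' (next c a))
  else False.

Lemma query_prob_stops k i (c : cfg) A X c' :
  stops_within k c -> (k <= i)%N -> query_prob i c A X c' = 0.
Proof.
elim: k i c A => [|k IH] [|i] c A //= c_stops ki.
rewrite -/(Defs.query_prob p program_of i.+1 c A X c') query_probS.
apply: expect_eq0 => a ad; case: (c_stops a ad) => [->|a_stops].
  by rewrite mul0r.
by rewrite (IH _ _ _ a_stops) ?mulr0.
Qed.

Record terminating (inv ready : cfg -> Prop) (max_ios : nat) : Prop := {
  steps_fdist : forall u, is_fdist (prog u);
  ready_inv : forall c, ready c -> inv c;
  inv_step : forall c, inv c -> surely (steps c)
    (fun a => if halts a.2 then ready (next c a) else inv (next c a));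
  ready_stops : forall c, ready c -> stops_within max_ios c }.

Variables (inv ready : cfg -> Prop) (max_ios : nat).
Hypothesis prog_term : terminating inv ready max_ios.

Lemma query_prob_ready i (c : cfg) A X c' :
  inv c -> ~ ready c' -> query_prob i c A X c' = 0.
Proof.
move=> + not_ready; elim: i c A => [|i IH] c A c_inv;
  rewrite ?query_prob0 ?query_probS; apply: expect_eq0 => a ad;
  have := inv_step prog_term c_inv ad; case: halts; rewrite ?mul0r //.
  by move=> a_ready; case: (next c a =P c') => [nextE|_];
     [rewrite nextE in a_ready | rewrite andbF mulr0].
by move=> /IH ->; rewrite mulr0.
Qed.

Fixpoint queries_gf (Ys : seq {set S}) (c : cfg) : {poly R} :=
  if Ys is Y :: Ys' then query_gf max_ios c Y (queries_gf Ys') else 1.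

Lemma coef_queries_gf Ys (c : cfg) k : ready c ->
  (queries_gf Ys c)`_k =
  sum_within Ys (fun Xs => queries_prob p program_of Xs c k).
Proof.
elim: Ys c k => [|Y Ys IH] c k c_ready; first by rewrite /= coef1.
rewrite /= (query_gfE _ _ _ (finset.sub0set Y)) coef_sum.
pose F i := \sum_(X : {set S} | X \subset Y) \sum_c'
  (query_prob i c finset.set0 X c' *
   (if (k < i)%N then 0 else (queries_gf Ys c')`_(k - i))).
rewrite (eq_bigr (fun i : 'I_max_ios => F i)); last first.
  move=> i _; rewrite coef_sum; apply: eq_bigr => X _; rewrite coef_sum.
  by apply: eq_bigr => c' _; rewrite coefZ coefXnM.
rewrite -(@big_ord_trunc _ _ _ F max_ios (max_ios + k.+1)) ?leq_addr //; last first.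
  move=> i ki; rewrite /F big1 // => X _; rewrite big1 // => c' _.
  by rewrite (query_prob_stops _ _ _ (ready_stops prog_term c_ready) ki) mul0r.
rewrite (@big_ord_trunc _ _ _ F k.+1) ?leq_addl //; last first.
  by move=> i ki; rewrite /F big1 // => X _; rewrite big1 // => c' _; rewrite ki mulr0.
rewrite /F exchange_big; apply: eq_bigr => X _ /=.
rewrite exchange_sum_within; apply: eq_bigr => i _.
rewrite exchange_sum_within; apply: eq_bigr => c' _.
rewrite sum_withinZl ltnNge -ltnS ltn_ord /=.
have [c'_ready|nc'] := pselect (ready c'); first by rewrite IH.
by rewrite (query_prob_ready _ _ _ (ready_inv prog_term c_ready) nc') !mul0r.
Qed.

Lemma queries_prob_stops Xs (c : cfg) k :
  ready c -> (size Xs * max_ios < k)%N -> queries_prob p program_of Xs c k = 0.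
Proof.
elim: Xs c k => [|X Xs IH] c k c_ready /=; first by rewrite mul0n; case: k.
rewrite mulSn => hk; rewrite big1 // => i _; rewrite big1 // => c' _.
have [Ki|iK] := leqP max_ios i.
  by rewrite (query_prob_stops _ _ _ (ready_stops prog_term c_ready) Ki) mul0r.
have [c'_ready|nc'] := pselect (ready c'); last first.
  by rewrite (query_prob_ready _ _ _ (ready_inv prog_term c_ready) nc') mul0r.
by rewrite IH ?mulr0 //; have := ltn_ord i; lia.
Qed.

Lemma size_queries_gf Ys (c : cfg) :
  ready c -> (size (queries_gf Ys c) <= (size Ys * max_ios).+1)%N.
Proof.
move=> c_ready; apply/leq_sizeP => k hk; rewrite coef_queries_gf //.
rewrite (@eq_sum_within _ _ _ _ (fun=> 0 * 0)) ?sum_withinZl ?mul0r // => Xs sX.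
by rewrite queries_prob_stops ?mulr0 // sX.
Qed.

Lemma query_gf_mass k (c : cfg) phi : inv c -> stops_within k c ->
  (forall c', ready c' -> (phi c').[1] = 1) -> (query_gf k c [set: S] phi).[1] = 1.
Proof.
move=> + + phi1; elim: k c => // k IH c c_inv c_stops.
rewrite query_gf_at1 (@eq_expect_in _ _ _ _ (fun=> 1)).
  by apply: expect_cst; exact: steps_fdist prog_term _.
move=> a ad; rewrite finset.subsetT mul1r; have := inv_step prog_term c_inv ad.
case: (c_stops a ad) => [->/phi1//|a_stops].
by case: halts => [/phi1//|a_inv]; exact: IH.
Qed.

Lemma queries_gf_mass q (c : cfg) :
  ready c -> (queries_gf (nseq q [set: S]) c).[1] = 1.
Proof.
elim: q c => [|q IH] c c_ready /=; first by rewrite hornerC.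
by apply: query_gf_mass => //;
   [exact: ready_inv prog_term _ c_ready | exact: ready_stops prog_term _ c_ready].
Qed.

Lemma query_gf_cost k (c : cfg) q : inv c -> stops_within k.+1 c ->
  (query_gf k.+1 c [set: S] (queries_gf (nseq q [set: S])))^`().[1] =
  expect (steps c) (fun a => if halts a.2
     then (queries_gf (nseq q [set: S]) (next c a))^`().[1] else
     1 + (query_gf k (next c a) [set: S] (queries_gf (nseq q [set: S])))^`().[1]).
Proof.
move=> c_inv c_stops; rewrite query_gf_deriv_at1; apply: eq_expect_in => a ad.
have := inv_step prog_term c_inv ad; have := c_stops a ad.
case: halts => // -[//|a_stops] a_inv; congr (_ + _).
by apply: query_gf_mass => // c'; exact: queries_gf_mass.
Qed.

Variable init : fdist R cfg.
Hypothesis init_ready : surely init ready.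

Lemma run_prob_stops Xs k : (size Xs * max_ios < k)%N ->
  run_prob p program_of (mass init) Xs k = 0.
Proof.
move=> hk; rewrite /run_prob big1 // => c _.
have [->|/mass_neq0 c_init] := eqVneq (mass init c) 0; first by rewrite mul0r.
by rewrite queries_prob_stops ?mulr0 //; exact: init_ready.
Qed.

Lemma sum_within_run_prob Ys k :
  sum_within Ys (fun Xs => run_prob p program_of (mass init) Xs k) =
  expect init (fun c => (queries_gf Ys c)`_k).
Proof.
rewrite /run_prob exchange_sum_within -sum_mass; apply: eq_bigr => c _.
rewrite sum_withinZl.
have [->|/mass_neq0 c_init] := eqVneq (mass init c) 0; first by rewrite !mul0r.
by rewrite coef_queries_gf //; exact: init_ready.
Qed.

Theorem answers_of_queries_gf :
  (forall Ys, expect init (fun c => (queries_gf Ys c).[1]) =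
     \prod_(Y <- Ys) \prod_(v in ~: Y) (1 - p v)) ->
  answers_subset_sampling program_of p (mass init).
Proof.
move=> gfE Xs; rewrite /answers_prob.
rewrite (@eseries_trunc _ _ (size Xs * max_ios).+1); last first.
  by move=> k hk; exact: run_prob_stops.
congr (_%:E); move: Xs; apply: sum_within_inj => Ys.
rewrite sum_within_subset_prob -gfE.
rewrite (@eq_sum_within _ _ _ _ (fun Xs => \sum_(k < (size Ys * max_ios).+1)
  run_prob p program_of (mass init) Xs k)); last by move=> Xs ->.
rewrite exchange_sum_within; under eq_bigr do rewrite sum_within_run_prob.
rewrite -expect_sum; apply: eq_expect_in => c /init_ready c_ready.
rewrite (horner_coef_wide _ (size_queries_gf Ys c_ready)).
by apply: eq_bigr => k _; rewrite expr1n mulr1.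
Qed.

Theorem cost_of_queries_gf (bound : R) :
  (forall q, expect init (fun c => (queries_gf (nseq q [set: S]) c)^`().[1]) <=
     q%:R * bound) ->
  amortized_expected_cost program_of p (mass init) bound.
Proof.
move=> gf_le q; rewrite /expected_cost.
rewrite (@eseries_trunc _ _ (q * max_ios).+1); last first.
  move=> k hk; rewrite big1 ?mulr0 // => Xs _.
  by rewrite run_prob_stops // size_tuple.
rewrite lee_fin; apply: le_trans (gf_le q); rewrite le_eqVlt; apply/orP; left.
under eq_bigr => k _ do rewrite -(sum_within_setT q
  (fun Xs => run_prob p program_of (mass init) Xs k)) sum_within_run_prob -expectZl.
rewrite -expect_sum; apply/eqP/eq_expect_in => c /init_ready c_ready.
have gf_size := size_queries_gf (nseq q [set: S]) c_ready; rewrite size_nseq in gf_size.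
rewrite (@horner_coef_wide _ (q * max_ios)); last first.
  by apply: leq_trans (size_poly _ _) _; rewrite -subn1 leq_subLR add1n.
rewrite big_ord_recl mul0r add0r; apply: eq_bigr => k _.
by rewrite expr1n mulr1 coef_deriv mulr_natl.
Qed.

Theorem samples_of_queries_gf (bound : R) : is_fdist init ->
  (forall Ys, expect init (fun c => (queries_gf Ys c).[1]) =
     \prod_(Y <- Ys) \prod_(v in ~: Y) (1 - p v)) ->
  (forall q, expect init (fun c => (queries_gf (nseq q [set: S]) c)^`().[1]) <= q%:R * bound) ->
  samples_subsets program_of p bound.
Proof.
move=> init_fd gfE gf_le; exists (mass init); split; first exact: mass_distribution.
  exact: answers_of_queries_gf.
exact: cost_of_queries_gf.
Qed.

End Programs.

Section Reports.
Variables (M B K W : nat) (S : finType).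
Implicit Types (Y : {set S}).

Definition safe Y (w : S + 'I_W) : bool := if w is inl v then v \in Y else true.

Lemma reported_subset (R : comNzRingType) (a : action M B K W) (m : memory M W S) Y
    (reports : seq 'I_M) : a.1.1 =i reports ->
  (reported a m \subset Y)%:R = \prod_(x <- reports) (safe Y (m x))%:R :> R.
Proof.
move=> aE; rewrite -natr_prod; congr (_%:R).
have -> : (\prod_(x <- reports) safe Y (m x))%N = all (fun x => safe Y (m x)) reports :> nat.
  by elim: reports {aE} => [|x r IH]; rewrite ?big_nil // big_cons IH /= mulnb.
congr nat_of_bool; apply/fintype.subsetP/allP => [sub x xr|safe_all v].
  case mx : (m x) => [v|] //=; apply: sub; rewrite inE; apply/existsP.
  by exists x; rewrite aE xr mx eqxx.
by rewrite inE => /existsP[x]; rewrite aE => /andP[/safe_all + /eqP xE]; rewrite xE.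
Qed.

End Reports.

(** * Poisson weights *)

Section Poisson.
Variable R : realType.
Implicit Types (x y : R) (t c : nat).

(* Unlike the library's [poisson_pmf], this is the point mass at [0] when [x = 0]. *)
Definition poisson x c : R := expR (- x) * (x ^+ c / c`!%:R).

Definition poisson_tail t x : R := 1 - \sum_(c < t) poisson x c.

Lemma poisson_ge0 x c : 0 <= x -> 0 <= poisson x c.
Proof. by move=> x0; rewrite !mulr_ge0 ?expR_ge0 ?exprn_ge0 ?invr_ge0. Qed.

Lemma sum_poisson t x :
  \sum_(c < t) poisson x c = expR (- x) * series (exp_coeff x) t.
Proof. by rewrite /poisson -big_distrr /= /series /= big_mkord. Qed.

Lemma series_exp_coeff_le x t : 0 <= x -> series (exp_coeff x) t <= expR x.
Proof.
move=> x0; rewrite /expR; apply: nondecreasing_cvgn_le.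
  by apply: nondecreasing_series => i _ _; exact: exp_coeff_ge0.
exact: is_cvg_series_exp_coeff.
Qed.

Lemma poisson_tail_ge0 t x : 0 <= x -> 0 <= poisson_tail t x.
Proof.
move=> x0; rewrite subr_ge0 sum_poisson expRN mulrC ler_pdivrMr ?expR_gt0 //.
by rewrite mul1r series_exp_coeff_le.
Qed.

Lemma poisson_tail0 x : poisson_tail 0 x = 1.
Proof. by rewrite /poisson_tail big_ord0 subr0. Qed.

Lemma poisson_tailS t x : poisson_tail t.+1 x = poisson_tail t x - poisson x t.
Proof. by rewrite /poisson_tail big_ord_recr /= opprD addrA. Qed.

Lemma poisson_tail_gt0 t x : 0 < x -> 0 < poisson_tail t x.
Proof.
move=> x0; have := poisson_tail_ge0 t.+1 (ltW x0); rewrite poisson_tailS subr_ge0.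
apply: lt_le_trans.
by rewrite !mulr_gt0 ?expR_gt0 ?exprn_gt0 ?invr_gt0 ?ltr0n ?fact_gt0.
Qed.

Lemma poisson_tailS_rate0 t : poisson_tail t.+1 0 = 0.
Proof.
rewrite /poisson_tail big_ord_recl /poisson oppr0 expR0 expr0 fact0 divr1 mul1r.
by rewrite big1 ?addr0 ?subrr // => i _; rewrite lift0 expr0n mul0r mulr0.
Qed.

Lemma poissonD t x y :
  poisson (x + y) t = \sum_(c < t.+1) poisson x c * poisson y (t - c).
Proof.
rewrite /poisson addrC exprDn opprD expRD big_distrl big_distrr /=.
apply: eq_bigr => c _; have ct : (c <= t)%N by rewrite -ltnS.
have fact_neq0 k : k`!%:R != 0 :> R by rewrite pnatr_eq0 -lt0n fact_gt0.
rewrite -(bin_fact ct) !natrM -[_ *+ 'C(_, _)]mulr_natr.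
have bin_neq0 : 'C(t, c)%:R != 0 :> R by rewrite pnatr_eq0 -lt0n bin_gt0.
by field; rewrite !fact_neq0 bin_neq0.
Qed.

Lemma poisson_tailD t x y :
  \sum_(c < t) poisson x c * poisson_tail (t - c) y + poisson_tail t x =
  poisson_tail t (x + y).
Proof.
elim: t => [|t IH]; first by rewrite big_ord0 add0r !poisson_tail0.
rewrite !poisson_tailS -IH poissonD big_ord_recr /= subSnn.
rewrite [X in _ = _ - X]big_ord_recr /= subnn poisson_tailS poisson_tail0.
have -> : \sum_(c < t) poisson x c * poisson_tail (t.+1 - c) y =
  \sum_(c < t) poisson x c * poisson_tail (t - c) y -
  \sum_(c < t) poisson x c * poisson y (t - c).
  rewrite -sumrB; apply: eq_bigr => c _.
  by rewrite subSn ?poisson_tailS ?mulrBr // ltnW.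
by ring.
Qed.

Lemma poisson_mulS x c : poisson x c.+1 * c.+1%:R = x * poisson x c.
Proof.
rewrite /poisson factS natrM exprS.
have fact_neq0 : c`!%:R != 0 :> R by rewrite pnatr_eq0 -lt0n fact_gt0.
by field; rewrite fact_neq0 addrC natr1 pnatr_eq0.
Qed.

Lemma poisson_mean_le t x : 0 <= x -> \sum_(c < t) poisson x c * c%:R <= x.
Proof.
move=> x0; case: t => [|t]; first by rewrite big_ord0.
rewrite big_ord_recl mulr0 add0r.
under eq_bigr => c _ do rewrite lift0 poisson_mulS.
rewrite -big_distrr /= -[leRHS]mulr1 ler_wpM2l //.
by have := poisson_tail_ge0 t x0; rewrite subr_ge0.
Qed.

Lemma poisson_window_le t n x : 0 <= x ->
  t%:R * (\sum_(c < n) poisson x c - \sum_(c < t) poisson x c) <= x.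
Proof.
move=> x0; have [nt|tn] := leqP n t.
  apply: (le_trans _ x0); rewrite mulr_ge0_le0 // subr_le0.
  rewrite (big_ord_widen _ _ nt) big_mkcond /=.
  by apply: ler_sum => c _; case: ifP => _; rewrite ?lexx ?poisson_ge0.
rewrite (big_ord_widen _ _ (ltnW tn)) [X in _ - X]big_mkcond -sumrB big_distrr /=.
apply: le_trans (poisson_mean_le n x0); apply: ler_sum => c _.
case: ltnP => ct; first by rewrite subrr mulr0 mulr_ge0 ?poisson_ge0.
by rewrite subr0 mulrC ler_wpM2l ?poisson_ge0 ?ler_nat.
Qed.

Lemma cvg_sum_poisson x : ((fun n => \sum_(c < n) poisson x c) @ \oo --> (1 : R))%classic.
Proof.
rewrite (_ : (fun n => _) = fun n => expR (- x) * series (exp_coeff x) n);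
  last by apply/funext => n; rewrite sum_poisson.
rewrite -(expR0 R) -(subrr x) [x - x]addrC expRD.
by apply: cvgM; [exact: cvg_cst | exact: is_cvg_series_exp_coeff].
Qed.

Lemma poisson_tail_markov t x : 0 <= x -> t%:R * poisson_tail t x <= x.
Proof.
move=> x0.
have window_cvg : ((fun n => t%:R * (\sum_(c < n) poisson x c - \sum_(c < t) poisson x c))
    @ \oo --> t%:R * poisson_tail t x)%classic.
  apply: cvgM; first exact: cvg_cst.
  by apply: cvgB; [exact: cvg_sum_poisson | exact: cvg_cst].
rewrite -(cvg_lim _ window_cvg) //; apply: limr_le.
  by apply/cvg_ex; eexists; exact: window_cvg.
by apply: nearW => n; exact: poisson_window_le.
Qed.

Definition truncated_poisson (J : nat) x : fdist R nat :=
  rcons [seq (poisson x c, c) | c <- iota 0 J.+1] (poisson_tail J.+1 x, J.+1).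

Lemma expect_truncated_poisson (J : nat) x F : expect (truncated_poisson J x) F =
  \sum_(c < J.+1) poisson x c * F c + poisson_tail J.+1 x * F J.+1.
Proof.
rewrite /expect /truncated_poisson -cats1 big_cat big_seq1; congr (_ + _).
by rewrite big_map -[iota 0 J.+1]/(index_iota 0 J.+1) big_mkord.
Qed.

Lemma fdist_truncated_poisson J x : 0 <= x -> is_fdist (truncated_poisson J x).
Proof.
move=> x0; apply/andP; split; last first.
  apply/eqP; transitivity (expect (truncated_poisson J x) (fun=> 1)).
    by apply: eq_bigr => z _; rewrite mulr1.
  rewrite expect_truncated_poisson; under eq_bigr do rewrite mulr1.
  by rewrite mulr1 addrC subrK.
rewrite all_rcons all_map poisson_tail_ge0 //.
by apply/allP => c _; exact: poisson_ge0.
Qed.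

Lemma surely_truncated_poisson J x :
  surely (truncated_poisson J x) (fun N => N <= J.+1)%N.
Proof.
move=> N; rewrite /outcomes /truncated_poisson /unzip2 map_rcons -map_comp map_id_in //.
by rewrite mem_rcons inE mem_iota add0n => /predU1P[->|/andP[_ /leqW]].
Qed.

(* One slot of rate [th] of a scan that still needs [t] points, the slots after it
   having rate [rho]; every point of the slot is accepted with probability [al].
   The outcome tells whether the slot has an accepted point, and the number of
   points still needed. *)
Section ScanStep.
Variables (th rho : R) (t : nat) (al : R).

(* The conditional probability of [c] points in the slot ([t] or more if [c = t]),
   none of which is of a kind making up a proportion [be] of the points. *)
Definition scan_weight (be : R) (c : nat) : R :=
  (if (c < t)%N
   then expR (- (th * be)) * poisson (th * (1 - be)) c * poisson_tail (t - c) rho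
   else expR (- (th * be)) * poisson_tail t (th * (1 - be))) /
  poisson_tail t (rho + th).

Definition scan_dist : fdist R (bool * nat) :=
  [seq (scan_weight al c, (false, t - c)%N) | c <- iota 0 t.+1] ++
  [seq (scan_weight 0 c - scan_weight al c, (true, t - c)%N) | c <- iota 0 t.+1].

Lemma expect_scan_dist F : expect scan_dist F =
  \sum_(c < t.+1) (scan_weight al c * F (false, t - c)%N +
    (scan_weight 0 c - scan_weight al c) * F (true, t - c)%N).
Proof.
rewrite /expect /scan_dist big_cat !big_map [RHS]big_split.
by rewrite -[iota 0 t.+1]/(index_iota 0 t.+1) !big_mkord.
Qed.

(* The probability that all points of a process of rate [mu] are of a kind of rate
   [sg], given that there are at least [s] points. *)
Definition scan_value (s : nat) (mu sg : R) : R :=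
  expR (- (mu - sg)) * poisson_tail s sg / poisson_tail s mu.

Hypotheses (th_gt0 : 0 < th) (rho_ge0 : 0 <= rho).

Lemma poisson_tail_total_neq0 : poisson_tail t (rho + th) != 0.
Proof. by rewrite gt_eqF // poisson_tail_gt0 // ltr_wpDl. Qed.

Lemma sum_scan_weight (be sg : R) : 0 <= be <= 1 -> 0 <= sg <= rho ->
  \sum_(c < t.+1) scan_weight be c * scan_value (t - c) rho sg =
  scan_value t (rho + th) (sg + th * (1 - be)).
Proof.
move=> /andP[be0 be1] /andP[sg0 sg_rho]; rewrite big_ord_recr /= subnn.
rewrite {2}/scan_weight ltnn /scan_value !poisson_tail0 mulr1 invr1 mulr1.
rewrite [sg + _]addrC -[poisson_tail t (th * (1 - be) + sg)]poisson_tailD.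
have -> : expR (- (rho + th - (th * (1 - be) + sg))) =
   expR (- (th * be)) * expR (- (rho - sg)).
  by rewrite -expRD; congr expR; ring.
rewrite [X in _ = X / _]mulrDr [RHS]mulrDl; congr (_ + _); last by ring.
rewrite mulr_sumr mulr_suml; apply: eq_bigr => c _.
rewrite /scan_weight ltn_ord.
have [rho_eq0|rho_neq0] := eqVneq rho 0.
  have sg_eq0 : sg = 0 by apply/eqP; rewrite eq_le sg0 -rho_eq0 sg_rho.
  rewrite rho_eq0 sg_eq0; case: (t - c)%N (subn_gt0 c t) => [|k _].
    by rewrite ltn_ord.
  by rewrite poisson_tailS_rate0; ring.
have tail_neq0 : poisson_tail (t - c) rho != 0.
  by rewrite gt_eqF // poisson_tail_gt0 // lt_def rho_neq0.
by field; rewrite tail_neq0 poisson_tail_total_neq0.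
Qed.

Lemma scan_weight_ge0 (be : R) c : 0 <= be <= 1 -> 0 <= scan_weight be c.
Proof.
move=> /andP[be0 be1]; rewrite /scan_weight.
apply: divr_ge0; last by rewrite poisson_tail_ge0 // addr_ge0 // ltW.
have th_be : 0 <= th * (1 - be) by rewrite mulr_ge0 ?subr_ge0 // ltW.
case: ifP => _; last by rewrite mulr_ge0 ?expR_ge0 ?poisson_tail_ge0.
apply: mulr_ge0; last exact: poisson_tail_ge0.
by apply: mulr_ge0; [exact: expR_ge0 | exact: poisson_ge0].
Qed.

Lemma scan_weight_le (be : R) c :
  0 <= be <= 1 -> scan_weight be c <= scan_weight 0 c.
Proof.
move=> /andP[be0 be1]; rewrite /scan_weight ler_wpM2r //.
  by rewrite invr_ge0 poisson_tail_ge0 // addr_ge0 // ltW.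
rewrite mulr0 subr0 mulr1 oppr0 expR0 !mul1r.
have x0 : 0 <= th * (1 - be) by rewrite mulr_ge0 ?subr_ge0 // ltW.
have y0 : 0 <= th * be by rewrite mulr_ge0 // ltW.
have thE : th * (1 - be) + th * be = th by ring.
case: ifP => _.
  rewrite ler_wpM2r ?poisson_tail_ge0 // /poisson mulrA -expRD -opprD addrC thE.
  rewrite ler_wpM2l ?expR_ge0 // ler_wpM2r ?invr_ge0 //.
  by rewrite lerXn2r ?nnegrE ?(ltW th_gt0) // ger_pMr // lerBlDr lerDl.
rewrite -[in leRHS]thE -poisson_tailD.
apply: (@le_trans _ _ (poisson_tail t (th * (1 - be)))).
  by rewrite -[leRHS]mul1r ler_wpM2r ?poisson_tail_ge0 // -expR0 ler_expR oppr_le0.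
rewrite lerDr sumr_ge0 // => c' _.
by rewrite mulr_ge0 ?poisson_ge0 ?poisson_tail_ge0.
Qed.

Lemma expect_scan_value (safe : bool) (sg : R) : 0 <= al <= 1 -> 0 <= sg <= rho ->
  expect scan_dist (fun z => (z.1 ==> safe)%:R * scan_value z.2 rho sg) =
  scan_value t (rho + th) (sg + th * (1 - al * (1 - safe%:R))).
Proof.
move=> al01 sg01; rewrite expect_scan_dist -sum_scan_weight //; last first.
  by case: safe; rewrite ?subrr ?subr0 ?mulr0 ?mulr1 ?lexx ?ler01.
apply: eq_bigr => c _ /=.
by case: safe => /=; rewrite ?subrr ?subr0 ?mulr0 ?mulr1; ring.
Qed.

Lemma expect_scan_last (safe : bool) : 0 <= al <= 1 -> rho = 0 ->
  expect scan_dist (fun z => (z.1 ==> safe)%:R) =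
  scan_value t th (th * (1 - al * (1 - safe%:R))).
Proof.
move=> al01 rho_eq0; rewrite -[th in scan_value t th]add0r -{1}rho_eq0.
rewrite -[X in scan_value t _ X]add0r -expect_scan_value ?rho_eq0 ?lexx //.
rewrite !expect_scan_dist; apply: eq_bigr => c _ /=.
have [ct|tc] := ltnP c t.
  have w0 be : scan_weight be c = 0.
    rewrite /scan_weight ct rho_eq0; move: ct; rewrite -subn_gt0.
    by case: (t - c)%N => // k _; rewrite poisson_tailS_rate0 mulr0 mul0r.
  by rewrite !w0 subrr !mul0r.
have -> : (t - c)%N = 0%N by apply/eqP; rewrite subn_eq0.
by rewrite /scan_value !poisson_tail0 subrr oppr0 expR0 mulr1 divr1 !mulr1.
Qed.

Lemma fdist_scan_dist : 0 <= al <= 1 -> is_fdist scan_dist.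
Proof.
move=> al01; apply/andP; split.
  rewrite all_cat !all_map; apply/andP; split; apply/allP => c _ /=.
    exact: scan_weight_ge0.
  by rewrite subr_ge0 scan_weight_le.
apply/eqP; transitivity (expect scan_dist (fun=> 1)).
  by apply: eq_bigr => z _; rewrite mulr1.
rewrite expect_scan_dist; under eq_bigr do rewrite !mulr1 addrC subrK.
rewrite big_ord_recr /= {2}/scan_weight ltnn mulr0 subr0 oppr0 expR0 mulr1 mul1r.
under eq_bigr => c _ do
  rewrite /scan_weight ltn_ord mulr0 subr0 oppr0 expR0 mulr1 mul1r.
rewrite -mulr_suml -mulrDl poisson_tailD [th + rho]addrC divff //.
exact: poisson_tail_total_neq0.
Qed.

Lemma surely_scan_dist : surely scan_dist (fun z => z.2 <= t)%N.
Proof.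
move=> z /mapP[x + ->]; rewrite mem_cat.
by move=> /orP[] /mapP[c _ ->] /=; exact: leq_subr.
Qed.

End ScanStep.
End Poisson.

(** * The law of a stream merged from child streams *)

Section FillMask.
Variables (T : eqType) (lab : T -> option nat).

Fixpoint fill_mask (A : Type) (mask : seq bool) (ys xs : seq A) : seq A :=
  match mask, xs with
  | b :: mask', x :: xs' =>
      if b then
        if ys is y :: ys' then y :: fill_mask mask' ys' xs' else x :: xs'
      else x :: fill_mask mask' ys xs'
  | _, _ => xs
  end.

Definition label_mask d (cs : seq T) := [seq lab w == Some d | w <- cs].

Definition label_count d (cs : seq T) := count id (label_mask d cs).

Lemma fill_mask_nil A (m : seq bool) (s : seq A) : fill_mask m [::] s = s.
Proof. by elim: m s => [|[] m IHm] [|x s] //=; rewrite IHm. Qed.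

Lemma map_fill_mask A A' (h : A -> A') m ys xs :
  map h (fill_mask m ys xs) = fill_mask m (map h ys) (map h xs).
Proof.
elim: m ys xs => [|b m IH] ys [|x xs] //=.
by case: b; [case: ys => [|y ys] //=|]; rewrite /= IH.
Qed.

Lemma size_fill_mask A m (ys xs : seq A) : size (fill_mask m ys xs) = size xs.
Proof.
elim: m ys xs => [|b m IH] ys [|x xs] //=.
by case: b; [case: ys => [|y ys] //=|]; rewrite /= IH.
Qed.

Lemma fill_mask_cons d y ys cs : lab y = None ->
  fill_mask (label_mask d cs) (y :: ys) cs =
  fill_mask (label_mask d (fill_mask (label_mask d cs) [:: y] cs)) ys
    (fill_mask (label_mask d cs) [:: y] cs).
Proof.
move=> ly; elim: cs => //= w cs IH.
case lw: (lab w == Some d) => /=; last by rewrite lw IH.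
by rewrite fill_mask_nil ly.
Qed.

Lemma label_count_fill d e ys cs : {in ys, forall y, lab y = None} ->
  label_count e (fill_mask (label_mask d cs) ys cs) =
  (label_count e cs - (if e == d then minn (size ys) (label_count d cs) else 0))%N.
Proof.
rewrite /label_count; elim: cs ys => [|w cs IH] ys ys_nolab /=.
  by rewrite minn0 if_same.
case lw: (lab w == Some d) => /=; last first.
  rewrite IH // add0n; case: (e =P d) => [->|_]; last by rewrite !subn0.
  by rewrite lw.
case: ys ys_nolab => [|y ys] ys_nolab /=; first by rewrite min0n if_same subn0.
rewrite IH; last by move=> z zy; apply: ys_nolab; rewrite inE zy orbT.
rewrite ys_nolab ?mem_head //.
case: (e =P d) => [->|ne]; first by rewrite lw add0n add1n minnSS subSS.
rewrite !subn0 (eqP lw) (_ : (Some d == Some e) = false) //.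
by apply/eqP => -[] /esym.
Qed.

Lemma label_count_le d cs : (label_count d cs <= size cs)%N.
Proof. by rewrite (leq_trans (count_size _ _)) // size_map. Qed.

End FillMask.

(* The expectation of [\prod_i g_i (s_i)] for a stream [s] that first follows [cs],
   a label [d] standing for the next element of the [d]-th of [f] child streams, and
   then repeats labels drawn uniformly from the first [k] children. The law of child
   [d] is given by [Ds d], and [acc d] collects the functions already applied to its
   successive elements. *)
Section MergeLaw.
Variables (R : numFieldType) (T : eqType) (lab : T -> option nat) (f k : nat).
Implicit Types (gs : seq (T -> R)) (cs : seq T) (acc : nat -> seq (T -> R)).
Implicit Types Ds : nat -> seq (T -> R) -> R.

Definition push (A : Type) (acc : nat -> seq A) d g :=
  fun e => if e == d then rcons (acc e) g else acc e.

Fixpoint merge_law Ds gs cs acc : R :=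
  match gs, cs with
  | [::], _ => \prod_(d < f) Ds d (acc d)
  | g :: gs', [::] =>
      k%:R^-1 * \sum_(d < k) merge_law Ds gs' [::] (push acc d g)
  | g :: gs', w :: cs' =>
      if lab w is Some d then merge_law Ds gs' cs' (push acc d g)
      else g w * merge_law Ds gs' cs' acc
  end.

Lemma eq_merge_law Ds Ds' gs cs acc acc' :
  (forall d gs, (d < f)%N -> Ds d gs = Ds' d gs) -> acc =1 acc' ->
  merge_law Ds gs cs acc = merge_law Ds' gs cs acc'.
Proof.
move=> DsE; elim: gs cs acc acc' => [|g gs IH] cs acc acc' accE /=.
  by apply: eq_bigr => d _; rewrite accE DsE.
have pushE d : push acc d g =1 push acc' d g by move=> e; rewrite /push accE.
case: cs => [|w cs]; first by congr (_ * _); apply: eq_bigr => d _; apply: IH.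
by case: lab => [d|]; [apply: IH | rewrite (IH _ _ _ accE)].
Qed.

Lemma expect_merge_law (Om : eqType) (om : fdist R Om) d0
    (DD : Om -> nat -> seq (T -> R) -> R) Ds gs cs acc :
  (d0 < f)%N ->
  (forall w d gs, (d < f)%N -> d != d0 -> DD w d gs = Ds d gs) ->
  (forall gs, expect om (fun w => DD w d0 gs) = Ds d0 gs) ->
  expect om (fun w => merge_law (DD w) gs cs acc) = merge_law Ds gs cs acc.
Proof.
move=> d0f DD_other DD_d0; elim: gs cs acc => [|g gs IH] cs acc /=.
  rewrite [RHS](bigD1 (Ordinal d0f)) //= -DD_d0 -expectZr; apply: eq_expect => w.
  rewrite (bigD1 (Ordinal d0f)) //=; congr (_ * _).
  by apply: eq_bigr => d dn; apply: DD_other.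
case: cs => [|w cs].
  by rewrite expectZl expect_sum; congr (_ * _); apply: eq_bigr => d _; apply: IH.
by case: lab => [d|]; [exact: IH | rewrite expectZl IH].
Qed.

Lemma merge_law_labels Ds (mk : nat -> T) m gs acc :
  (0 < k)%N -> (forall d, (d < k)%N -> lab (mk d) = Some d) ->
  expect (iid m (uniform R k)) (fun ds => merge_law Ds gs (map mk ds) acc) =
  merge_law Ds gs [::] acc.
Proof.
move=> k0 mkP; elim: m gs acc => [|m IH] gs acc /=; first by rewrite expect_ret.
case: gs => [|g gs]; first by rewrite expect_cst //; exact: (fdist_iid m.+1 (fdist_uniform R k)).
rewrite expect_bind expect_uniform //=; congr (_ * _); apply: eq_bigr => d _.
by rewrite expect_map -IH; apply: eq_expect => ds /=; rewrite mkP.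
Qed.

Lemma merge_law_child Ds Ds' gs cs acc acc' d a :
  (d < f)%N -> (forall e, e != d -> acc e = acc' e) ->
  (forall e l, (e < f)%N -> e != d -> Ds e l = Ds' e l) ->
  (forall l, Ds d (acc d ++ l) = a * Ds' d (acc' d ++ l)) ->
  merge_law Ds gs cs acc = a * merge_law Ds' gs cs acc'.
Proof.
move=> df + DsE; elim: gs cs acc acc' => [|g gs IH] cs acc acc' accE Dsd /=.
  rewrite (bigD1 (Ordinal df)) //= [in RHS](bigD1 (Ordinal df)) //= mulrA.
  have := Dsd [::]; rewrite !cats0 => ->; congr (_ * _).
  by apply: eq_bigr => e ed; rewrite accE // DsE.
have IHpush d' cs' : merge_law Ds gs cs' (push acc d' g) =
    a * merge_law Ds' gs cs' (push acc' d' g).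
  apply: IH => [e ed|l]; first by rewrite /push accE.
  by rewrite /push; case: ifP => _; rewrite ?cat_rcons Dsd.
case: cs => [|w cs]; first by rewrite mulrCA; congr (_ * _); rewrite mulr_sumr; apply: eq_bigr.
by case: lab => [e|]; [exact: IHpush | rewrite (IH _ _ _ accE Dsd) mulrCA].
Qed.

Lemma merge_law_pick Ds d (avg : (T -> R) -> R) (Om : eqType) (om : fdist R Om)
    (pick : Om -> T) m gs cs acc :
  (d < f)%N -> is_fdist om -> (forall w, lab (pick w) = None) ->
  (forall g, expect om (g \o pick) = avg g) ->
  (forall l, Ds d l = \prod_(g <- l) avg g) ->
  (label_count lab d cs <= m)%N ->
  expect (iid m om) (fun ys => merge_law Ds gs
       (fill_mask (label_mask lab d cs) (map pick ys) cs) acc) =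
  merge_law Ds gs cs acc.
Proof.
move=> df om_fd pick_nolab pickE DsE; rewrite /label_count.
elim: gs m cs acc => [|g gs IH] m cs acc cs_m.
  by rewrite expect_cst //; apply: fdist_iid.
case: cs cs_m => [|w cs] cs_m.
  rewrite (@eq_expect _ _ _ _ (fun=> merge_law Ds (g :: gs) [::] acc)) //.
  by rewrite expect_cst //; apply: fdist_iid.
rewrite /= in cs_m *.
case: (lab w =P Some d) cs_m => [lw|nw] cs_m /=; last first.
  by case lw : (lab w) => [e|]; rewrite ?expectZl IH.
case: m cs_m => // m cs_m; rewrite lw /= expect_bind.
rewrite (@merge_law_child Ds Ds gs cs (push acc d g) acc d (avg g)) //.
- rewrite -pickE -expectZr; apply: eq_expect => x.
  rewrite expect_map -(IH m cs acc); last by rewrite -ltnS.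
  by rewrite -expectZl; apply: eq_expect => ys /=; rewrite pick_nolab.
- by move=> e /negPf ed; rewrite /push ed.
by move=> l; rewrite /push eqxx cat_rcons !DsE !big_cat big_cons /= mulrCA.
Qed.

Lemma merge_law_take1 Ds Ds' d y gs cs acc :
  (d < f)%N -> lab y = None ->
  (forall e l, (e < f)%N -> e != d -> Ds e l = Ds' e l) ->
  Ds d [::] = Ds' d [::] ->
  (forall g l, Ds d (g :: l) = g y * Ds' d l) -> acc d = [::] ->
  (0 < label_count lab d cs)%N ->
  merge_law Ds' gs (fill_mask (label_mask lab d cs) [:: y] cs) acc =
  merge_law Ds gs cs acc.
Proof.
move=> df ly DsE Ds_nil Ds_cons; rewrite /label_count.
elim: gs cs acc => [|g gs IH] cs acc acc_d d_cs.
  by apply: eq_bigr => e _; have [->|ed] := eqVneq (e : nat) d;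
     rewrite ?acc_d ?Ds_nil ?DsE.
case: cs d_cs => // w cs /=; case: (lab w =P Some d) => [lw|nw] /= d_cs; last first.
  case lw : (lab w) => [e|]; last by rewrite IH.
  apply: IH => //; rewrite /push; case: eqP => // de.
  by case: nw; rewrite lw de.
rewrite ly lw fill_mask_nil; symmetry; apply: (@merge_law_child _ _ _ _ _ _ d) => //.
  by move=> e /negPf ed; rewrite /push ed.
by move=> l; rewrite /push eqxx acc_d Ds_cons.
Qed.

Lemma merge_law_take Ds (Dd : seq T -> seq (T -> R) -> R) d rest gs ys cs :
  (d < f)%N -> (forall s, Dd s [::] = 1) ->
  {in ys, forall y s g l, Dd (y :: s) (g :: l) = g y * Dd s l} ->
  {in ys, forall y, lab y = None} -> (size ys <= label_count lab d cs)%N ->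
  merge_law (fun e => if e == d then Dd rest else Ds e) gs
    (fill_mask (label_mask lab d cs) ys cs) (fun=> [::]) =
  merge_law (fun e => if e == d then Dd (ys ++ rest) else Ds e) gs
    cs (fun=> [::]).
Proof.
move=> df Dd_nil; elim: ys cs => [|y ys IH] cs Dd_cons ys_nolab sz.
  by rewrite fill_mask_nil.
have y_nolab := ys_nolab y (mem_head _ _).
have sub_ys z : z \in ys -> z \in y :: ys by rewrite inE orbC => ->.
rewrite fill_mask_cons // IH.
- apply: merge_law_take1 => //=.
  + by move=> e l _ /negPf->.
  + by rewrite eqxx !Dd_nil.
  + by move=> g l; rewrite eqxx Dd_cons ?mem_head.
  exact: leq_ltn_trans sz.
- by move=> z /sub_ys; exact: Dd_cons.
- by move=> z /sub_ys; exact: ys_nolab.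
rewrite label_count_fill; last by move=> z; rewrite inE => /eqP->.
rewrite eqxx (minn_idPl _) /=; last exact: leq_ltn_trans sz.
by rewrite leq_subRL ?add1n // (leq_ltn_trans _ sz).
Qed.

Lemma merge_law_mean Ds (avg : nat -> (T -> R) -> R) gs acc :
  (k <= f)%N ->
  (forall d l, (d < f)%N -> Ds d l = \prod_(g <- l) avg d g) ->
  merge_law Ds gs [::] acc =
  \prod_(d < f) \prod_(g <- acc d) avg d g *
  \prod_(g <- gs) (k%:R^-1 * \sum_(d < k) avg d g).
Proof.
move=> kf DsE; elim: gs acc => [|g gs IH] acc /=.
  by rewrite big_nil mulr1; apply: eq_bigr => d _; rewrite DsE.
rewrite big_cons; set P := \prod_(d < f) _; set Q := \prod_(h <- gs) _.
transitivity (k%:R^-1 * \sum_(d < k) (P * Q * avg d g)); last first.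
  by rewrite -mulr_sumr; ring.
congr (_ * _); apply: eq_bigr => d _; rewrite IH mulrAC; congr (_ * _).
have df : (d < f)%N := leq_trans (ltn_ord d) kf.
rewrite /P (bigD1 (Ordinal df)) //= [in RHS](bigD1 (Ordinal df)) //=.
rewrite {1}/push eqxx -cats1 big_cat big_seq1 /=.
rewrite (eq_bigr (fun e : 'I_f => \prod_(h <- acc e) avg e h)); first by ring.
by move=> e /negPf ed; rewrite /push (_ : (e == d :> nat) = false).
Qed.

Lemma merge_law_fill Ds (avg : nat -> (T -> R) -> R) (Om : eqType)
    (om : fdist R Om) (pick : Om -> T) m gs acc :
  (k <= f)%N -> is_fdist om -> (forall w, lab (pick w) = None) ->
  (forall d l, (d < f)%N -> Ds d l = \prod_(g <- l) avg d g) ->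
  (forall g, expect om (g \o pick) = k%:R^-1 * \sum_(d < k) avg d g) ->
  expect (iid m om) (fun ys => merge_law Ds gs (map pick ys) acc) =
  merge_law Ds gs [::] acc.
Proof.
move=> kf om_fd pick_nolab DsE pickE.
elim: m gs acc => [|m IH] gs acc; first by rewrite expect_ret.
case: gs => [|g gs]; first by rewrite expect_cst //; apply: fdist_iid.
rewrite /iid -/iid expect_bind [RHS](merge_law_mean _ _ kf DsE) big_cons.
rewrite (@eq_expect _ _ _ _ (fun x => g (pick x) * merge_law Ds gs [::] acc)).
  by rewrite expectZr pickE (merge_law_mean _ _ kf DsE); ring.
move=> x; rewrite expect_map -IH -expectZl.
by apply: eq_expect => ys /=; rewrite pick_nolab.
Qed.

End MergeLaw.

(** * The law of the output of the tree *)

Section SetNode.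
Variable A : Type.
Implicit Types (F : nat -> nat -> A) (l i : nat).

Definition set_node F l i a : nat -> nat -> A :=
  fun l' i' => if (l' == l) && (i' == i) then a else F l' i'.

Lemma set_node_same F l i a : set_node F l i a l i = a.
Proof. by rewrite /set_node !eqxx. Qed.

Lemma set_node_other F l i a l' i' :
  ~~ ((l' == l) && (i' == i)) -> set_node F l i a l' i' = F l' i'.
Proof. by rewrite /set_node => /negPf ->. Qed.

Lemma set_node_below F l i a l' i' : (l' < l)%N -> set_node F l i a l' i' = F l' i'.
Proof. by move=> l'l; rewrite set_node_other // (ltn_eqF l'l). Qed.

End SetNode.

(* A tree of depth [L] whose root has [f0] children and whose other nodes have [f];
   child [d] of node [(l, i)] is [(l - 1, i * f + d)], and the leaf [(0, i)] is the
   block of the [b] table words from [i * b] on. [lab k w] is the child that the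
   word [w] designates in a node with [k] children. *)
Section Tree.
Variables (R : numFieldType) (T : eqType) (f f0 L b : nat).
Variables (lab : nat -> T -> option nat) (table : nat -> T).
Hypotheses (f_gt0 : (0 < f)%N) (f0_gt0 : (0 < f0)%N) (f0_le : (f0 <= f)%N)
  (b_gt0 : (0 < b)%N).
Implicit Types (buf : nat -> nat -> seq T) (gs : seq (T -> R)).

Definition fan (l : nat) : nat := if l == L then f0 else f.

Lemma fan_gt0 l : (0 < fan l)%N. Proof. by rewrite /fan; case: eqP. Qed.
Lemma fan_le l : (fan l <= f)%N. Proof. by rewrite /fan; case: eqP. Qed.

Definition block_mean (i : nat) (g : T -> R) : R :=
  b%:R^-1 * \sum_(t < b) g (table (i * b + t)).

Fixpoint tree_law buf (l i : nat) gs : R :=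
  match l with
  | 0%N => \prod_(g <- gs) block_mean i g
  | l'.+1 => merge_law (lab (fan l)) f (fan l)
      (fun d => tree_law buf l' (i * f + d)) gs (buf l i) (fun=> [::])
  end.

Definition node_law buf (l i : nat) (s : seq T) gs : R :=
  merge_law (lab (fan l.+1)) f (fan l.+1)
    (fun d => tree_law buf l (i * f + d)) gs s (fun=> [::]).

Lemma tree_lawS buf l i gs :
  tree_law buf l.+1 i gs = node_law buf l i (buf l.+1 i) gs.
Proof. by []. Qed.

Lemma tree_law_nil buf l i : tree_law buf l i [::] = 1.
Proof. by elim: l i => [|l IH] i /=; [rewrite big_nil | rewrite big1]. Qed.

Lemma eq_tree_law buf buf' l i gs :
  (forall l i, buf l i = buf' l i) -> tree_law buf l i gs = tree_law buf' l i gs.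
Proof.
by move=> bufE; elim: l i gs => [|l IH] i gs //=; rewrite bufE; exact: eq_merge_law.
Qed.

Lemma tree_law_set_above buf l i s l' i' gs : (l' < l)%N ->
  tree_law (set_node buf l i s) l' i' gs = tree_law buf l' i' gs.
Proof.
elim: l' i' gs => [|l' IH] i' gs l'l //=; rewrite set_node_below //.
by apply: eq_merge_law => // d gs' _; apply: IH; exact: ltnW.
Qed.

Lemma node_law_set_above buf l i s l' i' s' gs : (l' < l)%N ->
  node_law (set_node buf l i s) l' i' s' gs = node_law buf l' i' s' gs.
Proof. by move=> l'l; apply: eq_merge_law => // d gs' _; exact: tree_law_set_above. Qed.

Lemma tree_law_set buf l i s gs :
  tree_law (set_node buf l.+1 i s) l.+1 i gs = node_law buf l i s gs.
Proof. by rewrite tree_lawS set_node_same node_law_set_above. Qed.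

Lemma node_law_pop buf l i ys s g gs : {in ys, forall y, lab (fan l.+1) y = None} ->
  node_law buf l i (ys ++ s) (nseq (size ys) g ++ gs) =
  \prod_(y <- ys) g y * node_law buf l i s gs.
Proof.
elim: ys => [|y ys IH] ys_nolab /=; first by rewrite big_nil mul1r.
rewrite big_cons -mulrA -IH => [|z zys]; last by apply: ys_nolab; rewrite inE zys orbT.
by rewrite {1}/node_law /= ys_nolab ?mem_head.
Qed.

Definition below lv iv l i := (l <= lv)%N && (i %/ f ^ (lv - l) == iv)%N.

Definition related lv iv l i :=
  if (l <= lv)%N then (i %/ f ^ (lv - l) == iv)%N
  else (iv %/ f ^ (l - lv) == i)%N.

Lemma belowxx l i : below l i l i.
Proof. by rewrite /below leqnn subnn expn0 divn1 eqxx. Qed.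

Lemma below_child l i d : (d < f)%N -> below l.+1 i l (i * f + d).
Proof. by move=> df; rewrite /below leqnSn subSnn expn1 divnMDl // divn_small ?addn0 /=. Qed.

Lemma set_node_not_below A (F : nat -> nat -> A) lv iv l i a l' i' :
  below lv iv l i -> ~~ below lv iv l' i' -> set_node F l i a l' i' = F l' i'.
Proof.
by move=> li nli'; apply: set_node_other; apply: contra nli' => /andP[/eqP-> /eqP->].
Qed.

Lemma tree_law_unrelated buf buf' lv iv l i gs :
  (forall l i, ~~ below lv iv l i -> buf l i = buf' l i) ->
  ~~ related lv iv l i -> tree_law buf l i gs = tree_law buf' l i gs.
Proof.
move=> bufE; elim: l i gs => [|l IH] i gs //= not_related.
rewrite -bufE; last by move: not_related; rewrite /related /below; case: leqP.
apply: eq_merge_law => // d gs' df; apply: IH; move: not_related; rewrite /related.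
have parentE : ((i * f + d) %/ f = i)%N by rewrite divnMDl // divn_small ?addn0.
case: (ltngtP l lv) => [llv|lvl|lE].
- by rewrite -(subnSK llv) expnS divnMA parentE.
- rewrite subSn ?(ltnW lvl) // expnSr divnMA; apply: contra => /eqP->.
  by rewrite parentE.
rewrite lE subnn expn0 divn1 subSnn expn1; apply: contra => /eqP<-.
by rewrite parentE.
Qed.

Lemma expect_ancestor_law (Om : eqType) (om : fdist R Om)
    (bufs : Om -> nat -> nat -> seq T) buf lv iv :
  (forall w l i, ~~ below lv iv l i -> bufs w l i = buf l i) ->
  (forall gs, expect om (fun w => tree_law (bufs w) lv iv gs) = tree_law buf lv iv gs) ->
  forall k gs, expect om (fun w => tree_law (bufs w) (k + lv) (iv %/ f ^ k) gs) =
    tree_law buf (k + lv) (iv %/ f ^ k) gs.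
Proof.
move=> bufsE node_lawE; elim=> [|k IH] gs; first by rewrite expn0 divn1.
rewrite addSn /=.
set d0 := ((iv %/ f ^ k) %% f)%N.
have d0E : ((iv %/ f ^ k.+1) * f + d0 = iv %/ f ^ k)%N.
  by rewrite expnSr divnMA /d0 -divn_eq.
have d0f : (d0 < f)%N by rewrite ltn_mod.
under eq_expect => w.
  rewrite bufsE; last by rewrite /below leqNgt ltnS leq_addl.
  over.
apply: (@expect_merge_law _ _ _ _ _ _ _ d0) => //.
  move=> w d gs' df ne; apply: (@tree_law_unrelated _ _ lv iv).
    by move=> l i; apply: bufsE.
  rewrite /related; case: leqP => [kl|_].
    have k0 : k = 0%N by lia.
    subst k; rewrite add0n subnn expn0 divn1; apply: contra ne => /eqP E.
    by rewrite -(eqn_add2l (iv %/ f ^ 1 * f)) E d0E expn0 divn1.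
  rewrite addnK; apply: contra ne => /eqP E.
  by rewrite -(eqn_add2l (iv %/ f ^ k.+1 * f)) -E d0E.
by move=> gs'; rewrite d0E.
Qed.

Lemma expect_root_law (Om : eqType) (om : fdist R Om)
    (bufs : Om -> nat -> nat -> seq T) buf lv iv gs :
  (lv <= L)%N -> (iv < f ^ (L - lv))%N ->
  (forall w l i, ~~ below lv iv l i -> bufs w l i = buf l i) ->
  (forall gs, expect om (fun w => tree_law (bufs w) lv iv gs) = tree_law buf lv iv gs) ->
  expect om (fun w => tree_law (bufs w) L 0 gs) = tree_law buf L 0 gs.
Proof.
move=> lL iL bufsE node_lawE; have := expect_ancestor_law bufsE node_lawE (L - lv) gs.
by rewrite subnK // divn_small.
Qed.

Lemma tree_law_labels (mk : nat -> T) buf l i m gs :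
  (0 < l)%N -> (l <= L)%N -> (i < f ^ (L - l))%N ->
  (forall d, (d < fan l)%N -> lab (fan l) (mk d) = Some d) ->
  expect (iid m (uniform R (fan l)))
    (fun ds => tree_law (set_node buf l i (map mk ds)) L 0 gs) =
  tree_law (set_node buf l i [::]) L 0 gs.
Proof.
move=> l0 lL iL mkP; apply: (expect_root_law _ lL iL) => [w l' i' nb|gs'].
  by rewrite !(set_node_not_below _ _ (belowxx l i)).
case: l l0 {lL iL} mkP => // l _ mkP; rewrite tree_law_set.
by under eq_expect do rewrite tree_law_set; exact: merge_law_labels (fan_gt0 _) mkP.
Qed.

Lemma tree_law_pick buf i d m gs :
  (0 < L)%N -> (i < f ^ (L - 1))%N -> (d < f)%N ->
  (forall s, lab (fan 1) (table s) = None) ->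
  (label_count (lab (fan 1)) d (buf 1%N i) <= m)%N ->
  expect (iid m (uniform R b)) (fun ts => tree_law (set_node buf 1 i
     (fill_mask (label_mask (lab (fan 1)) d (buf 1%N i))
        [seq table ((i * f + d) * b + t) | t <- ts] (buf 1%N i))) L 0 gs) =
  tree_law buf L 0 gs.
Proof.
move=> L0 iL df table_nolab cm; apply: (expect_root_law _ L0 iL) => [w l' i' nb|gs'].
  by rewrite !(set_node_not_below _ _ (belowxx 1 i)).
under eq_expect do rewrite tree_law_set.
apply: (@merge_law_pick _ _ _ _ _ _ d (block_mean (i * f + d)) _ (uniform R b)
  (fun t => table ((i * f + d) * b + t))) => //; first exact: fdist_uniform.
by move=> g; rewrite expect_uniform.
Qed.

Lemma tree_law_take buf l i d ys rest gs :
  (0 < l)%N -> (l < L)%N -> (i < f ^ (L - l.+1))%N -> (d < f)%N ->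
  buf l (i * f + d)%N = ys ++ rest ->
  {in ys, forall y, lab (fan l.+1) y = None /\ lab (fan l) y = None} ->
  (size ys <= label_count (lab (fan l.+1)) d (buf l.+1 i))%N ->
  tree_law (set_node (set_node buf l.+1 i
     (fill_mask (label_mask (lab (fan l.+1)) d (buf l.+1 i)) ys (buf l.+1 i)))
     l (i * f + d) rest) L 0 gs = tree_law buf L 0 gs.
Proof.
move=> l0 lL iL df childE ys_nolab sz; set s' := fill_mask _ _ _.
set buf' := set_node _ _ _ rest; rewrite -[LHS](expect_ret tt (fun=> tree_law buf' L 0 gs)).
apply: (@expect_root_law unit _ (fun=> buf') buf l.+1 i) => // [_ l' i' nb|gs'].
  by rewrite /buf' !(set_node_not_below _ _ _ nb) ?belowxx ?below_child.
rewrite expect_ret.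
case: l l0 {lL iL} childE ys_nolab sz @s' @buf' => // l _ childE ys_nolab sz s' buf'.
have -> : tree_law buf' l.+2 i gs' = node_law buf' l.+1 i s' gs'.
  rewrite tree_lawS {2}/buf' set_node_other ?set_node_same //.
  by rewrite eqn_leq ltnn.
rewrite tree_lawS /node_law.
pose child_law s := node_law buf l (i * f + d) s.
rewrite (@eq_merge_law _ _ _ _ _ _ (fun e => if e == d then child_law rest else
   tree_law buf l.+1 (i * f + e)) _ _ _ (fun=> [::])) //; last first.
  move=> e gs2 ef; rewrite tree_lawS {2}/buf'; case: eqP => [->|ne].
    by rewrite set_node_same /buf' !node_law_set_above.
  rewrite set_node_other; last by rewrite eqxx eqn_add2l; apply/eqP.
  by rewrite set_node_below // /buf' !node_law_set_above.
rewrite merge_law_take // => [|s|y ys_y s g gs2|y /ys_nolab[]//].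
- apply: eq_merge_law => // e gs2 ef; case: eqP => // ->.
  by rewrite tree_lawS childE.
- by rewrite /child_law /node_law /= big1 // => e _; rewrite tree_law_nil.
by rewrite /child_law /node_law /= (ys_nolab y ys_y).2.
Qed.

Fixpoint node_mean (l i : nat) (g : T -> R) : R :=
  if l is l'.+1 then (fan l)%:R^-1 * \sum_(d < fan l) node_mean l' (i * f + d) g
  else block_mean i g.

Fixpoint leaf_dist (l i : nat) : fdist R nat :=
  if l is l'.+1 then dbind (uniform R (fan l)) (fun d => leaf_dist l' (i * f + d))
  else dmap (fun t => i * b + t)%N (uniform R b).

Lemma fdist_leaf_dist l i : is_fdist (leaf_dist l i).
Proof.
elim: l i => [|l IH] i; first by apply: fdist_map; exact: fdist_uniform.
by apply: fdist_bind => [|d]; [exact: fdist_uniform | exact: IH].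
Qed.

Lemma expect_leaf_dist l i g : expect (leaf_dist l i) (g \o table) = node_mean l i g.
Proof.
elim: l i => [|l IH] i; first by rewrite expect_map expect_uniform.
rewrite [leaf_dist _ _]/= expect_bind expect_uniform ?fan_gt0 //.
by congr (_ * _); apply: eq_bigr.
Qed.

Lemma tree_law_empty buf l i gs :
  (forall l' i', (l' <= l)%N -> buf l' i' = [::]) ->
  tree_law buf l i gs = \prod_(g <- gs) node_mean l i g.
Proof.
elim: l i gs => [|l IH] i gs buf0 //=; rewrite buf0 //.
rewrite (@merge_law_mean _ _ _ _ _ _ (fun d g => node_mean l (i * f + d) g)) ?fan_le //.
  by rewrite big1 ?mul1r // => d _; rewrite big_nil.
by move=> d gs' _; apply: IH => l' i' l'l; apply: buf0; apply: leqW.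
Qed.

Fixpoint fill_nodes (ns : seq (nat * nat)) buf : fdist R (nat -> nat -> seq T) :=
  if ns is n :: ns' then
    dbind (iid (fan n.1 * b) (leaf_dist n.1 n.2))
      (fun ys => fill_nodes ns' (set_node buf n.1 n.2 (map table ys)))
  else dret R buf.

Lemma fdist_fill_nodes ns buf : is_fdist (fill_nodes ns buf).
Proof.
elim: ns buf => [|n ns IH] buf; first exact: fdist_ret.
apply: fdist_bind => [|ys]; last exact: IH.
by apply: fdist_iid; exact: fdist_leaf_dist.
Qed.

Lemma surely_fill_nodes ns buf :
  surely (fill_nodes ns buf) (fun buf' => forall l i,
    if (l, i) \in ns then exists2 ys, buf' l i = map table ys & size ys = (fan l * b)%N
    else buf' l i = buf l i).
Proof.
elim: ns buf => [|[l0 i0] ns IH] buf /=; first exact: surely_ret.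
apply: surely_bind => ys ys_iid buf' buf'_fill l i.
have [ys_size _] : size ys = (fan l0 * b)%N /\ all predT ys.
  exact: (@surely_iid _ _ _ (leaf_dist l0 i0) predT _ ys ys_iid).
have := IH _ buf' buf'_fill l i; rewrite inE xpair_eqE.
case: (boolP ((l, i) \in ns)) => _; first by rewrite orbT.
rewrite orbF => ->; rewrite /set_node.
by case: (boolP ((l == l0) && (i == i0))) => // /andP[/eqP-> _]; exists ys.
Qed.

Lemma tree_law_fill buf l i gs :
  (0 < l)%N -> (l <= L)%N -> (i < f ^ (L - l))%N ->
  (forall l' i', (l' < l)%N -> buf l' i' = [::]) -> buf l i = [::] ->
  (forall s, lab (fan l) (table s) = None) ->
  expect (iid (fan l * b) (leaf_dist l i))
    (fun ys => tree_law (set_node buf l i (map table ys)) L 0 gs) = tree_law buf L 0 gs.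
Proof.
move=> l0 lL iL empty_below empty_node table_nolab.
apply: (expect_root_law _ lL iL) => [w l' i' nb|gs'].
  by rewrite !(set_node_not_below _ _ (belowxx l i)).
case: l l0 {lL iL} empty_below empty_node table_nolab => // l _ empty_below empty_node table_nolab.
under eq_expect do rewrite tree_law_set.
rewrite tree_lawS empty_node.
apply: (@merge_law_fill _ _ _ _ _ _ (fun d => node_mean l (i * f + d))) => //.
- exact: fan_le.
- exact: fdist_leaf_dist.
- by move=> d gs2 _; apply: tree_law_empty => l' i' l'l; exact: empty_below.
by move=> g; rewrite expect_leaf_dist.
Qed.

(* Filling top down, every subtree below the filled node is still empty. *)
Lemma expect_fill_nodes ns buf gs :
  uniq ns -> sorted (fun n n' => n'.1 <= n.1)%N ns ->
  {in ns, forall n, [/\ (0 < n.1)%N, (n.1 <= L)%N & (n.2 < f ^ (L - n.1))%N]} ->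
  {in ns, forall n l i, (l < n.1)%N -> buf l i = [::]} ->
  {in ns, forall n, buf n.1 n.2 = [::]} ->
  (forall l s, lab (fan l) (table s) = None) ->
  expect (fill_nodes ns buf) (fun buf' => tree_law buf' L 0 gs) = tree_law buf L 0 gs.
Proof.
move=> + + + + + table_nolab; elim: ns buf => [|[l i] ns IH] buf /=.
  by rewrite expect_ret.
move=> /andP[nns ns_uniq] ns_sorted valid empty_below empty_node.
have level_trans : transitive (fun n n' : nat * nat => (n'.1 <= n.1)%N).
  by move=> ? ? ? le1 le2; apply: leq_trans le2 le1.
have all_le := order_path_min level_trans ns_sorted.
have sub_ns n : n \in ns -> n \in (l, i) :: ns by rewrite inE orbC => ->.
rewrite expect_bind (@eq_expect _ _ _ _
  (fun ys => tree_law (set_node buf l i (map table ys)) L 0 gs)); last first.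
  move=> ys; apply: IH => //; first exact: path_sorted ns_sorted.
  - by move=> n /sub_ns; exact: valid.
  - move=> n nn l' i' l'n; rewrite set_node_below; last first.
      by have /= := allP all_le _ nn; exact: leq_trans.
    exact: empty_below (sub_ns n nn) _ _ l'n.
  move=> n nn; rewrite set_node_other; first exact: empty_node (sub_ns n nn).
  by apply: contra nns => /andP[/eqP<- /eqP<-]; rewrite -surjective_pairing.
have [/= l0 lL iL] := valid (l, i) (mem_head _ _).
apply: tree_law_fill => //; first by move=> l' i'; exact: empty_below (mem_head _ _) _ _.
exact: empty_node (mem_head _ _).
Qed.

Lemma node_meanE l i g : (l < L)%N ->
  node_mean l i g = (f ^ l * b)%:R^-1 *
    \sum_(s < f ^ l * b) g (table (i * (f ^ l * b) + s)).
Proof.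
elim: l i => [|l IH] i lL /=; first by rewrite expn0 mul1n.
have -> : fan l.+1 = f by rewrite /fan ltn_eqF.
under eq_bigr => d _ do rewrite IH ?(ltnW lL) //.
rewrite -mulr_sumr mulrA -invfM -natrM mulnA -expnS; congr (_ * _).
rewrite expnS -mulnA (big_ord_mul _ (fun s => g (table (i * (f * (f ^ l * b)) + s)))).
apply: eq_bigr => d _; apply: eq_bigr => t _; congr (g (table _)).
by rewrite mulnDl addnA -mulnA.
Qed.

Lemma root_meanE g : (0 < L)%N ->
  node_mean L 0 g = (f0 * (f ^ L.-1 * b))%:R^-1 *
    \sum_(s < f0 * (f ^ L.-1 * b)) g (table s).
Proof.
move=> L0; rewrite -{1}(prednK L0) /= /fan prednK // eqxx.
under eq_bigr => d _ do rewrite node_meanE ?prednK //.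
rewrite -mulr_sumr mulrA -invfM -natrM; congr (_ * _).
rewrite (big_ord_mul _ (fun s => g (table s))).
by apply: eq_bigr => d _; apply: eq_bigr => t _.
Qed.

End Tree.

(** * The program *)

Fixpoint of_digits (Q : nat) (s : seq nat) : nat :=
  if s is x :: s' then (x + Q * of_digits Q s')%N else 0%N.

Definition digit (Q k v : nat) : nat := ((v %/ Q ^ k) %% Q)%N.

Lemma digit_of_digits Q s k : all (fun x => x < Q)%N s -> (k < size s)%N ->
  digit Q k (of_digits Q s) = nth 0%N s k.
Proof.
elim: s k => [|x s IH] // k /= /andP[xQ sQ] ks.
have Q0 : (0 < Q)%N by apply: leq_trans xQ.
case: k ks => [|k] ks; rewrite /digit.
  by rewrite expn0 divn1 addnC mulnC modnMDl modn_small.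
by rewrite expnS divnMA addnC mulnC divnMDl // (divn_small xQ) addn0 [RHS]/= -IH.
Qed.

Lemma of_digits_lt Q s :
  all (fun x => x < Q)%N s -> (of_digits Q s < Q ^ size s)%N.
Proof.
elim: s => [|x s IH] //= /andP[xQ /IH]; rewrite expnS => s_lt.
apply: leq_trans (_ : Q * (of_digits Q s).+1 <= _)%N.
  by rewrite mulnS ltn_add2r.
by rewrite leq_mul2l s_lt orbT.
Qed.

(* [x] is the number of samples already taken from the buffer of the root, and [N]
   the number of samples that the query still needs. [Direct s N]: table slot [s] has
   been read, for a tree of depth 0; [HeavyScan j x]: heavy block [j] has been read;
   [TableScan s t x]: slot [s] has been read, and the slots from [s] on must contain
   [t] points at least. The other states refill the buffer of node [(l, i)], saving
   or loading its [j]-th part. *)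
Inductive state :=
  | Idle of nat
  | Direct of nat & nat
  | HeavyScan of nat & nat
  | TableScan of nat & nat & nat
  | Label of nat & nat & nat
  | Gather of nat & nat & nat
  | Take of nat & nat & nat & nat
  | SaveDown of nat & nat & nat & nat & nat
  | SaveUp of nat & nat & nat & nat
  | LoadDown of nat & nat & nat & nat
  | LoadUp of nat & nat & nat & nat.

Definition is_idle (s : state) : bool := if s is Idle _ then true else false.

Definition digits_of_state (s : state) : seq nat :=
  match s with
  | Idle x => [:: 0; x; 0; 0; 0; 0]
  | Direct s N => [:: 1; s; N; 0; 0; 0]
  | HeavyScan j x => [:: 2; j; x; 0; 0; 0]
  | TableScan s t x => [:: 3; s; t; x; 0; 0]
  | Label l i N => [:: 4; l; i; N; 0; 0]
  | Gather l i N => [:: 5; l; i; N; 0; 0]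
  | Take l i d N => [:: 6; l; i; d; N; 0]
  | SaveDown l i d j N => [:: 7; l; i; d; j; N]
  | SaveUp l i j N => [:: 8; l; i; j; N; 0]
  | LoadDown l i j N => [:: 9; l; i; j; N; 0]
  | LoadUp l i j N => [:: 10; l; i; j; N; 0]
  end%N.

Definition state_of_digits (g : nat -> nat) : state :=
  match g 0%N with
  | 0 => Idle (g 1)
  | 1 => Direct (g 1) (g 2)
  | 2 => HeavyScan (g 1) (g 2)
  | 3 => TableScan (g 1) (g 2) (g 3)
  | 4 => Label (g 1) (g 2) (g 3)
  | 5 => Gather (g 1) (g 2) (g 3)
  | 6 => Take (g 1) (g 2) (g 3) (g 4)
  | 7 => SaveDown (g 1) (g 2) (g 3) (g 4) (g 5)
  | 8 => SaveUp (g 1) (g 2) (g 3) (g 4)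
  | 9 => LoadDown (g 1) (g 2) (g 3) (g 4)
  | _ => LoadUp (g 1) (g 2) (g 3) (g 4)
  end%N.

Definition label_of (W : nat) (A : Type) (k : nat) (w : A + 'I_W) : option nat :=
  if w is inr a then if (a < k)%N then Some (a : nat) else None else None.

Definition first_label (W : nat) (A : Type) k (ws : seq (A + 'I_W)) : option nat :=
  ohead (pmap (label_of k) ws).

Section Rates.
Variable R : realType.
Implicit Types x th : R.

Definition clamp x : R := Num.max 0 (Num.min 1 x).

Definition prob_of_word (A : Type) (w : R + A) : R := if w is inl x then clamp x else 0.

Lemma clamp01 x : 0 <= clamp x <= 1.
Proof. by rewrite le_max lexx /= ge_max ler01 ge_min lexx. Qed.

Lemma prob_of_word01 (A : Type) (w : R + A) : 0 <= prob_of_word w <= 1.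
Proof. by case: w => [x|a]; rewrite /= ?clamp01 // lexx ler01. Qed.

Lemma clampE x : 0 <= x <= 1 -> clamp x = x.
Proof. by move=> /andP[x0 x1]; rewrite /clamp (min_idPr x1) (max_idPr x0). Qed.

(* A Poisson process of this rate has a point with probability [x]. *)
Definition rate_of_prob x : R := - ln (1 - x).

(* A record of probability [x] occupies more than [rate_of_prob x / th] slots of
   rate [th] each, and is accepted with the probability that makes up for it. *)
Definition slot_count th x : nat := (Num.truncn (rate_of_prob x / th)).+1.

Definition accept_prob th x : R := rate_of_prob x / (th * (slot_count th x)%:R).

Lemma rate_of_prob_ge0 x : 0 <= x -> 0 <= rate_of_prob x.
Proof. by move=> x0; rewrite oppr_ge0 ln_le0 // gerBl. Qed.

Lemma expR_rate_of_prob x : x < 1 -> expR (- rate_of_prob x) = 1 - x.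
Proof. by move=> x1; rewrite opprK lnK // posrE subr_gt0. Qed.

Lemma accept_probE th x : 0 < th -> 0 <= x ->
  (slot_count th x)%:R * (th * clamp (accept_prob th x)) = rate_of_prob x.
Proof.
move=> th_gt0 x0; have rate_ge0 := rate_of_prob_ge0 x0.
have slots_gt0 : 0 < (slot_count th x)%:R :> R by rewrite ltr0n.
rewrite clampE /accept_prob; last first.
  rewrite divr_ge0 ?mulr_ge0 ?(ltW th_gt0) //= ler_pdivrMr ?mulr_gt0 // mul1r mulrC.
  by rewrite -ler_pdivrMr //; apply: ltW; exact: truncnS_gt.
by field; rewrite ?(gt_eqF slots_gt0) ?(gt_eqF th_gt0).
Qed.

End Rates.

(* A machine with [mem_pred + 1] memory cells, [disk_pred + 1] blocks of
   [block_pred + 1] words each, and integers up to [word_pred], and what the program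
   may depend on besides these sizes: a block holds [chunk] items and possibly a
   counter, and [root_fanout = 0] means that there is no tree. *)
Record layout (R : realType) := Layout {
  mem_pred : nat;
  block_pred : nat;
  disk_pred : nat;
  word_pred : nat;
  radix : nat;
  max_draws : nat;
  rate_unit : R;
  chunk : nat;
  resident : nat;
  fanout : nat;
  root_fanout : nat;
  depth : nat;
  table_blocks : nat;
  heavy_blocks : nat
}.

Section Program.
Variables (R : realType) (P : layout R).

Notation M := (mem_pred P).+1.
Notation B := (block_pred P).+1.
Notation K := (disk_pred P).+1.
Notation W := (word_pred P).+1.
Notation Q := (radix P).
Notation J := (max_draws P).
Notation b := (chunk P).
Notation f := (fanout P).
Notation f0 := (root_fanout P).
Notation L := (depth P).
Notation tb := (table_blocks P).
Notation fan := (fan f f0 L).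
Notation act := (action M B K W).

Definition slots : nat := (tb * b)%N.

Definition level_size (l : nat) : nat := if l == L then 1%N else (f0 * f ^ (L.-1 - l))%N.

Definition level_start (l : nat) : nat := (\sum_(k < l) level_size k)%N.

(* Memory cell 0 holds the control word; a block that is scanned goes to the cells
   from 1 on, up to cell [1 + junk_offset], which receives what is not scanned; then
   come the resident heavy records, the buffer of the current node, and the read
   positions of its children. *)
Definition junk_offset : nat := minn b (block_pred P).
Definition heavy_base : nat := junk_offset.+2.
Definition buffer_base : nat := (heavy_base + resident P)%N.
Definition counter_base : nat := (buffer_base + f * b)%N.

(* The table and the heavy records are followed on the disk by one block for every
   node but the root: the block of the [d]-th child of a node contains the [d]-th part
   of the buffer of this node, and the read position of the child. *)
Definition part_block (l i : nat) : nat := (tb + heavy_blocks P + level_start l + i)%N.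

Definition cell (a : nat) : 'I_M := inord a.
Definition block (a : nat) : 'I_K := inord a.
Definition number (a : nat) : 'I_W := inord a.

Definition scan_map : {ffun 'I_B -> 'I_M} :=
  [ffun j : 'I_B => cell (1 + minn j junk_offset)].

Definition part_map (d : nat) : {ffun 'I_B -> 'I_M} :=
  [ffun j : 'I_B => cell (if (j < b)%N then buffer_base + d * b + j
                          else if j == b :> nat then counter_base + d else 1)%N].

Definition read_table (be : nat) : io M B K := Read (block be) scan_map.
Definition read_heavy (j : nat) : io M B K := Read (block (tb + j)) scan_map.
Definition read_part (l i : nat) : io M B K := Read (block (part_block l i)) scan_map.
Definition load_part (l i d : nat) : io M B K :=
  Read (block (part_block l.-1 (i * f + d))) (part_map d).
Definition save_part (l i d : nat) : io M B K :=
  Write (block (part_block l.-1 (i * f + d))) (part_map d).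

Definition slot_rate (rate_mul : nat) : R := rate_mul%:R * rate_unit P.

Definition table_rate (rate_mul : nat) : R := slots%:R * slot_rate rate_mul.

(* The control word also encodes what the program must know about the instance: the
   number [used] of blocks of heavy records in use, and the rate of the table slots as
   a multiple [rate_mul] of the unit. *)
Section Steps.
Variables (used rate_mul : nat).

Definition control_word (s : state) : nat := of_digits Q [:: used, rate_mul & digits_of_state s].

Definition act_with (reports : seq nat) (src : nat -> nat + nat) (s : state)
    (i : io M B K) : act :=
  ([set x : 'I_M | (x : nat) \in reports],
   [ffun x : 'I_M => if x == 0 :> nat then inr (number (control_word s))
      else match src x with inl y => inl (cell y) | inr k => inr (number k) end],
   i).

Definition goto reports s i : act := act_with reports inl s i.

Definition finish_state (x : nat) : state :=
  if used == 0%N then Idle x else HeavyScan 0 x.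

Definition finish reports (x : nat) : act :=
  goto reports (finish_state x) (if used == 0%N then Halt _ _ _ else read_heavy 0).

Definition refill (l : nat) (ws : seq (nat + nat)) (a : nat) : nat + nat :=
  if (buffer_base <= a < buffer_base + fan l * b)%N
  then nth (inl a) ws (a - buffer_base) else inl a.

Definition set_counter (src : nat -> nat + nat) (d x a : nat) : nat + nat :=
  if a == (counter_base + d)%N then inr x else src a.

Definition buffer_cells (l : nat) : seq nat := iota buffer_base (fan l * b).

(* Where no transfer is needed, the program reads the first block of the table. *)
Definition label_act l i N (ds : seq nat) : act :=
  act_with [::] (refill l [seq inr d | d <- ds]) (Gather l i N) (read_table 0).

Definition replace (l : nat) (mask : seq bool) (cells : seq nat) : nat -> nat + nat :=
  refill l (fill_mask mask [seq inl a | a <- cells] [seq inl a | a <- buffer_cells l]).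

Definition after_save_down l i d j N : state :=
  if (j.+1 < fan l)%N then SaveDown l i d j.+1 N else LoadDown l.-1 (i * f + d) 0 N.

Definition after_save_up l i j N : state :=
  if (j.+1 < fan l)%N then SaveUp l i j.+1 N else LoadUp l.+1 (i %/ f) 0 N.

Definition after_load_down l i j N : state :=
  if (j.+1 < fan l)%N then LoadDown l i j.+1 N else Label l i N.

Definition after_load_up l i j N : state :=
  if (j.+1 < fan l)%N then LoadUp l i j.+1 N else Gather l i N.

Section View.
Variable u : view R M W.

Definition view_at (a : nat) : R + 'I_W := u (cell a).
Definition number_at (a : nat) : nat := if view_at a is inr k then k : nat else 0%N.
Definition prob_at (a : nat) : R := prob_of_word (view_at a).
Definition accept_at (a : nat) : R :=
  if view_at a is inl x then clamp (accept_prob (slot_rate rate_mul) x) else 0.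

Definition draw (reports : seq nat) (N x : nat) : fdist R act :=
  let live := (fan L * b - x)%N in
  dbind (thin [seq (accept_at a, a) | a <- iota (buffer_base + x) (minn N live)])
    (fun D =>
    if (N <= live)%N then dret R (finish (D ++ reports) (x + N))
    else if f0 == 0%N then
      dmap (fun s => goto (D ++ reports) (Direct s N.-1) (read_table (s %/ b)))
        (uniform R slots)
    else dret R (goto (D ++ reports) (Label L 0 (N - live)) (read_table 0))).

Definition start (reports : seq nat) (N x : nat) : fdist R act :=
  if N == J.+1 then dret R (goto reports (TableScan 0 J.+1 x) (read_table 0))
  else draw reports N x.

Definition buffer_view (l : nat) : seq (R + 'I_W) := [seq view_at a | a <- buffer_cells l].

Definition label_mask_at l d : seq bool := label_mask (@label_of W R (fan l)) d (buffer_view l).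

Definition descend_act l i d N : act :=
  let x := number_at (counter_base + d) in
  if l == 1%N then goto [::] (Take l i d N) (read_table (i * f + d))
  else if (x < fan l.-1 * b)%N then
    goto [::] (Take l i d N) (read_part l.-2 ((i * f + d) * f + x %/ b))
  else act_with [::] (set_counter inl d 0) (SaveDown l i d 0 N) (read_table 0).

Definition pick_act l i d N (ts : seq nat) : act :=
  act_with [::] (replace l (label_mask_at l d) [seq (1 + t)%N | t <- ts])
    (Gather l i N) (read_table 0).

Definition take_act l i d N : act :=
  let x := number_at (counter_base + d) in
  let k := minn (b - x %% b) (count id (label_mask_at l d)) in
  act_with [::] (set_counter (replace l (label_mask_at l d) (iota (1 + x %% b) k)) d (x + k))
    (Gather l i N) (read_table 0).

Definition step (s : state) : fdist R act :=
  match s with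
  | Idle x =>
      dbind (thin [seq (prob_at a, a) | a <- iota heavy_base (resident P)]) (fun D =>
      dbind (or_else 0%N (truncated_poisson J (table_rate rate_mul))) (fun N => start D N x))
  | Direct s N =>
      dbind (thin [seq (accept_at a, a) | a <- [:: (1 + s %% b)%N]]) (fun D => draw D N 0)
  | HeavyScan j x =>
      dmap (fun D =>
        if (j.+1 < used)%N then goto D (HeavyScan j.+1 x) (read_heavy j.+1)
        else goto D (Idle x) (Halt _ _ _))
      (thin [seq (prob_at a, a) | a <- iota 1 b])
  | TableScan s t x =>
      let a := (1 + s %% b)%N in
      dmap (fun z =>
        let reports := if z.1 then [:: a] else [::] in
        if (s.+1 < slots)%N
        then goto reports (TableScan s.+1 z.2 x) (read_table (s.+1 %/ b))
        else finish reports x)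
      (or_else (false, 0%N) (scan_dist (slot_rate rate_mul)
         ((slots - s.+1)%:R * slot_rate rate_mul) t (accept_at a)))
  | Label l i N => dmap (label_act l i N) (iid (fan l * b) (uniform R (fan l)))
  | Gather l i N =>
      if first_label (fan l) (buffer_view l) is Some d then dret R (descend_act l i d N)
      else if l == L then draw [::] N 0
      else dret R (goto [::] (SaveUp l i 0 N) (read_table 0))
  | Take l i d N =>
      if l == 1%N then dmap (pick_act l i d N) (iid (fan l * b) (uniform R b))
      else dret R (take_act l i d N)
  | SaveDown l i d j N => dret R (goto [::] (after_save_down l i d j N) (save_part l i j))
  | SaveUp l i j N => dret R (goto [::] (after_save_up l i j N) (save_part l i j))
  | LoadDown l i j N => dret R (goto [::] (after_load_down l i j N) (load_part l i j))
  | LoadUp l i j N => dret R (goto [::] (after_load_up l i j N) (load_part l i j))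
  end.

Lemma fdist_thin_map (q : nat -> R) r :
  (forall a, 0 <= q a <= 1) -> is_fdist (thin [seq (q a, a) | a <- r]).
Proof. by move=> q01; apply: fdist_thin; rewrite all_map; apply/allP => a _; exact: q01. Qed.

Lemma accept_at01 a : 0 <= accept_at a <= 1.
Proof. by rewrite /accept_at; case: view_at => [x|_]; rewrite ?clamp01 // lexx ler01. Qed.

Lemma fdist_draw reports N x : is_fdist (draw reports N x).
Proof.
apply: fdist_bind => [|D]; first by apply: fdist_thin_map; exact: accept_at01.
case: leqP => _; first exact: fdist_ret.
case: eqP => _; last exact: fdist_ret.
by apply: fdist_map; exact: fdist_uniform.
Qed.

Lemma fdist_start reports N x : is_fdist (start reports N x).
Proof. by rewrite /start; case: eqP => _; [exact: fdist_ret | exact: fdist_draw]. Qed.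

Lemma fdist_step s : is_fdist (step s).
Proof.
case: s => [x|s N|j x|s t x|l i N|l i N|l i d N|l i d j N|l i j N|l i j N|l i j N];
  try exact: fdist_ret.
- apply: fdist_bind => [|D]; first by apply: fdist_thin_map => a; exact: prob_of_word01.
  by apply: fdist_bind => [|N]; [exact: fdist_or_else | exact: fdist_start].
- apply: fdist_bind => [|D]; last exact: fdist_draw.
  by apply: fdist_thin_map; exact: accept_at01.
- by apply: fdist_map; apply: fdist_thin_map => a; exact: prob_of_word01.
- by apply: fdist_map; exact: fdist_or_else.
- by apply: fdist_map; apply: fdist_iid; exact: fdist_uniform.
- rewrite /=; case: first_label => [d|]; first exact: fdist_ret.
  by case: eqP => _; [exact: fdist_draw | exact: fdist_ret].
rewrite /=; case: eqP => _; last exact: fdist_ret.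
by apply: fdist_map; apply: fdist_iid; exact: fdist_uniform.
Qed.

End View.
End Steps.

Definition sampler (u : view R M W) : fdist R act :=
  let g k := digit Q k (number_at u 0) in
  step (g 0%N) (g 1%N) u (state_of_digits (fun k => g k.+2)).

Lemma fdist_sampler u : is_fdist (sampler u).
Proof. exact: fdist_step. Qed.

End Program.

(** * Invariants of the machine *)

Lemma ltn_muladd (b d e t : nat) : (t < b)%N -> (d < e)%N -> (d * b + t < e * b)%N.
Proof.
move=> t_lt de; apply: leq_trans (_ : d.+1 * b <= _)%N; last by rewrite leq_mul2r de orbT.
by rewrite mulSn addnC ltn_add2r.
Qed.

Section Machine.
Variables (R : realType) (P : layout R) (S : finType) (p : S -> R).

Notation M := (mem_pred P).+1.
Notation B := (block_pred P).+1.
Notation K := (disk_pred P).+1.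
Notation W := (word_pred P).+1.
Notation Q := (radix P).
Notation J := (max_draws P).
Notation b := (chunk P).
Notation hm := (resident P).
Notation f := (fanout P).
Notation f0 := (root_fanout P).
Notation L := (depth P).
Notation tb := (table_blocks P).
Notation hmax := (heavy_blocks P).
Notation fan := (fan f f0 L).
Notation slots := (slots P).
Notation level_size := (level_size P).
Notation level_start := (level_start P).
Notation junk_offset := (junk_offset P).
Notation heavy_base := (heavy_base P).
Notation buffer_base := (buffer_base P).
Notation counter_base := (counter_base P).
Notation part_block := (part_block P).
Notation buffer_cells := (buffer_cells P).
Notation scan_map := (scan_map P).
Notation part_map := (part_map P).
Notation refill := (refill P).
Notation replace := (replace P).
Notation set_counter := (set_counter P).
Notation cell := (cell P).
Notation block := (block P).
Notation number := (number P).
Notation after_save_down := (after_save_down P).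
Notation after_save_up := (after_save_up P).
Notation after_load_down := (after_load_down P).
Notation after_load_up := (after_load_up P).
Notation act := (action M B K W).
Notation word := (S + 'I_W)%type.
Notation mem := (memory M W S).
Notation dsk := (disk B K W S).
Notation cfg := (config M B K W S).
Notation next c a := (@next_config M B K W S a c).
Implicit Types (c : cfg) (m : mem) (dk : dsk).
Implicit Types (buf : nat -> nat -> seq word) (pos : nat -> nat -> nat).

Hypotheses (b_gt0 : (0 < b)%N) (b_le : (b <= B)%N).
Hypothesis b_tree : (0 < f0)%N -> (b < B)%N.
Hypothesis b_flat : f0 = 0%N -> b = 1%N.
Hypothesis f0_le : (f0 <= f)%N.
Hypothesis depthE : (0 < L)%N = (0 < f0)%N.
Hypothesis memory_fits : (counter_base + f <= M)%N.
Hypothesis disk_fits : (tb + hmax + level_start L <= K)%N.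
Hypothesis table_blocksE : (0 < f0)%N -> tb = level_size 0.

Definition mem_at m (a : nat) : word := m (cell a).

Definition null_word : word := inr ord_max.

Definition src_word m (x : nat + nat) : word :=
  match x with inl y => mem_at m y | inr k => inr (number k) end.

Lemma cell_inj a a' : (a < M)%N -> (a' < M)%N -> cell a = cell a' -> a = a'.
Proof. by move=> aM aM' /(congr1 val); rewrite /= !inordK. Qed.

Lemma block_inj a a' : (a < K)%N -> (a' < K)%N -> block a = block a' -> a = a'.
Proof. by move=> aK aK' /(congr1 val); rewrite /= !inordK. Qed.

Lemma junk_offset_cases :
  junk_offset = b /\ (b < B)%N \/ [/\ junk_offset = 0%N, b = 1%N & B = 1%N].
Proof.
rewrite /junk_offset; have [f00|f0_gt0] := posnP f0; last first.
  by left; have := b_tree f0_gt0; split=> //; apply/minn_idPl.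
have b1 := b_flat f00; rewrite b1; case: (block_pred P) => [|B'].
  by right.
by left; split=> //; apply/minn_idPl.
Qed.

Lemma basesE : [/\ counter_base = (buffer_base + f * b)%N,
  buffer_base = (heavy_base + hm)%N & heavy_base = junk_offset.+2].
Proof. by []. Qed.

Lemma junk_fits : (1 + junk_offset < M)%N.
Proof. by have [cE bE hE] := basesE; have := memory_fits; lia. Qed.

Lemma fan_leb l : (fan l * b <= f * b)%N.
Proof. by rewrite leq_mul2r fan_le ?orbT. Qed.

Variables (used rate_mul : nat).
Notation control_word := (control_word P used rate_mul).
Notation act_with := (@act_with R P used rate_mul).
Notation goto := (@goto R P used rate_mul).

Lemma mem_at_compute reports src s i m a : (a < M)%N ->
  mem_at (compute (act_with reports src s i) m) a =
  if a == 0%N then inr (number (control_word s)) else src_word m (src a).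
Proof.
move=> aM; rewrite /mem_at /compute ffunE /= ffunE inordK //.
by case: eqP => // _; case: (src a).
Qed.

Lemma read_hit (g : {ffun 'I_B -> 'I_M}) (blk : {ffun 'I_B -> word}) m j :
  (forall j', g j' = g j -> j' = j) ->
  ([ffun x => if [pick j | g j == x] is Some j then blk j else m x] : mem) (g j) = blk j.
Proof.
move=> g_inj; rewrite ffunE; case: pickP => [k /eqP/g_inj->//|/(_ j)].
by rewrite eqxx.
Qed.

Lemma read_miss (g : {ffun 'I_B -> 'I_M}) (blk : {ffun 'I_B -> word}) m x :
  (forall j, g j <> x) ->
  ([ffun x => if [pick j | g j == x] is Some j then blk j else m x] : mem) x = m x.
Proof. by move=> g_x; rewrite ffunE; case: pickP => // k /eqP/g_x. Qed.

Lemma scan_map_cell a j : (a < M)%N -> scan_map j = cell a -> (0 < a < heavy_base)%N.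
Proof.
move=> aM; rewrite ffunE => /cell_inj; have := junk_fits; have := geq_minr j junk_offset.
by move=> ? ? aE; have := aE _ aM; rewrite /heavy_base; lia.
Qed.

Lemma scan_mapE t : (t < b)%N -> scan_map (inord t) = cell (1 + t).
Proof.
move=> t_lt; rewrite ffunE inordK; last by lia.
by congr (cell (1 + _)); apply/minn_idPl; case: junk_offset_cases => [[-> _]|[-> ? _]]; lia.
Qed.

Lemma scan_map_inj t j : (t < b)%N -> scan_map j = scan_map (inord t) -> j = inord t.
Proof.
move=> t_lt; rewrite scan_mapE // ffunE => /cell_inj jt; apply: val_inj.
have t_junk : (t <= junk_offset)%N by case: junk_offset_cases => [[-> _]|[-> ? _]]; lia.
rewrite /= inordK; last by lia.
have := jt ltac:(have := junk_fits; have := geq_minr j junk_offset; lia)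
  ltac:(have := junk_fits; lia).
by have := ltn_ord j; case: junk_offset_cases => [[-> _]|[-> b1 B1]]; lia.
Qed.

Lemma next_scan reports src s be c :
  let c2 := next c (act_with reports src s (Read be scan_map)) in
  [/\ c2.2 = c.2, mem_at c2.1 0 = inr (number (control_word s)),
      forall a, (heavy_base <= a < M)%N -> mem_at c2.1 a = src_word c.1 (src a) &
      forall t, (t < b)%N -> mem_at c2.1 (1 + t) = c.2 be (inord t)].
Proof.
rewrite /next_config /=; split=> //.
- rewrite {1}/mem_at read_miss => [|j /(@scan_map_cell 0 j isT)] //; exact: mem_at_compute.
- move=> a /andP[a_heavy aM]; rewrite {1}/mem_at read_miss => [|j /(scan_map_cell aM)].
    by rewrite -[LHS]/(mem_at _ a) mem_at_compute //; case: a a_heavy aM.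
  by lia.
move=> t t_lt; rewrite /mem_at -scan_mapE //; apply: read_hit => j.
exact: scan_map_inj.
Qed.

Lemma next_halt reports src s c :
  let c2 := next c (act_with reports src s (Halt _ _ _)) in
  [/\ c2.2 = c.2, mem_at c2.1 0 = inr (number (control_word s)) &
      forall a, (0 < a < M)%N -> mem_at c2.1 a = src_word c.1 (src a)].
Proof.
by rewrite /next_config; split=> // [|[|a] // /andP[_ aM]]; exact: mem_at_compute.
Qed.

Definition part_cell d (j : nat) : nat :=
  if (j < b)%N then (buffer_base + d * b + j)%N
  else if j == b then (counter_base + d)%N else 1%N.

Lemma part_cell_lt d (j : nat) : (d < f)%N -> (part_cell d j < M)%N.
Proof.
move=> df; rewrite /part_cell; have mf := memory_fits; have [cE bE hE] := basesE.
by case: (ltngtP j b) => [jb|_|_]; [have := ltn_muladd jb df|..]; lia.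
Qed.

Lemma part_mapE d (j : 'I_B) : part_map d j = cell (part_cell d j).
Proof. by rewrite ffunE. Qed.

Lemma part_cell_inj d (j j' : nat) : (d < f)%N -> (j <= b)%N ->
  part_cell d j' = part_cell d j -> j' = j.
Proof.
move=> df; rewrite /part_cell; have [cE bE hE] := basesE.
have db : (d * b + b <= f * b)%N by rewrite -mulSnr leq_mul2r df orbT.
by case: (ltngtP j b); case: (ltngtP j' b); lia.
Qed.

Lemma part_map_inj d t j : (d < f)%N -> (b < B)%N -> (t <= b)%N ->
  part_map d j = part_map d (inord t) -> j = inord t.
Proof.
move=> df bB t_le; rewrite !part_mapE => /cell_inj jt; apply: val_inj.
have t_inord : (inord t : 'I_B) = t :> nat by rewrite inordK //; lia.
rewrite /= t_inord; apply: (part_cell_inj df t_le); move: jt.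
by rewrite !part_cell_lt // t_inord => /(_ isT isT).
Qed.

Lemma next_load reports s be d c : (d < f)%N -> (b < B)%N ->
  let c2 := next c (goto reports s (Read be (part_map d))) in
  [/\ c2.2 = c.2, mem_at c2.1 0 = inr (number (control_word s)),
      forall a, (1 < a < M)%N -> (forall j, (j <= b)%N -> a != part_cell d j) ->
        mem_at c2.1 a = mem_at c.1 a &
      forall t, (t <= b)%N -> mem_at c2.1 (part_cell d t) = c.2 be (inord t)].
Proof.
move=> df bB; rewrite /next_config /=; split=> //.
- rewrite {1}/mem_at read_miss => [|j]; first exact: mem_at_compute.
  rewrite part_mapE => /cell_inj; rewrite part_cell_lt // => /(_ isT isT).
  by have [cE bE hE] := basesE; rewrite /part_cell; case: ltngtP; lia.
- move=> a /andP[a1 aM] not_part; rewrite {1}/mem_at read_miss => [|j].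
    by rewrite -[LHS]/(mem_at _ a) mem_at_compute //; case: a a1 {aM not_part}.
  rewrite part_mapE => /cell_inj; rewrite part_cell_lt // => /(_ isT aM) aE.
  have [jb|bj] := leqP j b; first by have := not_part j jb; rewrite aE eqxx.
  by move: aE; rewrite /part_cell ltnNge ltnW // gtn_eqF //=; lia.
move=> t t_le; have t_inord : (inord t : 'I_B) = t :> nat by rewrite inordK //; lia.
rewrite /mem_at -{1}t_inord -part_mapE; apply: read_hit => j.
exact: part_map_inj.
Qed.

Lemma next_save reports s be d c : (d < f)%N -> (b < B)%N ->
  let c2 := next c (goto reports s (Write be (part_map d))) in
  [/\ forall be', be' != be -> c2.2 be' = c.2 be',
      mem_at c2.1 0 = inr (number (control_word s)),
      forall a, (0 < a < M)%N -> mem_at c2.1 a = mem_at c.1 a &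
      forall t, (t <= b)%N -> c2.2 be (inord t) = mem_at c.1 (part_cell d t)].
Proof.
move=> df bB; rewrite /next_config /=; split.
- by move=> be' /negPf nb; rewrite ffunE nb.
- exact: mem_at_compute.
- by move=> [|a] // /andP[_ aM]; rewrite mem_at_compute.
move=> t t_lt; rewrite ffunE eqxx ffunE part_mapE inordK; last by lia.
rewrite -[LHS]/(mem_at _ _) mem_at_compute ?part_cell_lt // ifF //.
have [cE bE hE] := basesE.
by rewrite /part_cell; case: ltngtP; lia.
Qed.

(* The part of the configuration that depends on the instance: the words of the heavy
   records, followed by null words, and those of the table. *)
Variables (heavy table : nat -> word).
Hypothesis used_le : (used <= hmax)%N.
Hypothesis table_nolabel : forall k s, (k <= f)%N -> label_of k (table s) = None.

Definition records_stored m dk : Prop :=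
  [/\ forall t, (t < hm)%N -> mem_at m (heavy_base + t) = heavy t,
      forall be t, (be < tb)%N -> (t < b)%N -> dk (block be) (inord t) = table (be * b + t) &
      forall j t, (j < used)%N -> (t < b)%N ->
        dk (block (tb + j)) (inord t) = heavy (hm + j * b + t)].

Section Parts.
Variables (buf : nat -> nat -> seq word) (pos : nat -> nat -> nat).

Definition part_word l i d t : word :=
  if (t < b)%N then nth null_word (buf l i) (d * b + t)
  else inr (number (pos l.-1 (i * f + d))).

Definition part_in_memory m l i d : Prop :=
  forall t, (t <= b)%N -> mem_at m (part_cell d t) = part_word l i d t.

Definition part_on_disk dk l i d : Prop :=
  forall t, (t <= b)%N ->
  dk (block (part_block l.-1 (i * f + d))) (inord t) = part_word l i d t.

Definition is_node l i : bool := [&& 0 < l, l <= L & i < level_size l]%N.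

Definition parts_stored m dk (resident : option (nat * nat)) : Prop :=
  forall l i d, is_node l i -> (d < fan l)%N ->
  if resident == Some (l, i) then part_in_memory m l i d else part_on_disk dk l i d.

End Parts.

Lemma part_cell_buffer d t : (t < b)%N -> part_cell d t = (buffer_base + d * b + t)%N.
Proof. by rewrite /part_cell => ->. Qed.

Lemma part_cell_counter d : part_cell d b = (counter_base + d)%N.
Proof. by rewrite /part_cell ltnn eqxx. Qed.

Lemma part_cell_range d t : (d < f)%N -> (t <= b)%N -> (buffer_base <= part_cell d t < M)%N.
Proof.
move=> df t_le; rewrite part_cell_lt // andbT /part_cell.
by have [cE bE hE] := basesE; case: ltngtP t_le; lia.
Qed.

Lemma depth_gt0 : (0 < L)%N -> (0 < f0)%N. Proof. by rewrite depthE. Qed.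

Lemma fanout_gt0 : (0 < L)%N -> (0 < f)%N.
Proof. by move/depth_gt0/leq_trans; apply. Qed.

Lemma node_depth l i : is_node l i -> (0 < L)%N. Proof. by case/and3P; lia. Qed.

Lemma node_fanout l i : is_node l i -> (0 < f)%N.
Proof. by move/node_depth/fanout_gt0. Qed.

Lemma node_chunk l i : is_node l i -> (b < B)%N.
Proof. by move/node_depth/depth_gt0/b_tree. Qed.

Lemma fan_leq l : (fan l <= f)%N. Proof. exact: fan_le. Qed.

Lemma fan_root : fan L = f0. Proof. by rewrite /fan eqxx. Qed.

Lemma fan_inner l : (l < L)%N -> fan l = f.
Proof. by move=> lL; rewrite /fan ltn_eqF. Qed.

Lemma node_fan_gt0 l i : is_node l i -> (0 < fan l)%N.
Proof.
by move=> nd; apply: fan_gt0; [exact: node_fanout nd | exact: depth_gt0 (node_depth nd)].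
Qed.

Lemma node_child_size l i d : is_node l i -> (d < fan l)%N ->
  (i * f + d < level_size l.-1)%N.
Proof.
case/and3P=> l0 lL; rewrite /level_size.
have -> : (l.-1 == L) = false by lia.
case: eqP => [->|/eqP nl].
  by rewrite ltnS leqn0 => /eqP->; rewrite fan_root mul0n subnn muln1.
have llL : (l < L)%N by rewrite ltn_neqAle nl.
rewrite fan_inner // => il df.
have -> : (L.-1 - l.-1 = (L.-1 - l).+1)%N by lia.
by rewrite expnSr mulnA; apply: ltn_muladd.
Qed.

Lemma node_child l i d : is_node l i -> (1 < l)%N -> (d < fan l)%N ->
  is_node l.-1 (i * f + d).
Proof.
move=> nd l1 df; rewrite /is_node (node_child_size nd df) andbT.
by case/and3P: nd => ? ? _; lia.
Qed.

Lemma node_parent l i : is_node l i -> (l < L)%N -> is_node l.+1 (i %/ f).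
Proof.
move=> nd lL; have f_gt0 := node_fanout nd; case/and3P: nd => l0 _ il.
rewrite /is_node lL /=; move: il; rewrite /level_size ltn_eqF //.
case: eqP => [<-|ne] il.
  rewrite divn_small //; move: il; rewrite -pred_Sn subnn muln1.
  by move/leq_trans; apply.
rewrite ltn_divLR //; move: il.
have -> : (L.-1 - l = (L.-1 - l.+1).+1)%N by lia.
by rewrite expnSr mulnA.
Qed.

Lemma child_parent i d : (d < f)%N -> ((i * f + d) %/ f = i)%N.
Proof. by move=> df; rewrite divnMDl ?divn_small ?addn0 //; lia. Qed.

Lemma node_lt_expn l i : is_node l i -> (i < f ^ (L - l))%N.
Proof.
move=> nd; have f_gt0 := node_fanout nd; case/and3P: nd => l0 lL.
rewrite /level_size; case: eqP => [->|ne]; first by rewrite subnn expn0.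
have -> : (L - l = (L.-1 - l).+1)%N by lia.
move=> il; apply: leq_trans il _.
by rewrite expnS leq_mul2r f0_le orbT.
Qed.

Lemma root_index i : is_node L i -> i = 0%N.
Proof. by case/and3P; rewrite /level_size eqxx; lia. Qed.

Lemma root_is_node : (0 < f0)%N -> is_node L 0.
Proof. by move=> f0_gt0; rewrite /is_node depthE f0_gt0 leqnn /level_size eqxx. Qed.

Lemma level_size_le l : (l < L)%N -> (level_size l <= level_size 0)%N.
Proof.
move=> lL; have f_gt0 := fanout_gt0 (leq_ltn_trans (leq0n _) lL).
rewrite /level_size !ltn_eqF ?(leq_ltn_trans _ lL) //.
by apply: leq_mul => //; apply: leq_pexp2l => //; rewrite subn0 leq_subr.
Qed.

Lemma level_start_mono l l' :
  (l < l')%N -> (level_start l + level_size l <= level_start l')%N.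
Proof.
elim: l' => // l' IH; rewrite ltnS leq_eqVlt /level_start big_ord_recr /=.
by case/predU1P=> [->//|/IH h]; apply: leq_trans h _; rewrite leq_addr.
Qed.

Lemma part_block_lt l i : (l < L)%N -> (i < level_size l)%N -> (part_block l i < K)%N.
Proof. by move=> /level_start_mono; have := disk_fits; rewrite /part_block; lia. Qed.

Lemma part_block_inj l i l' i' : (l < L)%N -> (i < level_size l)%N -> (l' < L)%N ->
  (i' < level_size l')%N -> block (part_block l i) = block (part_block l' i') ->
  (l, i) = (l', i').
Proof.
move=> lL il lL' il' /block_inj blockE.
have := blockE (part_block_lt lL il) (part_block_lt lL' il'); rewrite /part_block.
have [ll'|ll'|->] := ltngtP l l'; last by move=> E; congr (_, _); lia.
  by have := level_start_mono ll'; lia.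
by have := level_start_mono ll'; lia.
Qed.

Lemma child_level l i : is_node l i -> (l.-1 < L)%N. Proof. by case/and3P; lia. Qed.

Lemma child_block_inj l i d l' i' d' : is_node l i -> is_node l' i' ->
  (d < fan l)%N -> (d' < fan l')%N ->
  block (part_block l.-1 (i * f + d)) = block (part_block l'.-1 (i' * f + d')) ->
  [/\ l = l', i = i' & d = d'].
Proof.
move=> nd nd' df df'; have df2 := leq_trans df (fan_leq _); have df2' := leq_trans df' (fan_leq _).
move=> /(part_block_inj (child_level nd) (node_child_size nd df)
  (child_level nd') (node_child_size nd' df')).
case=> lE iE; have ll' : l = l' by case/and3P: nd; case/and3P: nd'; lia.
have ii' : i = i' by rewrite -(child_parent i df2) iE child_parent.
by split=> //; move: iE; rewrite ii'; lia.
Qed.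

Definition no_labels l (ws : seq word) : bool :=
  all (fun w => label_of (fan l) w == None) ws.

(* The buffers that contain labels are those of the nodes from this one to the root. *)
Definition labels_from s : nat * nat :=
  match s with
  | Gather l i _ | Take l i _ _ | SaveDown l i _ _ _ | LoadUp l i _ _ => (l, i)
  | SaveUp l i _ _ | LoadDown l i _ _ | Label l i _ => (l.+1, i %/ f)%N
  | _ => (L.+1, 0%N)
  end.

(* The node whose old buffer is about to be discarded. *)
Definition discarded_node s : option (nat * nat) :=
  match s with
  | Label l i _ | LoadDown l i _ _ => Some (l, i)
  | SaveDown l i d _ _ => Some (l.-1, i * f + d)%N
  | _ => None
  end.

Definition resident_node s : option (nat * nat) :=
  match s with
  | Label l i _ | Gather l i _ | Take l i _ _ | SaveDown l i _ _ _
  | SaveUp l i _ _ => Some (l, i)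
  | LoadDown _ _ _ _ | LoadUp _ _ _ _ => None
  | _ => Some (L, 0%N)
  end.

Definition sizes_ok buf pos : Prop :=
  forall l i, is_node l i -> size (buf l i) = (fan l * b)%N /\ (pos l i <= fan l * b)%N.

Definition labels_ok (n : nat * nat) buf pos : Prop :=
  forall l i, is_node l i ->
  if below f l i n.1 n.2 then pos l i = 0%N else no_labels l (buf l i).

Definition pending_labels l d (ws : seq word) : nat :=
  label_count (@label_of W S (fan l)) d ws.

Definition state_ok s buf pos : Prop :=
  match s with
  | Idle x => x = pos L 0%N /\ (x <= fan L * b)%N
  | Direct s N => [/\ f0 = 0%N, (s < slots)%N, (N <= J)%N & pos L 0%N = 0%N]
  | HeavyScan j x => [/\ (j < used)%N, x = pos L 0%N & (x <= fan L * b)%N]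
  | TableScan s t x =>
      [/\ (s < slots)%N, (t <= J.+1)%N, x = pos L 0%N & (x <= fan L * b)%N]
  | Label l i N => [/\ is_node l i, (N <= J)%N & pos l i = 0%N]
  | Gather l i N => is_node l i /\ (N <= J)%N
  | Take l i d N => [/\ is_node l i, (N <= J)%N, (d < fan l)%N,
      (0 < pending_labels l d (buf l i))%N &
      (1 < l)%N -> (pos l.-1 (i * f + d) < f * b)%N]
  | SaveDown l i d j N => [/\ is_node l i, (N <= J)%N, (1 < l)%N && (d < fan l)%N,
      (j < fan l)%N & pos l.-1 (i * f + d)%N = 0%N]
  | SaveUp l i j N => [/\ is_node l i, (N <= J)%N, (l < L)%N & (j < fan l)%N]
  | LoadDown l i j N =>
     [/\ is_node l i, (N <= J)%N, (l < L)%N, (j < fan l)%N & pos l i = 0%N]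
  | LoadUp l i j N => [/\ is_node l i, (N <= J)%N & (j < fan l)%N]
  end.

Definition transferred s m dk buf pos : Prop :=
  match s with
  | Direct s _ | TableScan s _ _ => mem_at m (1 + s %% b) = table s
  | HeavyScan j _ => forall t, (t < b)%N -> mem_at m (1 + t) = heavy (hm + j * b + t)
  | Take l i d _ => forall t, (t < b)%N -> mem_at m (1 + t) =
      if l == 1%N then table ((i * f + d) * b + t)
      else nth null_word (buf l.-1 (i * f + d)%N)
             (pos l.-1 (i * f + d)%N %/ b * b + t)
  | SaveDown l i _ j _ | SaveUp l i j _ =>
      forall d, (d < j)%N -> part_on_disk buf pos dk l i d
  | LoadDown l i j _ | LoadUp l i j _ =>
      forall d, (d < j)%N -> part_in_memory buf pos m l i d
  | _ => True
  end.

Definition stored c resident buf pos : Prop :=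
  records_stored c.1 c.2 /\ parts_stored buf pos c.1 c.2 resident.

Definition consistent s buf pos : Prop :=
  [/\ sizes_ok buf pos, labels_ok (labels_from s) buf pos & state_ok s buf pos].

Definition represents c s buf pos : Prop :=
  [/\ mem_at c.1 0 = inr (number (control_word s)), stored c (resident_node s) buf pos,
      transferred s c.1 c.2 buf pos & consistent s buf pos].

Lemma stored_mem c c2 resident buf pos : c2.2 = c.2 ->
  (forall a, (heavy_base <= a < M)%N -> mem_at c2.1 a = mem_at c.1 a) ->
  stored c resident buf pos -> stored c2 resident buf pos.
Proof.
move=> diskE memE [[heavy_mem table_disk heavy_disk] parts].
have [cE bE hE] := basesE; have mf := memory_fits.
split; first split; rewrite ?diskE //.
  by move=> t t_hm; rewrite memE ?heavy_mem //; lia.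
move=> l i d nd df; have := parts l i d nd df; case: ifP => // _ part t t_le.
rewrite memE ?part //; have := part_cell_range (leq_trans df (fan_leq l)) t_le.
by lia.
Qed.

Lemma represents_scan c reports s be buf pos :
  stored c (resident_node s) buf pos -> consistent s buf pos ->
  (forall m, (forall t, (t < b)%N -> mem_at m (1 + t) = c.2 be (inord t)) ->
     transferred s m c.2 buf pos) ->
  represents (next c (goto reports s (Read be scan_map))) s buf pos.
Proof.
move=> c_stored s_ok scan_ok; have [diskE ctrlE memE scanE] := next_scan reports inl s be c.
split=> //; first by apply: stored_mem c_stored.
by rewrite diskE; apply: scan_ok.
Qed.

Lemma represents_change c src s buf pos buf' pos' l i :
  stored c (Some (l, i)) buf pos -> is_node l i -> resident_node s = Some (l, i) ->
  (forall a, (heavy_base <= a < buffer_base)%N -> src a = inl a) ->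
  (forall d t, (d < fan l)%N -> (t <= b)%N ->
     src_word c.1 (src (part_cell d t)) = part_word buf' pos' l i d t) ->
  (forall l' i', ~~ ((l' == l) && (i' == i)) -> buf' l' i' = buf l' i') ->
  (forall l' i' d, is_node l' i' -> ~~ ((l' == l) && (i' == i)) -> (d < fan l')%N ->
     pos' l'.-1 (i' * f + d)%N = pos l'.-1 (i' * f + d)%N) ->
  consistent s buf' pos' ->
  (forall m' dk', transferred s m' dk' buf' pos') ->
  represents (next c (act_with [::] src s (read_table P 0))) s buf' pos'.
Proof.
move=> [[heavy_mem table_disk heavy_disk] parts] nd s_node src_heavy src_part bufE posE s_ok tr.
have [cE bE hE] := basesE; have mf := memory_fits.
have [diskE ctrlE memE _] := next_scan [::] src s (block 0) c.
split=> //; rewrite s_node; split; first split; rewrite ?diskE //.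
  move=> t t_hm; rewrite memE; last by lia.
  by rewrite src_heavy; [exact: heavy_mem | lia].
move=> l' i' d nd' df; have := parts l' i' d nd' df.
case: (Some (l, i) =P Some (l', i')) => [[lE iE]|ne] part t t_le.
  subst l' i'; rewrite -[read_table P 0]/(Read _ _) memE ?src_part //.
  by have := part_cell_range (leq_trans df (fan_leq _)) t_le; lia.
have ne' : ~~ ((l' == l) && (i' == i)).
  by apply/negP => /andP[/eqP lE /eqP iE]; apply: ne; rewrite lE iE.
by rewrite part // /part_word bufE // posE.
Qed.

Lemma save_part_stored c s l i j buf pos :
  stored c (Some (l, i)) buf pos -> is_node l i -> (j < fan l)%N ->
  (forall d, (d < j)%N -> part_on_disk buf pos c.2 l i d) ->
  let c2 := next c (goto [::] s (save_part P l i j)) in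
  [/\ mem_at c2.1 0 = inr (number (control_word s)), stored c2 (Some (l, i)) buf pos &
      forall d, (d < j.+1)%N -> part_on_disk buf pos c2.2 l i d].
Proof.
move=> [[heavy_mem table_disk heavy_disk] parts] nd jf saved.
have jf' := leq_trans jf (fan_leq l); have [cE bE hE] := basesE; have mf := memory_fits.
have [diskE ctrlE memE partE] :=
  next_save [::] s (block (part_block l.-1 (i * f + j))) c jf' (node_chunk nd).
have untouched a : (a < tb + hmax)%N -> block a != block (part_block l.-1 (i * f + j)).
  move=> a_lt; apply/eqP => /block_inj aE.
  have := aE ltac:(have := disk_fits; lia) (part_block_lt (child_level nd) (node_child_size nd jf)).
  by rewrite /part_block; lia.
split=> //.
- split; first split.
  + by move=> t t_hm; rewrite memE ?heavy_mem //; lia.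
  + by move=> be t be_tb t_lt; rewrite diskE ?table_disk //; apply: untouched; lia.
  + by move=> j1 t j1_hb t_lt; rewrite diskE ?heavy_disk //; apply: untouched; lia.
  move=> l' i' d nd' df; have := parts l' i' d nd' df.
  case: ifP => ne part t t_le.
    rewrite memE ?part //; have := part_cell_range (leq_trans df (fan_leq l')) t_le.
    by lia.
  rewrite diskE ?part //; apply/eqP => /(child_block_inj nd' nd df jf)[lE iE _].
  by rewrite lE iE eqxx in ne.
move=> d; rewrite ltnS leq_eqVlt => /predU1P[->|dj] t t_le.
  by have := parts l i j nd jf; rewrite eqxx => part; rewrite -part //; exact: partE.
rewrite diskE ?saved //; apply/eqP => /(child_block_inj nd nd (ltn_trans dj jf) jf)[_ _ dE].
by rewrite dE ltnn in dj.
Qed.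

Lemma load_part_stored c s l i j buf pos :
  stored c None buf pos -> is_node l i -> (j < fan l)%N ->
  (forall d, (d < j)%N -> part_in_memory buf pos c.1 l i d) ->
  let c2 := next c (goto [::] s (load_part P l i j)) in
  [/\ mem_at c2.1 0 = inr (number (control_word s)), stored c2 None buf pos &
      forall d, (d < j.+1)%N -> part_in_memory buf pos c2.1 l i d].
Proof.
move=> [[heavy_mem table_disk heavy_disk] parts] nd jf loaded.
have jf' := leq_trans jf (fan_leq l); have [cE bE hE] := basesE; have mf := memory_fits.
have [diskE ctrlE memE partE] :=
  next_load [::] s (block (part_block l.-1 (i * f + j))) c jf' (node_chunk nd).
split=> //.
- split=> //; split=> // t t_hm; rewrite memE ?heavy_mem //; first by lia.
  by move=> t' /(part_cell_range jf'); lia.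
move=> d; rewrite ltnS leq_eqVlt => /predU1P[->|dj] t t_le.
  by rewrite -(parts l i j nd jf t t_le); exact: partE.
have df := ltn_trans dj jf'; rewrite memE ?loaded //.
  by have := part_cell_range df t_le; lia.
move=> t' t'_le; have dfb : (d * b + b <= j * b)%N by rewrite -mulSnr leq_mul2r dj orbT.
have jfb : (j * b + b <= f * b)%N by rewrite -mulSnr leq_mul2r jf' orbT.
apply/eqP; rewrite /part_cell.
by case: (ltngtP t b) t_le; case: (ltngtP t' b) t'_le; lia.
Qed.

Lemma stored_saved c l i buf pos : stored c (Some (l, i)) buf pos ->
  (forall d, (d < fan l)%N -> part_on_disk buf pos c.2 l i d) -> stored c None buf pos.
Proof.
move=> [records parts] saved; split=> // l' i' d nd df /=; have := parts l' i' d nd df.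
by case: eqP => // -[lE iE] _; subst l' i'; exact: saved.
Qed.

Lemma stored_loaded c l i buf pos : stored c None buf pos ->
  (forall d, (d < fan l)%N -> part_in_memory buf pos c.1 l i d) ->
  stored c (Some (l, i)) buf pos.
Proof.
move=> [records parts] loaded; split=> // l' i' d nd df; have := parts l' i' d nd df.
by case: ifP => // /eqP[lE iE] _; subst l' i'; exact: loaded.
Qed.

Lemma save_down_represents c l i d j N buf pos : represents c (SaveDown l i d j N) buf pos ->
  represents (next c (goto [::] (after_save_down l i d j N) (save_part P l i j)))
    (after_save_down l i d j N) buf pos.
Proof.
move=> [_ c_stored saved [sizes labels [nd NJ /andP[l1 df] jf pos0]]].
have [ctrlE c2_stored saved2] :=
  save_part_stored (after_save_down l i d j N) c_stored nd jf saved.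
move: ctrlE c2_stored saved2; rewrite /after_save_down; case: ltnP => jf' ctrlE c2_stored saved2.
  by split=> //; split=> //; split=> //; apply/andP.
have nd' := node_child nd l1 df; have lL := child_level nd.
split=> //.
  by apply: stored_saved c2_stored _ => d' df'; apply: saved2; exact: leq_trans df' jf'.
split=> //=; first by rewrite child_parent ?prednK ?(leq_trans df (fan_leq l)) //; lia.
by split=> //; exact: node_fan_gt0 nd'.
Qed.

Lemma save_up_represents c l i j N buf pos : represents c (SaveUp l i j N) buf pos ->
  represents (next c (goto [::] (after_save_up l i j N) (save_part P l i j)))
    (after_save_up l i j N) buf pos.
Proof.
move=> [_ c_stored saved [sizes labels [nd NJ lL jf]]].
have [ctrlE c2_stored saved2] :=
  save_part_stored (after_save_up l i j N) c_stored nd jf saved.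
move: ctrlE c2_stored saved2; rewrite /after_save_up; case: ltnP => jf' ctrlE c2_stored saved2.
  by split.
have nd' := node_parent nd lL; split=> //.
  by apply: stored_saved c2_stored _ => d' df'; apply: saved2; exact: leq_trans df' jf'.
by split=> //; split=> //; exact: node_fan_gt0 nd'.
Qed.

Lemma load_down_represents c l i j N buf pos : represents c (LoadDown l i j N) buf pos ->
  represents (next c (goto [::] (after_load_down l i j N) (load_part P l i j)))
    (after_load_down l i j N) buf pos.
Proof.
move=> [_ c_stored loaded [sizes labels [nd NJ lL jf pos0]]].
have [ctrlE c2_stored loaded2] :=
  load_part_stored (after_load_down l i j N) c_stored nd jf loaded.
move: ctrlE c2_stored loaded2; rewrite /after_load_down; case: ltnP => jf' ctrlE c2_stored loaded2.
  by split.
split=> //; apply: stored_loaded c2_stored _ => d' df'.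
by apply: loaded2; exact: leq_trans df' jf'.
Qed.

Lemma load_up_represents c l i j N buf pos : represents c (LoadUp l i j N) buf pos ->
  represents (next c (goto [::] (after_load_up l i j N) (load_part P l i j)))
    (after_load_up l i j N) buf pos.
Proof.
move=> [_ c_stored loaded [sizes labels [nd NJ jf]]].
have [ctrlE c2_stored loaded2] :=
  load_part_stored (after_load_up l i j N) c_stored nd jf loaded.
move: ctrlE c2_stored loaded2; rewrite /after_load_up; case: ltnP => jf' ctrlE c2_stored loaded2.
  by split.
split=> //; apply: stored_loaded c2_stored _ => d' df'.
by apply: loaded2; exact: leq_trans df' jf'.
Qed.

Hypotheses (Q_gt10 : (10 < Q)%N) (J_lt : (J.+1 < Q)%N) (slots_lt : (slots < Q)%N)
  (depth_lt : (L < Q)%N) (fanout_lt : (f < Q)%N) (buffer_lt : (f * b < Q)%N)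
  (used_lt : (used < Q)%N) (rate_mul_lt : (rate_mul < Q)%N) (W_ge : (Q ^ 8 <= W)%N)
  (slots_gt0 : (0 < slots)%N).

Notation view c := (view_of p c.1).

Lemma node_lt_radix l i : is_node l i -> (l < Q)%N && (i < Q)%N.
Proof.
move=> nd; have L_gt0 := node_depth nd; case/and3P: nd => l0 lL.
have [->|ne] := eqVneq l L; first by rewrite /level_size eqxx; lia.
move=> il; have := level_size_le (_ : l < L)%N; rewrite -table_blocksE ?depth_gt0 //.
have : (tb <= slots)%N by rewrite /slots leq_pmulr.
by lia.
Qed.

Lemma digits_of_state_lt s buf pos :
  consistent s buf pos -> all (fun x => x < Q)%N (digits_of_state s).
Proof.
case=> _ _.
have buf_lt l x : (x <= fan l * b)%N -> (x < Q)%N by have := fan_leb l; lia.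
have fan_lt l x : (x < fan l)%N -> (x < Q)%N by have := fan_leq l; lia.
case: s => [x|s N|j x|s t x|l i N|l i N|l i d N|l i d j N|l i j N|l i j N|l i j N] /=.
- by case=> _ /buf_lt; lia.
- by case; lia.
- by case=> ? _ /buf_lt; lia.
- by case=> ? ? _ /buf_lt; lia.
- by case=> /node_lt_radix/andP[? ?]; lia.
- by case=> /node_lt_radix/andP[? ?]; lia.
- by case=> /node_lt_radix/andP[? ?] ? /fan_lt ?; lia.
- by case=> /node_lt_radix/andP[? ?] ? /andP[? /fan_lt ?] /fan_lt ?; lia.
- by case=> /node_lt_radix/andP[? ?] ? ? /fan_lt ?; lia.
- by case=> /node_lt_radix/andP[? ?] ? ? /fan_lt ?; lia.
by case=> /node_lt_radix/andP[? ?] ? /fan_lt ?; lia.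
Qed.

Lemma numberK a : (a < Q)%N -> number a = a :> nat.
Proof.
move=> aQ; rewrite inordK // (leq_trans _ W_ge) //.
by rewrite (@leq_trans Q) // -{1}(expn1 Q) leq_pexp2l //; lia.
Qed.

Lemma view_at_mem c a : view_at (view c) a =
  match mem_at c.1 a with inl v => inl (p v) | inr k => inr k end.
Proof. by rewrite /view_at ffunE. Qed.

Lemma number_at_mem c a x : (x < Q)%N -> mem_at c.1 a = inr (number x) ->
  number_at (view c) a = x.
Proof. by move=> xQ aE; rewrite /number_at view_at_mem aE numberK. Qed.

Lemma label_view_at c k a : label_of k (view_at (view c) a) = label_of k (mem_at c.1 a).
Proof. by rewrite view_at_mem; case: (mem_at _ _). Qed.

Lemma sampler_step c s buf pos : represents c s buf pos ->
  sampler (view c) = step used rate_mul (view c) s.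
Proof.
case=> ctrlE _ _ /digits_of_state_lt s_lt.
have all_lt : all (fun x => x < Q)%N [:: used, rate_mul & digits_of_state s].
  by rewrite /= used_lt rate_mul_lt.
have size8 : size [:: used, rate_mul & digits_of_state s] = 8%N by case: s {s_lt ctrlE all_lt}.
have word_lt : (control_word s < W)%N.
  by apply: leq_trans W_ge; rewrite -size8; exact: of_digits_lt.
have ctrl_at : number_at (view c) 0 = control_word s.
  by rewrite /number_at view_at_mem ctrlE /= inordK.
have digitE k : (k < 8)%N ->
    digit Q k (control_word s) = nth 0%N [:: used, rate_mul & digits_of_state s] k.
  by move=> k8; apply: digit_of_digits => //; rewrite size8.
rewrite /sampler ctrl_at !digitE //=; congr (step _ _ _ _).
rewrite /state_of_digits !digitE //.
by case: s {s_lt ctrlE all_lt size8 word_lt ctrl_at digitE}.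
Qed.

(* No refill of the tree is under way. *)
Definition settled c buf pos x : Prop :=
  [/\ stored c (Some (L, 0%N)) buf pos, sizes_ok buf pos, labels_ok (L.+1, 0%N) buf pos,
      x = pos L 0%N & (x <= fan L * b)%N].

Lemma idle_settled c x buf pos : represents c (Idle x) buf pos -> settled c buf pos x.
Proof. by case=> _ c_stored _ [? ? []]. Qed.

Lemma settled_set_root c buf pos x x' : settled c buf pos x -> (x' <= fan L * b)%N ->
  settled c buf (set_node pos L 0 x') x'.
Proof.
move=> [[records parts] sizes labels xE x_le] x'_le.
have posE l i d : is_node l i ->
    set_node pos L 0 x' l.-1 (i * f + d)%N = pos l.-1 (i * f + d)%N.
  by move=> nd; rewrite set_node_below //; exact: child_level nd.
split=> //; last by rewrite set_node_same.
- split=> // l i d nd df; have := parts l i d nd df.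
  by case: ifP => _ part t t_le; rewrite part // /part_word posE.
- move=> l i nd; have [? ?] := sizes l i nd; split=> //.
  by rewrite /set_node; case: ifP => // /andP[/eqP-> _].
move=> l i nd; have := labels l i nd; rewrite /below /= leqNgt ltnS.
by case/and3P: nd => _ -> _.
Qed.

Lemma halt_represents c reports x buf pos : settled c buf pos x ->
  represents (next c (goto reports (Idle x) (Halt _ _ _))) (Idle x) buf pos.
Proof.
move=> [c_stored sizes labels xE x_le].
have [diskE ctrlE memE] := next_halt reports inl (Idle x) c.
split=> //; apply: stored_mem c_stored => // a /andP[a_ge aM].
by rewrite memE // aM andbT; have [_ _ hE] := basesE; lia.
Qed.

Lemma heavy_scan_represents c reports j x buf pos : settled c buf pos x -> (j < used)%N ->
  represents (next c (goto reports (HeavyScan j x) (read_heavy P j))) (HeavyScan j x) buf pos.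
Proof.
move=> [c_stored sizes labels xE x_le] j_used; apply: represents_scan => // m scanE t t_lt.
by rewrite scanE //; case: c_stored => -[_ _ heavy_disk] _; exact: heavy_disk.
Qed.

Lemma table_scanE c be s m : records_stored c.1 c.2 -> (s < slots)%N -> be = (s %/ b)%N ->
  (forall t, (t < b)%N -> mem_at m (1 + t) = c.2 (block be) (inord t)) ->
  mem_at m (1 + s %% b) = table s.
Proof.
move=> [_ table_disk _] s_lt -> scanE; have sb := ltn_pmod s b_gt0.
by rewrite scanE // table_disk // -?divn_eq // ltn_divLR.
Qed.

Lemma table_scan_represents c reports s t x buf pos :
  settled c buf pos x -> (s < slots)%N -> (t <= J.+1)%N ->
  represents (next c (goto reports (TableScan s t x) (read_table P (s %/ b))))
    (TableScan s t x) buf pos.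
Proof.
move=> [c_stored sizes labels xE x_le] s_lt tJ; apply: represents_scan => // m.
by apply: table_scanE => //; case: c_stored.
Qed.

Lemma direct_represents c reports s N buf pos :
  settled c buf pos 0 -> f0 = 0%N -> (s < slots)%N -> (N <= J)%N ->
  represents (next c (goto reports (Direct s N) (read_table P (s %/ b))))
    (Direct s N) buf pos.
Proof.
move=> [c_stored sizes labels xE x_le] f00 s_lt NJ; apply: represents_scan => // m.
by apply: table_scanE => //; case: c_stored.
Qed.

Lemma root_label_represents c reports N x buf pos :
  settled c buf pos x -> (0 < f0)%N -> (N <= J)%N ->
  represents (next c (goto reports (Label L 0 N) (read_table P 0))) (Label L 0 N) buf
    (set_node pos L 0 0).
Proof.
move=> /settled_set_root/(_ (leq0n _))[c_stored sizes labels xE x_le] f0_gt0 NJ.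
apply: represents_scan => //; split=> //=; first by rewrite div0n.
by split=> //; exact: root_is_node.
Qed.

Lemma finish_represents c reports x buf pos : settled c buf pos x ->
  represents (next c (finish P used rate_mul reports x)) (finish_state used x) buf pos.
Proof.
move=> c_settled; rewrite /finish /finish_state; case: eqP => used0.
  exact: halt_represents.
by apply: heavy_scan_represents => //; lia.
Qed.

Lemma buffer_word c l i buf pos j : stored c (Some (l, i)) buf pos -> is_node l i ->
  (j < fan l * b)%N -> mem_at c.1 (buffer_base + j) = nth null_word (buf l i) j.
Proof.
move=> [_ parts] nd jl; have df : (j %/ b < fan l)%N by rewrite ltn_divLR.
have t_lt := ltn_pmod j b_gt0; have := parts l i _ nd df; rewrite eqxx => /(_ _ (ltnW t_lt)).
by rewrite part_cell_buffer // /part_word t_lt -addnA -divn_eq.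
Qed.

Lemma buffer_words c l i buf pos : stored c (Some (l, i)) buf pos -> is_node l i ->
  sizes_ok buf pos -> [seq mem_at c.1 a | a <- buffer_cells l] = buf l i.
Proof.
move=> c_stored nd sizes; have [sz _] := sizes l i nd.
apply: (@eq_from_nth _ null_word); rewrite size_map size_iota ?sz // => j jl.
by rewrite (nth_map 0%N) ?size_iota // nth_iota // (buffer_word c_stored nd).
Qed.

Lemma counter_word c l i d buf pos : stored c (Some (l, i)) buf pos -> is_node l i ->
  (d < fan l)%N -> mem_at c.1 (counter_base + d) = inr (number (pos l.-1 (i * f + d))).
Proof.
move=> [_ parts] nd df; have := parts l i d nd df; rewrite eqxx => /(_ b (leqnn _)).
by rewrite part_cell_counter /part_word ltnn.
Qed.

Lemma child_counter c l i d buf pos : stored c (Some (l, i)) buf pos -> is_node l i ->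
  sizes_ok buf pos -> (1 < l)%N -> (d < fan l)%N ->
  number_at (view c) (counter_base + d) = pos l.-1 (i * f + d)%N.
Proof.
move=> c_stored nd sizes l1 df; apply: number_at_mem; last exact: counter_word c_stored nd df.
have [_ pos_le] := sizes _ _ (node_child nd l1 df).
by have := fan_leb l.-1; lia.
Qed.

Lemma labels_buffer_view c l i buf pos k : stored c (Some (l, i)) buf pos -> is_node l i ->
  sizes_ok buf pos ->
  [seq label_of k w | w <- buffer_view (view c) l] = [seq label_of k w | w <- buf l i].
Proof.
move=> c_stored nd sizes; rewrite -(buffer_words c_stored nd sizes) -!map_comp.
by apply: eq_map => a /=; rewrite label_view_at.
Qed.

Lemma label_mask_buffer c l i d buf pos : stored c (Some (l, i)) buf pos -> is_node l i ->
  sizes_ok buf pos ->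
  label_mask_at (view c) l d = label_mask (@label_of W S (fan l)) d (buf l i).
Proof.
move=> c_stored nd sizes; have := labels_buffer_view (fan l) c_stored nd sizes.
move/(congr1 (map (fun o => o == Some d))).
by rewrite /label_mask_at /label_mask -!map_comp.
Qed.

Lemma first_labelE (A : Type) k (ws : seq (A + 'I_W)) :
  first_label k ws = ohead (pmap id [seq label_of k w | w <- ws]).
Proof.
rewrite /first_label; congr ohead; elim: ws => //= w ws ->.
by case: (label_of k w).
Qed.

Lemma first_label_buffer c l i buf pos : stored c (Some (l, i)) buf pos -> is_node l i ->
  sizes_ok buf pos ->
  first_label (fan l) (buffer_view (view c) l) = first_label (fan l) (buf l i).
Proof.
by move=> c_stored nd sizes; rewrite !first_labelE (labels_buffer_view _ c_stored nd sizes).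
Qed.

Lemma label_of_lt (A : Type) k (w : A + 'I_W) d : label_of k w = Some d -> (d < k)%N.
Proof. by case: w => //= a; case: ifP => // ak [<-]. Qed.

Lemma first_label_some l (ws : seq word) d : first_label (fan l) ws = Some d ->
  (d < fan l)%N /\ (0 < pending_labels l d ws)%N.
Proof.
rewrite /first_label /pending_labels /label_count; elim: ws => //= w ws IH.
case lw : (label_of (fan l) w) => [e|] /=; last by move/IH.
by case=> <-; rewrite eqxx; split=> //; exact: label_of_lt lw.
Qed.

Lemma first_label_none l (ws : seq word) : first_label (fan l) ws = None -> no_labels l ws.
Proof.
rewrite /first_label /no_labels; elim: ws => //= w ws IH.
by case: (label_of (fan l) w).
Qed.

Lemma below_step l i l' i' : (0 < f)%N -> below f l' i' l i =
  ((l' == l) && (i' == i)) || below f l' i' l.+1 (i %/ f).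
Proof.
move=> f_gt0; rewrite /below; case: (ltngtP l l') => [ll'|l'l|->] //=.
  by rewrite -divnMA -expnS subnSK.
by rewrite subnn expn0 divn1 eq_sym orbF.
Qed.

Lemma not_below_deeper l i l' i' : (l' < l)%N -> below f l' i' l i = false.
Proof. by move=> l'l; rewrite /below leqNgt l'l. Qed.

Lemma labels_ok_pos0 l i buf pos : labels_ok (l, i) buf pos -> is_node l i -> pos l i = 0%N.
Proof. by move=> labels nd; have := labels l i nd; rewrite belowxx. Qed.

Lemma labels_ok_down l i buf pos : labels_ok (l.+1, i %/ f)%N buf pos -> is_node l i ->
  pos l i = 0%N -> labels_ok (l, i) buf pos.
Proof.
move=> labels nd pos0 l' i' nd'; have := labels l' i' nd'.
rewrite /= [below f l' i' l i]below_step ?(node_fanout nd) //.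
by case: (boolP ((l' == l) && (i' == i))) => [/andP[/eqP-> /eqP->]|_].
Qed.

Lemma labels_ok_up l i buf pos : labels_ok (l, i) buf pos -> is_node l i ->
  no_labels l (buf l i) -> labels_ok (l.+1, i %/ f)%N buf pos.
Proof.
move=> labels nd nolab l' i' nd'; have := labels l' i' nd'.
rewrite /= [below f l' i' l i]below_step ?(node_fanout nd) //.
case: (boolP ((l' == l) && (i' == i))) => [/andP[/eqP-> /eqP->] _|_] //=.
by rewrite not_below_deeper.
Qed.

Lemma labels_ok_set_buffer l i ws buf pos : labels_ok (l, i) buf pos ->
  labels_ok (l, i) (set_node buf l i ws) pos.
Proof.
move=> labels l' i' nd; have := labels l' i' nd; case: ifP => //= not_below.
by rewrite set_node_other //; apply: contraFN not_below => /andP[/eqP-> /eqP->]; exact: belowxx.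
Qed.

Lemma labels_ok_set_pos n l i x buf pos : labels_ok n buf pos -> (l < n.1)%N ->
  labels_ok n buf (set_node pos l i x).
Proof.
move=> labels ln l' i' nd; have := labels l' i' nd; case: ifP => // is_below.
rewrite set_node_other //; apply/negP => /andP[/eqP l'E _].
by rewrite l'E not_below_deeper in is_below.
Qed.

Lemma sizes_ok_set_buffer l i ws buf pos : sizes_ok buf pos -> size ws = (fan l * b)%N ->
  sizes_ok (set_node buf l i ws) pos.
Proof.
move=> sizes ws_size l' i' nd; have [? ?] := sizes l' i' nd; split=> //.
by rewrite /set_node; case: ifP => // /andP[/eqP-> _].
Qed.

Lemma sizes_ok_set_pos l i x buf pos : sizes_ok buf pos -> (x <= fan l * b)%N ->
  sizes_ok buf (set_node pos l i x).
Proof.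
move=> sizes x_le l' i' nd; have [? ?] := sizes l' i' nd; split=> //.
by rewrite /set_node; case: ifP => // /andP[/eqP-> _].
Qed.

Lemma set_child_counter l i d x l' i' d' pos : is_node l i -> is_node l' i' ->
  (d < fan l)%N -> (d' < fan l')%N -> ~~ ((l' == l) && (i' == i)) ->
  set_node pos l.-1 (i * f + d) x l'.-1 (i' * f + d')%N = pos l'.-1 (i' * f + d')%N.
Proof.
move=> nd nd' df df'; move=> ne; apply: set_node_other; apply: contra ne => /andP[/eqP lE /eqP iE].
have -> : l' = l by case/and3P: nd'; case/and3P: nd; lia.
rewrite eqxx /= -(child_parent i' (leq_trans df' (fan_leq _))) iE.
by rewrite child_parent // (leq_trans df (fan_leq _)).
Qed.

Definition label_word (d : nat) : word := inr (number d).

Lemma label_of_label_word k d : (d < k)%N -> (k <= f)%N -> label_of k (label_word d) = Some d.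
Proof. by move=> dk kf; rewrite /label_of /= numberK ?dk //; lia. Qed.

Lemma refill_outside l ws a : (a < buffer_base)%N || (counter_base <= a)%N ->
  refill l ws a = inl a.
Proof.
rewrite /refill => a_out; rewrite ifF //; have := fan_leb l; have [cE bE hE] := basesE.
by lia.
Qed.

Lemma src_word_refill m l ws d t : size ws = (fan l * b)%N -> (d < fan l)%N -> (t < b)%N ->
  src_word m (refill l ws (part_cell d t)) =
  nth null_word [seq src_word m y | y <- ws] (d * b + t).
Proof.
move=> ws_size df t_lt; have dt_lt := ltn_muladd t_lt df; rewrite part_cell_buffer // /refill.
rewrite ifT; last by lia.
rewrite (nth_map (inl (buffer_base + d * b + t)%N)) ?ws_size //; congr (src_word m (nth _ _ _)).
by lia.
Qed.

Lemma represents_refill c src ws s buf pos buf' pos' l i :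
  stored c (Some (l, i)) buf pos -> is_node l i -> resident_node s = Some (l, i) ->
  size ws = (fan l * b)%N -> buf' = set_node buf l i [seq src_word c.1 y | y <- ws] ->
  (forall a, (a < counter_base)%N -> src a = refill l ws a) ->
  (forall d, (d < fan l)%N ->
     src_word c.1 (src (counter_base + d)%N) = inr (number (pos' l.-1 (i * f + d)))) ->
  (forall l' i' d, is_node l' i' -> ~~ ((l' == l) && (i' == i)) -> (d < fan l')%N ->
     pos' l'.-1 (i' * f + d)%N = pos l'.-1 (i' * f + d)%N) ->
  consistent s buf' pos' ->
  (forall m' dk', transferred s m' dk' buf' pos') ->
  represents (next c (act_with [::] src s (read_table P 0))) s buf' pos'.
Proof.
move=> c_stored nd s_node ws_size bufE srcE counterE posE s_ok tr.
have [cE bE hE] := basesE.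
apply: (represents_change c_stored nd) => //.
- move=> a /andP[_ a_lt]; rewrite srcE; last by lia.
  by apply: refill_outside; rewrite a_lt.
- move=> d t df; rewrite leq_eqVlt => /predU1P[->|t_lt].
    by rewrite part_cell_counter counterE // /part_word ltnn.
  rewrite srcE; last first.
    by have := ltn_muladd t_lt (leq_trans df (fan_leq l)); rewrite part_cell_buffer //; lia.
  by rewrite src_word_refill // /part_word t_lt bufE set_node_same.
by move=> l' i' ne; rewrite bufE set_node_other.
Qed.

Lemma label_represents c l i N buf pos ds : represents c (Label l i N) buf pos ->
  size ds = (fan l * b)%N -> all (fun d => d < fan l)%N ds ->
  represents (next c (label_act P used rate_mul l i N ds)) (Gather l i N)
    (set_node buf l i (map label_word ds)) pos.
Proof.
move=> [_ c_stored _ [sizes labels [nd NJ pos0]]] ds_size ds_lt.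
apply: (represents_refill c_stored nd _ _ (ws := [seq inr d | d <- ds])) => //.
- by rewrite size_map.
- by rewrite -map_comp.
- by move=> d df; rewrite refill_outside ?leq_addr ?orbT //; exact: counter_word c_stored nd df.
split=> //; first by apply: sizes_ok_set_buffer; rewrite ?size_map.
by apply: labels_ok_set_buffer; exact: labels_ok_down labels nd pos0.
Qed.

Lemma descend_leaf_represents c i d N buf pos : represents c (Gather 1 i N) buf pos ->
  first_label (fan 1) (buf 1%N i) = Some d ->
  represents (next c (goto [::] (Take 1 i d N) (read_table P (i * f + d)))) (Take 1 i d N)
    buf pos.
Proof.
move=> [_ c_stored _ [sizes labels [nd NJ]]] /first_label_some[df d_pending].
apply: represents_scan => // m scanE t t_lt; rewrite scanE //.
have [[_ table_disk _] _] := c_stored; apply: table_disk => //.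
by rewrite table_blocksE ?depth_gt0 ?(node_depth nd) //; exact: (node_child_size nd).
Qed.

Lemma descend_represents c l i d N buf pos : represents c (Gather l i N) buf pos ->
  (1 < l)%N -> first_label (fan l) (buf l i) = Some d ->
  (pos l.-1 (i * f + d) < fan l.-1 * b)%N ->
  represents (next c (goto [::] (Take l i d N)
     (read_part P l.-2 ((i * f + d) * f + pos l.-1 (i * f + d) %/ b)))) (Take l i d N)
    buf pos.
Proof.
move=> [_ c_stored _ [sizes labels [nd NJ]]] l1 /first_label_some[df d_pending] pos_lt.
have nd' := node_child nd l1 df.
apply: represents_scan => //.
  by split=> //; split=> // _; exact: leq_trans pos_lt (fan_leb _).
move=> m scanE t t_lt; rewrite gtn_eqF // scanE //.
have part_lt : (pos l.-1 (i * f + d) %/ b < fan l.-1)%N by rewrite ltn_divLR.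
have [_ parts] := c_stored; have := parts _ _ _ nd' part_lt.
rewrite ifF; last by apply/eqP => -[]; lia.
by move=> /(_ t (ltnW t_lt)) ->; rewrite /part_word t_lt.
Qed.

Lemma descend_refill_represents c l i d N buf pos : represents c (Gather l i N) buf pos ->
  (1 < l)%N -> first_label (fan l) (buf l i) = Some d ->
  represents (next c (act_with [::] (set_counter inl d 0) (SaveDown l i d 0 N) (read_table P 0)))
    (SaveDown l i d 0 N) buf (set_node pos l.-1 (i * f + d) 0).
Proof.
move=> [_ c_stored _ [sizes labels [nd NJ]]] l1 /first_label_some[df d_pending].
have [cE bE hE] := basesE.
apply: (represents_change c_stored nd) => //.
- by move=> a a_lt; rewrite /set_counter ifF //; lia.
- move=> d' t df'; rewrite leq_eqVlt => /predU1P[->|t_lt].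
    rewrite part_cell_counter /set_counter eqn_add2l /part_word ltnn /set_node eqxx /= eqn_add2l.
    by case: eqP => //= _; exact: counter_word c_stored nd df'.
  rewrite /set_counter ifF; last first.
    by have := ltn_muladd t_lt (leq_trans df' (fan_leq l)); rewrite part_cell_buffer //; lia.
  have [_ parts] := c_stored; have := parts l i d' nd df'; rewrite eqxx => partE.
  by rewrite /= (partE t (ltnW t_lt)) /part_word t_lt.
- by move=> l' i' d' nd' ne df'; exact: set_child_counter.
split=> //=; first exact: sizes_ok_set_pos.
  by apply: labels_ok_set_pos => //=; lia.
by rewrite l1 df set_node_same; split=> //; exact: node_fan_gt0 nd.
Qed.

Lemma save_up_start_represents c l i N buf pos : represents c (Gather l i N) buf pos ->
  first_label (fan l) (buf l i) = None -> (l < L)%N ->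
  represents (next c (goto [::] (SaveUp l i 0 N) (read_table P 0))) (SaveUp l i 0 N) buf pos.
Proof.
move=> [_ c_stored _ [sizes labels [nd NJ]]] /first_label_none nolab lL.
apply: represents_scan => //; split=> //=; last by split=> //; exact: node_fan_gt0 nd.
exact: labels_ok_up.
Qed.

Lemma gathered_settled c N buf pos : represents c (Gather L 0 N) buf pos ->
  first_label (fan L) (buf L 0%N) = None -> settled c buf pos 0.
Proof.
move=> [_ c_stored _ [sizes labels [nd NJ]]] /first_label_none nolab.
split=> //; last by rewrite (labels_ok_pos0 labels nd).
by have := labels_ok_up labels nd nolab; rewrite div0n.
Qed.

Lemma size_replaced l mask (cells : seq nat) :
  size (fill_mask mask [seq inl a | a <- cells] [seq inl a | a <- buffer_cells l] : seq (nat + nat))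
  = (fan l * b)%N.
Proof. by rewrite size_fill_mask size_map size_iota. Qed.

Lemma src_word_replaced c l i mask (cells : seq nat) buf pos :
  stored c (Some (l, i)) buf pos -> is_node l i -> sizes_ok buf pos ->
  [seq src_word c.1 y | y <- fill_mask mask [seq inl a | a <- cells]
     [seq inl a | a <- buffer_cells l]] =
  fill_mask mask [seq mem_at c.1 a | a <- cells] (buf l i).
Proof.
move=> c_stored nd sizes; rewrite map_fill_mask -!map_comp; congr fill_mask.
exact: (buffer_words c_stored nd sizes).
Qed.

Definition picked buf l i d (ts : seq nat) : seq word :=
  fill_mask (label_mask (@label_of W S (fan l)) d (buf l i))
    [seq table ((i * f + d) * b + t) | t <- ts] (buf l i).

Lemma pick_represents c i d N buf pos ts : represents c (Take 1 i d N) buf pos ->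
  size ts = (fan 1 * b)%N -> all (fun t => t < b)%N ts ->
  represents (next c (pick_act used rate_mul (view c) 1 i d N ts)) (Gather 1 i N)
    (set_node buf 1 i (picked buf 1 i d ts)) pos.
Proof.
move=> [_ c_stored scanE [sizes labels [nd NJ df d_pending _]]] ts_size ts_lt.
rewrite /pick_act (label_mask_buffer _ c_stored nd sizes).
apply: (represents_refill c_stored nd _ (size_replaced _ _ _)) => //.
- rewrite (src_word_replaced _ _ c_stored nd sizes) -map_comp.
  congr (set_node _ _ _ (fill_mask _ _ _)).
  by apply/eq_in_map => t /(allP ts_lt) t_lt /=; rewrite scanE.
- move=> d' df'; rewrite /replace refill_outside ?leq_addr ?orbT //.
  exact: counter_word c_stored nd df'.
split=> //; last exact: labels_ok_set_buffer.
by apply: sizes_ok_set_buffer; rewrite ?size_fill_mask; have [] := sizes 1%N i nd.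
Qed.

Definition take_count buf pos l i d : nat :=
  minn (b - pos l.-1 (i * f + d)%N %% b) (pending_labels l d (buf l i)).

Definition taken_words buf pos l i d : seq word :=
  take (take_count buf pos l i d)
    (drop (pos l.-1 (i * f + d)%N) (buf l.-1 (i * f + d)%N)).

Definition taken buf pos l i d : seq word :=
  fill_mask (label_mask (@label_of W S (fan l)) d (buf l i)) (taken_words buf pos l i d)
    (buf l i).

Lemma take_count_le l i d N buf pos : consistent (Take l i d N) buf pos -> (1 < l)%N ->
  (pos l.-1 (i * f + d) + take_count buf pos l i d <= f * b)%N /\
  size (buf l.-1 (i * f + d)%N) = (f * b)%N.
Proof.
move=> [sizes _ [nd NJ df d_pending pos_lt]] l1; have nd' := node_child nd l1 df.
have [sz _] := sizes _ _ nd'; rewrite fan_inner ?(child_level nd) // in sz; split=> //.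
have := pos_lt l1; rewrite /take_count; set x := pos _ _ => x_lt.
have xE := divn_eq x b; have x_mod := ltn_pmod x b_gt0.
have : ((x %/ b).+1 * b <= f * b)%N by rewrite leq_mul2r ltn_divLR // x_lt orbT.
by rewrite mulSn; lia.
Qed.

Lemma size_taken_words l i d N buf pos : consistent (Take l i d N) buf pos -> (1 < l)%N ->
  size (taken_words buf pos l i d) = take_count buf pos l i d.
Proof.
move=> s_ok l1; have [count_le sz] := take_count_le s_ok l1.
by rewrite size_takel // size_drop sz; lia.
Qed.

Lemma scanned_taken_words c l i d N buf pos : represents c (Take l i d N) buf pos ->
  (1 < l)%N -> let x := pos l.-1 (i * f + d)%N in
  [seq mem_at c.1 a | a <- iota (1 + x %% b) (take_count buf pos l i d)] =
  taken_words buf pos l i d.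
Proof.
move=> [_ _ scanE s_ok] l1 x; have sz := size_taken_words s_ok l1.
apply: (@eq_from_nth _ null_word); rewrite size_map size_iota ?sz // => r r_lt.
have count_le : (take_count buf pos l i d <= b - x %% b)%N by rewrite geq_minl.
rewrite (nth_map 0%N) ?size_iota // nth_iota // -addnA scanE; last by lia.
by rewrite gtn_eqF // nth_take // nth_drop addnA -/x -divn_eq.
Qed.

Lemma take_represents c l i d N buf pos : represents c (Take l i d N) buf pos -> (1 < l)%N ->
  represents (next c (take_act used rate_mul (view c) l i d N)) (Gather l i N)
    (set_node buf l i (taken buf pos l i d))
    (set_node pos l.-1 (i * f + d) (pos l.-1 (i * f + d) + take_count buf pos l i d)%N).
Proof.
move=> c_rep l1; have [_ c_stored _ s_ok] := c_rep.
have [sizes labels [nd NJ df d_pending pos_lt]] := s_ok.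
have [count_le _] := take_count_le s_ok l1; have [cE bE hE] := basesE.
rewrite /take_act (label_mask_buffer _ c_stored nd sizes).
rewrite (child_counter c_stored nd sizes l1 df) -/(label_count _ _ _) -/(pending_labels _ _ _).
rewrite -/(take_count buf pos l i d); set mask := label_mask _ _ _; set cells := iota _ _.
apply: (represents_refill c_stored nd _ (size_replaced l mask cells)) => //.
- by rewrite (src_word_replaced _ _ c_stored nd sizes) (scanned_taken_words c_rep l1).
- by move=> a a_lt; rewrite /set_counter ifF //; lia.
- move=> d' df'; rewrite /set_counter eqn_add2l /set_node eqxx /= eqn_add2l.
  case: eqP => //= _; rewrite /replace refill_outside ?leq_addr ?orbT //.
  exact: counter_word c_stored nd df'.
- by move=> l' i' d' nd' ne df'; exact: set_child_counter.
split=> //; last by apply: labels_ok_set_buffer; apply: labels_ok_set_pos => //=; lia.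
apply: sizes_ok_set_pos; last by rewrite fan_inner ?(child_level nd).
by apply: sizes_ok_set_buffer; rewrite ?size_fill_mask; have [] := sizes l i nd.
Qed.

(** * Amortized cost *)

Hypothesis fanout_gt1 : (0 < L)%N -> (1 < f)%N.

(* Costs are counted in units of [1 / b] I/Os. *)
Definition sample_price (l : nat) : nat := (10 * l)%N.

Definition draw_price : nat := if f0 == 0%N then 1%N else sample_price L.

Definition consumed_credit (l x : nat) : nat := (sample_price l * x + 2 * (x %% b))%N.

Definition label_cost (l q : nat) : nat :=
  ((sample_price l.-1 + 2) * q + 2 * b * (0 < q))%N.

Definition labels_cost (l : nat) (ws : seq word) : nat :=
  (\sum_(d < fan l) label_cost l (pending_labels l d ws))%N.

Definition sum_nodes (h : nat -> nat -> nat) : nat :=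
  (\sum_(l < L.+1) \sum_(i < level_size l) (if l == 0 :> nat then 0 else h l i))%N.

Definition consumed_potential pos : nat :=
  sum_nodes (fun l i => if l == L then 0%N else consumed_credit l (pos l i)).

Definition labels_potential buf : nat := sum_nodes (fun l i => labels_cost l (buf l i)).

Definition ascent_cost l : nat := ((L - l) * ((2 * f + 2) * b))%N.

Definition refill_cost l : nat :=
  ((sample_price l.-1 + 2) * (fan l * b) + 2 * b * fan l +
   (if l == L then 0 else (2 * f + 2) * b))%N.

(* An upper bound on the remaining cost of the current query plus the potential of the
   final configuration. *)
Definition budget s buf pos : nat :=
  (consumed_potential pos + labels_potential buf +
  match s with
  | Idle x => sample_price L * x
  | Direct _ N => draw_price * N + b * used
  | HeavyScan j x => sample_price L * x + b * (used - j.+1)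
  | TableScan s _ x => sample_price L * x + b * (slots - s.+1) + b * used
  | Label l _ N => ascent_cost l.+1 + refill_cost l + b + draw_price * N + b * used
  | Gather l _ N => ascent_cost l + draw_price * N + b * used
  | Take l _ _ N => ascent_cost l + draw_price * N + b * used
  | SaveDown l _ _ j N =>
      ascent_cost l + refill_cost l.-1 + b + f * b + (fan l - j) * b +
      draw_price * N + b * used
  | SaveUp l _ j N =>
      ascent_cost l.+1 + f * b + (fan l - j) * b + draw_price * N + b * used
  | LoadDown l _ j N =>
      ascent_cost l.+1 + refill_cost l + b + (fan l - j) * b + draw_price * N + b * used
  | LoadUp l _ j N => ascent_cost l + (fan l - j) * b + draw_price * N + b * used
  end - (if s is Take _ _ _ _ then b else 0))%N.

Definition draw_budget buf pos x N : nat :=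
  (consumed_potential pos + labels_potential buf + sample_price L * x +
   draw_price * N + b * used)%N.

Definition start_budget buf pos x N : nat :=
  (consumed_potential pos + labels_potential buf + sample_price L * x + b * used +
   (if N == J.+1 then b * slots else draw_price * N))%N.

Definition leads c bound a s buf pos : Prop :=
  [/\ represents (next c a) s buf pos, halts a.2 = is_idle s &
      (budget s buf pos + (~~ is_idle s) * b <= bound)%N].

Lemma sum_nodes_update h h' l i : is_node l i ->
  (forall l' i', ~~ ((l' == l) && (i' == i)) -> h l' i' = h' l' i') ->
  (sum_nodes h + h' l i = sum_nodes h' + h l i)%N.
Proof.
case/and3P=> l0 lL il hE; have l_lt : (l < L.+1)%N by rewrite ltnS.
have l_neq0 : (l == 0%N) = false by lia.
pose rest g := (\sum_(j < level_size l | j != Ordinal il) g l j +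
  \sum_(k < L.+1 | k != Ordinal l_lt) \sum_(j < level_size k)
    (if k == 0 :> nat then 0 else g k j))%N.
have sum_nodesE g : sum_nodes g = (g l i + rest g)%N.
  rewrite /sum_nodes (bigD1 (Ordinal l_lt)) //= (bigD1 (Ordinal il)) //= l_neq0 -addnA.
  by congr (_ + (_ + _))%N; apply: eq_bigr.
have restE : rest h = rest h'.
  congr (_ + _)%N; first by apply: eq_bigr => j ne; apply: hE; rewrite eqxx; exact: ne.
  apply: eq_bigr => k ne; apply: eq_bigr => j _; case: ifP => // _; apply: hE.
  by rewrite negb_and (_ : (k != l :> nat) = true) //; exact: ne.
by rewrite !sum_nodesE restE; lia.
Qed.

Lemma leq_sum_nodes h h' : (forall l i, is_node l i -> h l i <= h' l i)%N ->
  (sum_nodes h <= sum_nodes h')%N.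
Proof.
move=> hh'; apply: leq_sum => l _; apply: leq_sum => i _; case: eqP => // l0.
by apply: hh'; rewrite /is_node lt0n (introF eqP l0) /= -ltnS !ltn_ord.
Qed.

Lemma pending_labels_le l d ws : (pending_labels l d ws <= size ws)%N.
Proof. exact: label_count_le. Qed.

Lemma sum_pending_labels_le l ws : (\sum_(d < fan l) pending_labels l d ws <= size ws)%N.
Proof.
rewrite /pending_labels /label_count /label_mask; elim: ws => [|w ws IH] /=.
  by rewrite big1.
rewrite big_split /= -[(size ws).+1]add1n leq_add //.
case lw: (label_of (fan l) w) => [e|]; last by rewrite big1.
rewrite (bigD1 (Ordinal (label_of_lt lw))) //= eqxx big1 ?addn0 // => d ne.
by case: eqP => // -[dE]; case/eqP: ne; apply: val_inj.
Qed.

Lemma labels_cost_le l ws : size ws = (fan l * b)%N ->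
  (labels_cost l ws <= (sample_price l.-1 + 2) * (fan l * b) + 2 * b * fan l)%N.
Proof.
move=> ws_size; rewrite /labels_cost /label_cost big_split /= -!big_distrr /= leq_add //.
  by rewrite leq_mul2l -ws_size sum_pending_labels_le orbT.
rewrite leq_mul2l; apply/orP; right.
rewrite -[X in (_ <= X)%N]card_ord -sum1_card; apply: leq_sum => d _.
by case: (0 < _)%N.
Qed.

Lemma labels_cost_fill l d (ys ws : seq word) : (d < fan l)%N ->
  {in ys, forall y, label_of (fan l) y = None} ->
  (labels_cost l (fill_mask (label_mask (@label_of W S (fan l)) d ws) ys ws) +
     label_cost l (pending_labels l d ws) =
   labels_cost l ws +
     label_cost l (pending_labels l d ws - minn (size ys) (pending_labels l d ws)))%N.
Proof.
move=> df ys_nolab; rewrite /labels_cost (bigD1 (Ordinal df)) //=.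
rewrite [X in (_ = X + _)%N](bigD1 (Ordinal df)) //= /pending_labels label_count_fill // eqxx.
rewrite (eq_bigr (fun e : 'I_(fan l) => label_cost l (label_count (@label_of W S (fan l)) e ws))).
  by rewrite addnC addnCA addnC.
move=> e ne; rewrite label_count_fill // (_ : (e == d :> nat) = false) ?subn0 //.
exact: negbTE.
Qed.

Lemma labels_potential_set buf l i ws : is_node l i ->
  (labels_potential (set_node buf l i ws) + labels_cost l (buf l i) =
   labels_potential buf + labels_cost l ws)%N.
Proof.
move=> nd; have := @sum_nodes_update (fun l' i' => labels_cost l' (set_node buf l i ws l' i'))
  (fun l' i' => labels_cost l' (buf l' i')) l i nd.
by rewrite set_node_same; apply=> l' i' ne; rewrite set_node_other.
Qed.

Lemma consumed_potential_set pos l i x : is_node l i -> (l < L)%N ->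
  (consumed_potential (set_node pos l i x) + consumed_credit l (pos l i) =
   consumed_potential pos + consumed_credit l x)%N.
Proof.
move=> nd lL; have := @sum_nodes_update
  (fun l' i' => if l' == L then 0%N else consumed_credit l' (set_node pos l i x l' i'))
  (fun l' i' => if l' == L then 0%N else consumed_credit l' (pos l' i')) l i nd.
by rewrite set_node_same ltn_eqF //; apply=> l' i' ne; rewrite set_node_other.
Qed.

Lemma consumed_potential_root pos x :
  consumed_potential (set_node pos L 0 x) = consumed_potential pos.
Proof.
apply: eq_bigr => l _; apply: eq_bigr => i _; case: ifP => // _.
by case: eqP => // ne; rewrite set_node_other // (introF eqP ne).
Qed.

Lemma labels_potential_ge l i d buf : is_node l i -> (d < fan l)%N ->
  (0 < pending_labels l d (buf l i))%N -> (2 * b <= labels_potential buf)%N.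
Proof.
move=> nd df d_pending; have := labels_potential_set buf [::] nd.
have -> : labels_cost l [::] = 0%N.
  by rewrite /labels_cost big1 // => e _; rewrite /label_cost !muln0.
rewrite addn0 => <-; rewrite /labels_cost (bigD1 (Ordinal df)) //= /label_cost d_pending muln1.
by lia.
Qed.

Lemma scan_cost n j : (j < n)%N ->
  ((n - j) * b = (n - j.+1) * b + b)%N /\ (b <= (n - j) * b)%N.
Proof.
by move=> jn; split; [rewrite -mulSnr; congr muln; lia | rewrite leq_pmull ?subn_gt0].
Qed.

Lemma finish_leads c reports x buf pos : settled c buf pos x ->
  leads c (consumed_potential pos + labels_potential buf + sample_price L * x + b * used)
    (finish P used rate_mul reports x) (finish_state used x) buf pos.
Proof.
move=> c_settled; split; first exact: finish_represents.
  by rewrite /finish /finish_state; case: eqP.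
rewrite /finish_state /budget; case: eqP => /= [->|used0]; first by lia.
by have [scanE scan_ge] := @scan_cost used 0 ltac:(lia); rewrite !subn0 in scanE *; lia.
Qed.

Lemma leads_le c bound bound' a s buf pos :
  (bound <= bound')%N -> leads c bound a s buf pos -> leads c bound' a s buf pos.
Proof. by move=> le_bound [? ? le_budget]; split=> //; exact: leq_trans le_bound. Qed.

Lemma draw_finish_leads c reports x N buf pos : settled c buf pos x ->
  (N <= fan L * b - x)%N ->
  leads c (draw_budget buf pos x N) (finish P used rate_mul reports (x + N))
    (finish_state used (x + N)) buf (set_node pos L 0 (x + N)%N).
Proof.
move=> c_settled N_le; have [_ _ _ _ x_le] := c_settled.
have x'_le : (x + N <= fan L * b)%N by lia.
apply: leads_le (finish_leads _ (settled_set_root c_settled x'_le)).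
rewrite consumed_potential_root mulnDr /draw_budget.
suff : (sample_price L * N <= draw_price * N)%N by lia.
rewrite /draw_price; case: eqP => // f00; move: N_le.
by rewrite fan_root f00 mul0n sub0n leqn0 => /eqP->; rewrite !muln0.
Qed.

Lemma draw_label_leads c reports x N buf pos : settled c buf pos x -> (0 < f0)%N ->
  (N <= J)%N -> (fan L * b - x < N)%N ->
  leads c (draw_budget buf pos x N)
    (goto reports (Label L 0 (N - (fan L * b - x))) (read_table P 0))
    (Label L 0 (N - (fan L * b - x))) buf (set_node pos L 0 0%N).
Proof.
move=> c_settled f0_gt0 NJ N_gt; have [_ _ _ _ x_le] := c_settled.
split=> //; first by apply: root_label_represents c_settled f0_gt0 _; lia.
rewrite mul1n /budget /draw_budget consumed_potential_root subn0 /ascent_cost subnS subnn mul0n.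
rewrite /refill_cost eqxx /draw_price gtn_eqF // fan_root in x_le N_gt *.
have priceE : (sample_price L = sample_price L.-1 + 10)%N.
  by rewrite /sample_price; have := depthE; lia.
have live_price : (sample_price L * (f0 * b - x) + sample_price L * x =
    sample_price L * (f0 * b))%N by rewrite -mulnDr subnK.
rewrite -{2}(subnK (ltnW N_gt)) mulnDr; have : (b <= f0 * b)%N by rewrite leq_pmull.
by move: live_price; rewrite priceE !mulnDl; lia.
Qed.

Lemma direct_leads c reports s N buf pos : settled c buf pos 0 -> f0 = 0%N ->
  (s < slots)%N -> (0 < N <= J)%N ->
  leads c (draw_budget buf pos 0 N) (goto reports (Direct s N.-1) (read_table P (s %/ b)))
    (Direct s N.-1) buf pos.
Proof.
move=> c_settled f00 s_lt /andP[N0 NJ]; split=> //.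
  by apply: direct_represents => //; lia.
by rewrite /budget /draw_budget /draw_price f00 eqxx (b_flat f00) subn0; lia.
Qed.

Lemma heavy_scan_leads c reports j x buf pos : settled c buf pos x -> (j.+1 < used)%N ->
  leads c (budget (HeavyScan j x) buf pos)
    (goto reports (HeavyScan j.+1 x) (read_heavy P j.+1)) (HeavyScan j.+1 x) buf pos.
Proof.
move=> c_settled j_used; split=> //; first exact: heavy_scan_represents.
by rewrite /budget !subn0; have [scanE scan_ge] := scan_cost j_used; lia.
Qed.

Lemma halt_leads c reports j x buf pos : settled c buf pos x ->
  leads c (budget (HeavyScan j x) buf pos) (goto reports (Idle x) (Halt _ _ _))
    (Idle x) buf pos.
Proof.
move=> c_settled; split=> //; first exact: halt_represents.
by rewrite mul0n addn0 /budget !subn0 leq_add2l leq_addr.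
Qed.

Lemma table_scan_leads c reports s t t' x buf pos : settled c buf pos x ->
  (s.+1 < slots)%N -> (t' <= J.+1)%N ->
  leads c (budget (TableScan s t x) buf pos)
    (goto reports (TableScan s.+1 t' x) (read_table P (s.+1 %/ b)))
    (TableScan s.+1 t' x) buf pos.
Proof.
move=> c_settled s_lt t'J; split=> //; first exact: table_scan_represents.
by rewrite /budget !subn0; have [scanE scan_ge] := scan_cost s_lt; lia.
Qed.

Lemma table_scan_start_leads c reports x buf pos : settled c buf pos x ->
  leads c (start_budget buf pos x J.+1)
    (goto reports (TableScan 0 J.+1 x) (read_table P 0)) (TableScan 0 J.+1 x) buf pos.
Proof.
move=> c_settled; split=> //.
  by have := table_scan_represents reports c_settled slots_gt0 (leqnn _); rewrite div0n.
rewrite mul1n /budget /start_budget eqxx !subn0.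
by have [scanE scan_ge] := scan_cost slots_gt0; rewrite !subn0 in scanE *; lia.
Qed.

Lemma label_leads c l i N buf pos ds : represents c (Label l i N) buf pos ->
  size ds = (fan l * b)%N -> all (fun d => d < fan l)%N ds ->
  leads c (budget (Label l i N) buf pos) (label_act P used rate_mul l i N ds) (Gather l i N)
    (set_node buf l i (map label_word ds)) pos.
Proof.
move=> c_rep ds_size ds_lt; split=> //; first exact: label_represents.
have [_ _ _ [_ _ [nd _ _]]] := c_rep; rewrite mul1n /budget !subn0.
have potential := labels_potential_set buf (map label_word ds) nd.
have cost_le : (labels_cost l (map label_word ds) <= _)%N := labels_cost_le (_ : _ = _).
rewrite /refill_cost.
have : (ascent_cost l <= ascent_cost l.+1 + (if l == L then 0 else (2 * f + 2) * b))%N.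
  rewrite /ascent_cost; case: eqP => [->|ne]; first by rewrite subnn mul0n.
  have -> : (L - l = (L - l.+1).+1)%N by case/and3P: nd; lia.
  by rewrite mulSn addnC.
by have := cost_le ltac:(by rewrite size_map); lia.
Qed.

Lemma descend_leads c l i d N buf pos : represents c (Gather l i N) buf pos ->
  first_label (fan l) (buf l i) = Some d ->
  (l = 1%N \/ (1 < l)%N /\ (pos l.-1 (i * f + d) < fan l.-1 * b)%N) ->
  leads c (budget (Gather l i N) buf pos) (descend_act used rate_mul (view c) l i d N)
    (Take l i d N) buf pos.
Proof.
move=> c_rep fl l_cases; have [_ c_stored _ [sizes labels [nd NJ]]] := c_rep.
have [df d_pending] := first_label_some fl.
have budget_le : (budget (Take l i d N) buf pos + true * b <= budget (Gather l i N) buf pos)%N.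
  by rewrite mul1n /budget; have := labels_potential_ge nd df d_pending; lia.
rewrite /descend_act; case: l_cases => [lE|[l1 pos_lt]].
  by subst l; split=> //; exact: descend_leaf_represents.
rewrite gtn_eqF // (child_counter c_stored nd sizes l1 df) pos_lt.
by split=> //; exact: descend_represents.
Qed.

Lemma descend_refill_leads c l i d N buf pos : represents c (Gather l i N) buf pos ->
  (1 < l)%N -> first_label (fan l) (buf l i) = Some d ->
  (fan l.-1 * b <= pos l.-1 (i * f + d))%N ->
  leads c (budget (Gather l i N) buf pos) (descend_act used rate_mul (view c) l i d N)
    (SaveDown l i d 0 N) buf (set_node pos l.-1 (i * f + d) 0%N).
Proof.
move=> c_rep l1 fl pos_ge; have [_ c_stored _ [sizes labels [nd NJ]]] := c_rep.
have [df d_pending] := first_label_some fl; have nd' := node_child nd l1 df.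
have lL := child_level nd.
rewrite /descend_act gtn_eqF // (child_counter c_stored nd sizes l1 df) ltnNge pos_ge.
split=> //; first exact: descend_refill_represents.
have [_ pos_le] := sizes _ _ nd'; rewrite fan_inner // in pos_ge pos_le.
rewrite mul1n /budget !subn0 -[consumed_potential pos]addn0.
have := consumed_potential_set pos 0 nd' lL.
have -> : pos l.-1 (i * f + d)%N = (f * b)%N by lia.
rewrite /consumed_credit muln0 mod0n muln0 modnMl muln0 !addn0 => <-.
rewrite /refill_cost (ltn_eqF lL) fan_inner //.
have priceE : (sample_price l.-1 = sample_price l.-2 + 10)%N by rewrite /sample_price; lia.
have fl_le := fan_leb l.
have f2 : (2 * b <= f * b)%N by rewrite leq_mul2r (fanout_gt1 (node_depth nd)) orbT.
rewrite priceE !mulnDl; lia.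
Qed.

Lemma save_up_start_leads c l i N buf pos : represents c (Gather l i N) buf pos ->
  first_label (fan l) (buf l i) = None -> (l < L)%N ->
  leads c (budget (Gather l i N) buf pos) (goto [::] (SaveUp l i 0 N) (read_table P 0))
    (SaveUp l i 0 N) buf pos.
Proof.
move=> c_rep fl lL; split=> //; first exact: save_up_start_represents.
rewrite mul1n /budget !subn0 /ascent_cost.
have -> : (L - l = (L - l.+1).+1)%N by lia.
by rewrite fan_inner // mulSn mulnDl; lia.
Qed.

Lemma pick_leads c i d N buf pos ts : represents c (Take 1 i d N) buf pos ->
  size ts = (fan 1 * b)%N -> all (fun t => t < b)%N ts ->
  leads c (budget (Take 1 i d N) buf pos) (pick_act used rate_mul (view c) 1 i d N ts)
    (Gather 1 i N) (set_node buf 1 i (picked buf 1 i d ts)) pos.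
Proof.
move=> c_rep ts_size ts_lt; split=> //; first exact: pick_represents.
have [_ _ _ [sizes _ [nd _ df d_pending _]]] := c_rep; have [sz _] := sizes _ _ nd.
rewrite mul1n /budget; have := labels_potential_ge nd df d_pending.
have := labels_potential_set buf (picked buf 1 i d ts) nd.
have ys_nolab : {in [seq table ((i * f + d) * b + t) | t <- ts],
    forall y, label_of (fan 1) y = None}.
  by move=> _ /mapP[t _ ->]; exact: table_nolabel (fan_leq _).
have := labels_cost_fill (buf 1%N i) df ys_nolab; rewrite -/(picked buf 1 i d ts).
rewrite size_map ts_size -sz (minn_idPr (pending_labels_le _ _ _)) subnn /label_cost.
by rewrite d_pending ltnn !muln0 muln1; lia.
Qed.

Lemma taken_words_nolabel c l i d N buf pos : represents c (Take l i d N) buf pos ->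
  (1 < l)%N -> {in taken_words buf pos l i d, forall y,
    label_of (fan l) y = None /\ label_of (fan l.-1) y = None}.
Proof.
move=> [_ _ _ [sizes labels [nd NJ df _ _]]] l1 y /mem_take /mem_drop y_child.
have := labels _ _ (node_child nd l1 df); rewrite not_below_deeper; last by rewrite /=; lia.
move=> /allP/(_ y y_child)/eqP y_nolab; split=> //; move: y_nolab.
rewrite (fan_inner (child_level nd)) /label_of; case: y {y_child} => // k; case: ifP => // kf _.
by rewrite ifF //; have := fan_leq l; lia.
Qed.

(* Taking items from a child either moves its read position to the next block or serves
   all the labels of the child; both release [2 * b]. *)
Lemma take_credit l x q k : (0 < q)%N -> k = minn (b - x %% b) q ->
  (consumed_credit l.-1 (x + k) + label_cost l (q - k) + 2 * b <=
   consumed_credit l.-1 x + label_cost l q)%N.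
Proof.
move=> q_gt0 kE; rewrite /consumed_credit /label_cost q_gt0 muln1 mulnDr.
have x_mod := ltn_pmod x b_gt0.
have k_le : (k <= q)%N by rewrite kE geq_minr.
have qE : ((sample_price l.-1 + 2) * q =
    (sample_price l.-1 + 2) * (q - k) + (sample_price l.-1 * k + 2 * k))%N.
  by rewrite -mulnDl -mulnDr subnK.
have [all_served|[some_left block_done]] : k = q \/ (k < q)%N /\ k = (b - x %% b)%N.
  by lia.
  have : ((x + k) %% b <= x %% b + k)%N by rewrite -modnDml; exact: leq_mod.
  by move: qE; rewrite all_served subnn ltnn !muln0; lia.
have -> : ((x + k) %% b = 0)%N.
  by rewrite -modnDml block_done subnKC ?modnn // ltnW.
have -> : (0 < q - k)%N by lia.
by lia.
Qed.

Lemma take_leads c l i d N buf pos : represents c (Take l i d N) buf pos -> (1 < l)%N ->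
  leads c (budget (Take l i d N) buf pos) (take_act used rate_mul (view c) l i d N) (Gather l i N)
    (set_node buf l i (taken buf pos l i d))
    (set_node pos l.-1 (i * f + d) (pos l.-1 (i * f + d) + take_count buf pos l i d)%N).
Proof.
move=> c_rep l1; split=> //; first exact: take_represents.
have [_ _ _ s_ok] := c_rep; have [_ _ [nd _ df d_pending _]] := s_ok.
have nd' := node_child nd l1 df.
rewrite mul1n /budget; have := labels_potential_ge nd df d_pending.
have ys_nolab : {in taken_words buf pos l i d, forall y, label_of (fan l) y = None}.
  by move=> y /(taken_words_nolabel c_rep l1)[].
have := labels_potential_set buf (taken buf pos l i d) nd.
have := labels_cost_fill (buf l i) df ys_nolab; rewrite -/(taken buf pos l i d).
rewrite (size_taken_words s_ok l1) (minn_idPl (geq_minr _ _)) -/(take_count buf pos l i d).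
have := consumed_potential_set pos (pos l.-1 (i * f + d) + take_count buf pos l i d)%N nd'
  (child_level nd).
by have := take_credit l d_pending (erefl (take_count buf pos l i d)); lia.
Qed.

Lemma save_down_leads c l i d j N buf pos : represents c (SaveDown l i d j N) buf pos ->
  leads c (budget (SaveDown l i d j N) buf pos)
    (goto [::] (after_save_down l i d j N) (save_part P l i j)) (after_save_down l i d j N)
    buf pos.
Proof.
move=> c_rep; split; [exact: save_down_represents | by rewrite /after_save_down; case: ifP |].
have [_ _ _ [_ _ [nd _ /andP[l1 df] jf _]]] := c_rep.
have [scanE scan_ge] := scan_cost jf.
rewrite /after_save_down; case: ltnP => _; rewrite mul1n /budget !subn0.
  by lia.
by rewrite prednK ?(fan_inner (child_level nd)) ?(ltnW l1) //; lia.
Qed.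

Lemma save_up_leads c l i j N buf pos : represents c (SaveUp l i j N) buf pos ->
  leads c (budget (SaveUp l i j N) buf pos)
    (goto [::] (after_save_up l i j N) (save_part P l i j)) (after_save_up l i j N) buf pos.
Proof.
move=> c_rep; split; [exact: save_up_represents | by rewrite /after_save_up; case: ifP |].
have [_ _ _ [_ _ [nd _ lL jf]]] := c_rep; have := fan_leb l.+1.
have [scanE scan_ge] := scan_cost jf.
by rewrite /after_save_up; case: ltnP => _; rewrite mul1n /budget !subn0; lia.
Qed.

Lemma load_down_leads c l i j N buf pos : represents c (LoadDown l i j N) buf pos ->
  leads c (budget (LoadDown l i j N) buf pos)
    (goto [::] (after_load_down l i j N) (load_part P l i j)) (after_load_down l i j N)
    buf pos.
Proof.
move=> c_rep; split; [exact: load_down_represents | by rewrite /after_load_down; case: ifP |].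
have [_ _ _ [_ _ [nd _ lL jf _]]] := c_rep.
have [scanE scan_ge] := scan_cost jf.
by rewrite /after_load_down; case: ltnP => _; rewrite mul1n /budget !subn0; lia.
Qed.

Lemma load_up_leads c l i j N buf pos : represents c (LoadUp l i j N) buf pos ->
  leads c (budget (LoadUp l i j N) buf pos)
    (goto [::] (after_load_up l i j N) (load_part P l i j)) (after_load_up l i j N) buf pos.
Proof.
move=> c_rep; split; [exact: load_up_represents | by rewrite /after_load_up; case: ifP |].
have [_ _ _ [_ _ [nd _ jf]]] := c_rep.
have [scanE scan_ge] := scan_cost jf.
by rewrite /after_load_up; case: ltnP => _; rewrite mul1n /budget !subn0; lia.
Qed.

Definition advances c bound a : Prop := exists s buf pos, leads c bound a s buf pos.

Lemma leads_advances c bound a s buf pos : leads c bound a s buf pos -> advances c bound a.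
Proof. by move=> a_leads; exists s, buf, pos. Qed.

Lemma draw_advances c reports x N buf pos : settled c buf pos x -> (N <= J)%N ->
  surely (draw used rate_mul (view c) reports N x) (advances c (draw_budget buf pos x N)).
Proof.
move=> c_settled NJ; apply: surely_bind => D _; case: leqP => N_live.
  by apply: surely_ret; apply: leads_advances; exact: draw_finish_leads.
case: posnP => [f00|f0_gt0]; last first.
  by apply: surely_ret; apply: leads_advances; exact: draw_label_leads.
apply: surely_map => s /(surely_uniform slots_gt0) s_lt; apply: leads_advances.
have x0 : x = 0%N by case: c_settled => _ _ _ _; rewrite fan_root f00; lia.
by rewrite x0 in c_settled *; apply: direct_leads => //; lia.
Qed.

Lemma start_advances c reports x N buf pos : settled c buf pos x -> (N <= J.+1)%N ->
  surely (start used rate_mul (view c) reports N x) (advances c (start_budget buf pos x N)).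
Proof.
move=> c_settled NJ; rewrite /start; case: eqP => [->|ne].
  by apply: surely_ret; apply: leads_advances; exact: table_scan_start_leads.
have -> : start_budget buf pos x N = draw_budget buf pos x N.
  by rewrite /start_budget (introF eqP ne) addnAC.
by apply: draw_advances c_settled _; lia.
Qed.

Lemma gather_draw_budget N buf pos :
  budget (Gather L 0 N) buf pos = draw_budget buf pos 0 N.
Proof.
by rewrite /budget /draw_budget /ascent_cost subnn subn0 muln0 addn0 add0n addnA.
Qed.

Lemma direct_draw_budget s N buf pos :
  budget (Direct s N) buf pos = draw_budget buf pos 0 N.
Proof. by rewrite /budget /draw_budget subn0 muln0 addn0 addnA. Qed.

Lemma last_scan_budget s t x buf pos :
  (consumed_potential pos + labels_potential buf + sample_price L * x + b * used <=
   budget (TableScan s t x) buf pos)%N.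
Proof. by rewrite /budget subn0; have := leq0n (b * (slots - s.+1)); lia. Qed.

Lemma gather_advances c l i N buf pos : represents c (Gather l i N) buf pos ->
  surely (step used rate_mul (view c) (Gather l i N)) (advances c (budget (Gather l i N) buf pos)).
Proof.
move=> c_rep; have [_ c_stored _ [sizes _ [nd NJ]]] := c_rep.
rewrite /= (first_label_buffer c_stored nd sizes).
case fl : (first_label _ _) => [d|].
  apply: surely_ret; have [df d_pending] := first_label_some fl.
  have [l1|l1] := leqP l 1.
    by apply: leads_advances; apply: descend_leads => //; left; case/and3P: nd; lia.
  have [pos_ge|pos_lt] := leqP (fan l.-1 * b) (pos l.-1 (i * f + d)).
    by apply: leads_advances; exact: descend_refill_leads.
  by apply: leads_advances; apply: descend_leads => //; right.
case: eqP => [lE|ne]; last first.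
  apply: surely_ret; apply: leads_advances; apply: save_up_start_leads => //.
  by case/and3P: nd; lia.
subst l; have i0 := root_index nd; subst i.
by rewrite gather_draw_budget; exact: draw_advances (gathered_settled c_rep fl) NJ.
Qed.

Lemma step_advances c s buf pos : represents c s buf pos -> ~~ is_idle s ->
  surely (step used rate_mul (view c) s) (advances c (budget s buf pos)).
Proof.
move=> c_rep not_idle; have [_ c_stored _ [sizes labels s_ok]] := c_rep.
case: s not_idle c_rep c_stored labels s_ok =>
  [x|s N|j x|s t x|l i N|l i N|l i d N|l i d j N|l i j N|l i j N|l i j N] //
  _ c_rep c_stored labels s_ok.
- have [f00 s_lt NJ pos0] := s_ok; apply: surely_bind => D _.
  by rewrite direct_draw_budget; apply: draw_advances.
- have [j_used xE x_le] := s_ok; apply: surely_map => D _ /=.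
  by case: ltnP => j_next; apply: leads_advances; [exact: heavy_scan_leads | exact: halt_leads].
- have [s_lt tJ xE x_le] := s_ok; have c_settled : settled c buf pos x by [].
  apply: surely_map => z; have z_le : surely (or_else (false, 0%N) (scan_dist (slot_rate P rate_mul)
      ((slots - s.+1)%:R * slot_rate P rate_mul) t (accept_at rate_mul (view c) (1 + s %% b)%N)))
      (fun z => z.2 <= J.+1)%N.
    by apply: surely_or_else => // z' /surely_scan_dist/leq_trans; apply.
  move=> /z_le z_lt; case: ltnP => s_next; apply: leads_advances.
    exact: table_scan_leads.
  exact: leads_le (last_scan_budget _ _ _ _ _) (finish_leads _ c_settled).
- have [nd _ _] := s_ok; have fan_pos := node_fan_gt0 nd.
  apply: surely_map => ds /(surely_iid_uniform fan_pos)[ds_size ds_lt].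
  by apply: leads_advances; exact: label_leads.
- exact: gather_advances.
- have [nd _ _ _ _] := s_ok; rewrite /=; case: eqP => [lE|ne].
    subst l; apply: surely_map => ts /(surely_iid_uniform b_gt0)[ts_size ts_lt].
    by apply: leads_advances; exact: pick_leads.
  apply: surely_ret; apply: leads_advances; apply: take_leads => //.
  by case/and3P: nd; lia.
- by apply: surely_ret; apply: leads_advances; exact: save_down_leads.
- by apply: surely_ret; apply: leads_advances; exact: save_up_leads.
- by apply: surely_ret; apply: leads_advances; exact: load_down_leads.
by apply: surely_ret; apply: leads_advances; exact: load_up_leads.
Qed.

Definition max_ios : nat :=
  (sum_nodes (fun l _ => sample_price l * (f * b) + 2 * b) +
   sum_nodes (fun l _ => (sample_price l.-1 + 2) * (fan l * b) + 2 * b * fan l) +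
   sample_price L * (fan L * b) + b * used + b * slots + draw_price * J).+2%N.

Lemma start_budget_lt c x N buf pos : settled c buf pos x -> (N <= J.+1)%N ->
  ((start_budget buf pos x N).+1 < max_ios)%N.
Proof.
move=> [_ sizes _ _ x_le] NJ; rewrite /max_ios /start_budget !ltnS.
have consumed_le : (consumed_potential pos <=
    sum_nodes (fun l _ => sample_price l * (f * b) + 2 * b))%N.
  apply: leq_sum_nodes => l i nd; case: eqP => // _; have [_ pos_le] := sizes _ _ nd.
  rewrite /consumed_credit leq_add // leq_mul2l ?(ltnW (ltn_pmod _ b_gt0)) ?orbT //.
  by rewrite (leq_trans pos_le (fan_leb l)) orbT.
have labels_le : (labels_potential buf <=
    sum_nodes (fun l _ => (sample_price l.-1 + 2) * (fan l * b) + 2 * b * fan l))%N.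
  by apply: leq_sum_nodes => l i nd; apply: labels_cost_le; have [] := sizes _ _ nd.
have x_price : (sample_price L * x <= sample_price L * (fan L * b))%N.
  by rewrite leq_mul2l x_le orbT.
case: eqP => [_|ne]; first by lia.
have : (draw_price * N <= draw_price * J)%N by rewrite leq_mul2l; lia.
by lia.
Qed.

Definition running c : Prop := exists s buf pos, represents c s buf pos.
Definition idle c : Prop := exists x buf pos, represents c (Idle x) buf pos.

Lemma idle_advances c x buf pos : represents c (Idle x) buf pos ->
  surely (step used rate_mul (view c) (Idle x)) (advances c max_ios.-2).
Proof.
move=> c_rep; apply: surely_bind => D _; apply: surely_bind => N N_drawn.
have NJ : (N <= J.+1)%N.
  exact: (@surely_or_else _ _ _ (truncated_poisson J _) (fun N => N <= J.+1)%N _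
    (@surely_truncated_poisson _ J _) N N_drawn).
have c_settled := idle_settled c_rep.
move=> a /(start_advances c_settled NJ)[s [buf' [pos' a_leads]]].
exists s, buf', pos'; apply: leads_le a_leads.
by have := start_budget_lt c_settled NJ; lia.
Qed.

Lemma sampler_advances c s buf pos : represents c s buf pos ->
  surely (sampler (view c)) (advances c (if is_idle s then max_ios.-2 else budget s buf pos)).
Proof.
move=> c_rep; rewrite (sampler_step c_rep); case: (boolP (is_idle s)) => [|not_idle].
  by case: s c_rep => // x c_rep _; exact: idle_advances c_rep.
exact: step_advances.
Qed.

Lemma step_stops k c s buf pos : represents c s buf pos -> ~~ is_idle s ->
  (budget s buf pos < k)%N -> stops_within (@sampler R P) p k c.
Proof.
elim: k c s buf pos => // k IH c s buf pos c_rep not_idle budget_lt a a_drawn.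
have := sampler_advances c_rep a_drawn; rewrite (negPf not_idle).
case=> s' [buf' [pos' [a_rep a_halts budget_le]]].
case: (boolP (is_idle s')) budget_le => [idle'|not_idle']; rewrite ?mul1n => budget_le.
  by left; rewrite a_halts.
by right; apply: (IH _ _ _ _ a_rep not_idle'); have := b_gt0; lia.
Qed.

Lemma sampler_terminating : terminating (@sampler R P) p running idle max_ios.
Proof.
split=> [u|c [x [buf [pos c_rep]]]|c [s [buf [pos c_rep]]] a a_drawn|c [x [buf [pos c_rep]]]].
- exact: fdist_sampler.
- by exists (Idle x), buf, pos.
- have [s' [buf' [pos' [a_rep -> _]]]] := sampler_advances c_rep a_drawn.
  by case: s' a_rep => [x|||||||||| ] *; do 3 eexists; eassumption.
have c_advances : surely (sampler (view c)) (advances c max_ios.-2) := sampler_advances c_rep.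
rewrite -[max_ios]/(max_ios.-1.+1) => a /c_advances[s' [buf' [pos' [a_rep a_halts budget_le]]]].
case: (boolP (is_idle s')) budget_le => [idle'|not_idle'] budget_le.
  by left; rewrite a_halts.
right; have budget_lt : (budget s' buf' pos' < max_ios.-1)%N.
  by rewrite mul1n in budget_le; have := b_gt0; lia.
exact: step_stops a_rep not_idle' budget_lt.
Qed.

(** * Values of configurations *)

Hypothesis rate_gt0 : 0 < slot_rate P rate_mul.
Implicit Types (Y : {set S}) (Ys : seq {set S}).

Definition accept_word (w : word) : R :=
  if w is inl v then clamp (accept_prob (slot_rate P rate_mul) (p v)) else 0.

Definition prob_word (w : word) : R := if w is inl v then clamp (p v) else 0.

Definition slot_pass Y w : R := 1 - accept_word w * (1 - (safe Y w)%:R).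
Definition heavy_pass Y w : R := 1 - prob_word w * (1 - (safe Y w)%:R).

Lemma accept_at_mem c a : accept_at rate_mul (view c) a = accept_word (mem_at c.1 a).
Proof. by rewrite /accept_at view_at_mem; case: (mem_at c.1 a). Qed.

Lemma prob_at_mem c a : prob_at (view c) a = prob_word (mem_at c.1 a).
Proof. by rewrite /prob_at view_at_mem; case: (mem_at c.1 a). Qed.

Lemma slot_pass01 Y w : 0 <= slot_pass Y w <= 1.
Proof.
have /andP[accept_ge0 accept_le1] : 0 <= accept_word w <= 1.
  by case: w => [v|k]; rewrite /accept_word ?clamp01 // lexx ler01.
rewrite /slot_pass; case: (safe Y w); rewrite ?subrr ?mulr0 ?subr0 ?lexx ?ler01 //.
by rewrite mulr1 subr_ge0 accept_le1 lerBlDr lerDl.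
Qed.

Definition in_memory (reports : seq nat) : bool := all (fun a => a < M)%N reports.

Definition all_safe Y c (reports : seq nat) : R :=
  \prod_(a <- reports) (safe Y (mem_at c.1 a))%:R.

Lemma reported_within (a : act) reports c Y :
  a.1.1 = [set x : 'I_M | (x : nat) \in reports] -> in_memory reports ->
  (reported a c.1 \subset Y)%:R = all_safe Y c reports.
Proof.
move=> aE inM; rewrite (@reported_subset _ _ _ _ _ _ _ _ _ (map cell reports)) ?big_map //.
move=> x; rewrite aE inE; apply/idP/mapP => [xr|[y yr ->]].
  by exists (x : nat) => //; rewrite /cell inord_val.
by rewrite inordK // (allP inM).
Qed.

Definition live_buffers discarded buf pos l i : seq word :=
  if discarded == Some (l, i) then [::] else drop (pos l i) (buf l i).

Definition table_mean (g : word -> R) : R := slots%:R^-1 * \sum_(s < slots) g (table s).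

Notation tree_law := (@tree_law R _ f f0 L b (@label_of W S) table).

(* The law of the samples that the next queries will draw. *)
Definition stream_law discarded buf pos (gs : seq (word -> R)) : R :=
  if f0 == 0%N then \prod_(g <- gs) table_mean g
  else tree_law (live_buffers discarded buf pos) L 0 gs.

Definition after_draws N (g : word -> R) (law : seq (word -> R) -> R) gs : R :=
  law (nseq N g ++ gs).

Definition resident_value Y : R := \prod_(t < hm) heavy_pass Y (heavy t).

Definition disk_value j Y : R :=
  \prod_(j <= k < used) \prod_(t < b) heavy_pass Y (heavy (hm + k * b + t)).

Definition pass_rate s Y : R := \sum_(s <= k < slots) slot_rate P rate_mul * slot_pass Y (table k).

Definition table_scan_value s t Y : R :=
  scan_value t ((slots - s)%:R * slot_rate P rate_mul) (pass_rate s Y).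

(* The probability that the answers to the next queries are contained in [Ys]. *)
Fixpoint queries_value (Ys : seq {set S}) (law : seq (word -> R) -> R) : R :=
  if Ys is Y :: Ys' then
    resident_value Y * (disk_value 0 Y *
      (\sum_(N < J.+1) poisson (table_rate P rate_mul) N *
         queries_value Ys' (after_draws N (slot_pass Y) law) +
       poisson_tail J.+1 (table_rate P rate_mul) * table_scan_value 0 J.+1 Y *
         queries_value Ys' law))
  else law [::].

Lemma eq_queries_value Ys law law' : law =1 law' -> queries_value Ys law = queries_value Ys law'.
Proof.
elim: Ys law law' => [|Y Ys IH] law law' lawE /=; first exact: lawE.
congr (_ * (_ * (_ + _))); last by rewrite (IH _ _ lawE).
apply: eq_bigr => N _; rewrite (IH _ (after_draws N (slot_pass Y) law')) // => gs.
exact: lawE.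
Qed.

Lemma queries_valueZ Ys x law :
  queries_value Ys (fun gs => x * law gs) = x * queries_value Ys law.
Proof.
elim: Ys law => [|Y Ys IH] law //=; rewrite IH.
under eq_bigr => N _ do
  rewrite -[after_draws _ _ _]/(fun gs => x * after_draws N (slot_pass Y) law gs) IH mulrCA.
by rewrite -mulr_sumr; ring.
Qed.

Lemma expect_queries_value (T : eqType) (d : fdist R T) Ys (law : T -> seq (word -> R) -> R) :
  expect d (fun w => queries_value Ys (law w)) =
  queries_value Ys (fun gs => expect d (fun w => law w gs)).
Proof.
elim: Ys law => [|Y Ys IH] law //=.
rewrite !expectZl expectD expectZl IH; congr (_ * (_ * (_ + _))).
rewrite (@expect_sum _ _ _ _ (index_enum _) (fun (N : 'I_J.+1) w => poisson _ N *
  queries_value Ys (after_draws N (slot_pass Y) (law w)))).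
by apply: eq_bigr => N _; rewrite expectZl IH.
Qed.

(* The factors that the heavy records and the table contribute to the current query are
   those of the blocks that are still to be scanned. *)
Definition state_value Y Ys s (law : seq (word -> R) -> R) : R :=
  match s with
  | Idle _ => queries_value Ys law
  | Direct s N => slot_pass Y (table s) *
      (disk_value 0 Y * queries_value Ys (after_draws N (slot_pass Y) law))
  | HeavyScan j _ => disk_value j Y * queries_value Ys law
  | TableScan s t _ => table_scan_value s t Y * (disk_value 0 Y * queries_value Ys law)
  | Label _ _ N | Gather _ _ N | Take _ _ _ N | SaveDown _ _ _ _ N
  | SaveUp _ _ _ N | LoadDown _ _ _ N | LoadUp _ _ _ N =>
      disk_value 0 Y * queries_value Ys (after_draws N (slot_pass Y) law)
  end.

Lemma finish_state_value Y Ys x law :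
  state_value Y Ys (finish_state used x) law = disk_value 0 Y * queries_value Ys law.
Proof.
rewrite /finish_state; case: eqP => //= used0.
by rewrite /disk_value used0 big_geq // mul1r.
Qed.

Lemma finish_discarded x : discarded_node (finish_state used x) = None.
Proof. by rewrite /finish_state; case: eqP. Qed.

Lemma eq_stream_law n n' buf pos buf' pos' :
  (forall l i, live_buffers n buf pos l i = live_buffers n' buf' pos' l i) ->
  stream_law n buf pos =1 stream_law n' buf' pos'.
Proof. by move=> liveE gs; rewrite /stream_law; case: eqP => // _; exact: eq_tree_law. Qed.

Lemma stream_law_discard l i x buf pos : (size (buf l i) <= pos l i)%N ->
  stream_law (Some (l, i)) buf (set_node pos l i x) =1 stream_law None buf pos.
Proof.
move=> exhausted; apply: eq_stream_law => l' i'; rewrite /live_buffers /=.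
case: eqP => [[<- <-]|ne]; first by rewrite drop_oversize.
by rewrite set_node_other //; apply/negP => /andP[/eqP lE /eqP iE]; apply: ne; rewrite lE iE.
Qed.

Lemma stream_law_pop c x N g gs buf pos : settled c buf pos x ->
  let k := minn N (fan L * b - x) in
  stream_law None buf pos (nseq N g ++ gs) =
  \prod_(a <- iota (buffer_base + x) k) g (mem_at c.1 a) *
    stream_law None buf (set_node pos L 0 (x + k)%N) (nseq (N - k) g ++ gs).
Proof.
move=> [c_stored sizes labels xE x_le] k; have k_le : (k <= fan L * b - x)%N := geq_minr _ _.
rewrite /stream_law; case: eqP => [f00|/eqP f0_neq0].
  have -> : k = 0%N by apply/eqP; rewrite -leqn0 (leq_trans k_le) // fan_root f00 mul0n.
  by rewrite big_nil mul1r subn0.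
have f0_gt0 : (0 < f0)%N by rewrite lt0n.
have nd := root_is_node f0_gt0; have [sz _] := sizes _ _ nd.
have nolab : no_labels L (buf L 0%N) by have := labels L 0%N nd; rewrite not_below_deeper.
have [L' LE] : exists L', L = L'.+1 by exists L.-1; rewrite prednK // depthE.
pose ys := take k (drop x (buf L 0%N)).
have ys_size : size ys = k by rewrite size_takel // size_drop sz.
have -> : \prod_(a <- iota (buffer_base + x) k) g (mem_at c.1 a) = \prod_(y <- ys) g y.
  have ysE : ys = [seq mem_at c.1 a | a <- iota (buffer_base + x) k].
    rewrite /ys -(buffer_words c_stored nd sizes) -map_drop -map_take drop_iota take_iota.
    by rewrite (minn_idPl k_le).
  by rewrite ysE big_map.
have ys_nolab : {in ys, forall y, label_of (fan L) y = None}.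
  by move=> y /mem_take/mem_drop/(allP nolab)/eqP.
rewrite -{1}(subnKC (geq_minl N _ : (k <= N)%N)) nseqD -catA.
pose live := live_buffers None buf pos.
rewrite (@eq_tree_law _ _ _ _ _ _ _ _ (live_buffers _ _ (set_node pos _ _ _))
  (set_node live L 0 (drop (k + x) (buf L 0%N)))); last first.
  move=> l i; rewrite /live /live_buffers /set_node /=.
  by case: ifP => // /andP[/eqP-> /eqP->]; rewrite addnC.
have liveE : live L 0%N = ys ++ drop (k + x) (buf L 0%N).
  by rewrite -drop_drop cat_take_drop /live /live_buffers /= -xE.
rewrite LE in ys_nolab liveE *; rewrite tree_lawS tree_law_set -/live liveE -[k in nseq k _]ys_size.
exact: node_law_pop.
Qed.

Section Queries.
Variables (Y : {set S}) (Ys : seq {set S}).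

Definition agrees c bound (Cont : act -> R) : Prop :=
  forall a s buf pos, leads c bound a s buf pos ->
  Cont a = state_value Y Ys s (stream_law (discarded_node s) buf pos).

Lemma agrees_le c bound bound' Cont : (bound <= bound')%N -> agrees c bound' Cont ->
  agrees c bound Cont.
Proof. by move=> le_bound cont a s buf pos /(leads_le le_bound); exact: cont. Qed.

Definition within c (Cont : act -> R) (a : act) : R := (reported a c.1 \subset Y)%:R * Cont a.

Lemma leads_value c bound Cont a reports s buf pos : agrees c bound Cont ->
  leads c bound a s buf pos ->
  a.1.1 = [set x : 'I_M | (x : nat) \in reports] -> in_memory reports ->
  within c Cont a =
  all_safe Y c reports * state_value Y Ys s (stream_law (discarded_node s) buf pos).
Proof.
move=> cont a_leads aE inM.
by rewrite /within (reported_within _ _ aE) // (cont _ _ _ _ a_leads).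
Qed.

Lemma silent_leads_value c bound Cont a s buf pos : agrees c bound Cont ->
  leads c bound a s buf pos -> a.1.1 = [set x : 'I_M | (x : nat) \in [::]] ->
  within c Cont a = state_value Y Ys s (stream_law (discarded_node s) buf pos).
Proof.
move=> cont a_leads aE.
by rewrite (leads_value cont a_leads aE) // /all_safe big_nil mul1r.
Qed.

Lemma expect_thin_safe c (q : nat -> R) (q_word : word -> R) r x F :
  (forall a, q a = q_word (mem_at c.1 a)) -> in_memory r ->
  (forall D, in_memory D -> F D = all_safe Y c D * x) ->
  expect (thin [seq (q a, a) | a <- r]) F =
  \prod_(a <- r) (1 - q_word (mem_at c.1 a) * (1 - (safe Y (mem_at c.1 a))%:R)) * x.
Proof.
move=> qE rM FE; rewrite (@eq_expect_in _ _ _ _ (fun D => all_safe Y c D * x)).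
  rewrite expectZr expect_thin_prod big_map; congr (_ * _).
  by apply: eq_bigr => a _; rewrite qE.
move=> D D_thin; apply: FE; apply: (surely_thin _ D_thin).
by rewrite /unzip2 -map_comp map_id.
Qed.

Lemma finish_value c Cont reports x N buf pos : settled c buf pos x -> (N <= fan L * b - x)%N ->
  in_memory reports -> agrees c (draw_budget buf pos x N) Cont ->
  within c Cont (finish P used rate_mul reports (x + N)) =
  all_safe Y c reports * (disk_value 0 Y *
    queries_value Ys (stream_law None buf (set_node pos L 0 (x + N)%N))).
Proof.
move=> c_settled N_le inM cont.
rewrite (leads_value cont (draw_finish_leads _ c_settled N_le) erefl inM).
by rewrite finish_state_value finish_discarded.
Qed.

Lemma draw_label_value c Cont reports x N buf pos : settled c buf pos x -> (0 < f0)%N ->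
  (N <= J)%N -> (fan L * b - x < N)%N ->
  in_memory reports -> agrees c (draw_budget buf pos x N) Cont ->
  within c Cont (goto reports (Label L 0 (N - (fan L * b - x))) (read_table P 0)) =
  all_safe Y c reports * (disk_value 0 Y * queries_value Ys
    (after_draws (N - (fan L * b - x)) (slot_pass Y)
       (stream_law None buf (set_node pos L 0 (x + (fan L * b - x))%N)))).
Proof.
move=> c_settled f0_gt0 NJ N_gt inM cont.
rewrite (leads_value cont (draw_label_leads _ c_settled f0_gt0 NJ N_gt) erefl inM) /=.
have [_ sizes _ _ x_le] := c_settled; have [sz _] := sizes _ _ (root_is_node f0_gt0).
congr (_ * (_ * _)); apply: eq_queries_value => gs; rewrite /after_draws.
rewrite -(@stream_law_discard L 0 0) ?set_node_same ?sz ?subnKC //.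
by apply: eq_stream_law => l i; rewrite /live_buffers /set_node; case: (_ =P _) => // _; case: ifP.
Qed.

Lemma direct_draw_value c Cont reports N buf pos : settled c buf pos 0 -> f0 = 0%N ->
  (0 < N <= J)%N -> in_memory reports -> agrees c (draw_budget buf pos 0 N) Cont ->
  expect (uniform R slots) (fun s =>
    within c Cont (goto reports (Direct s N.-1) (read_table P (s %/ b)))) =
  all_safe Y c reports * (disk_value 0 Y *
    queries_value Ys (after_draws N (slot_pass Y) (stream_law None buf pos))).
Proof.
move=> c_settled f00 N_range inM cont; have /andP[N_gt0 _] := N_range.
pose law := stream_law None buf pos.
rewrite (@eq_expect_in _ _ _ _ (fun s => all_safe Y c reports * (slot_pass Y (table s) *
   (disk_value 0 Y * queries_value Ys (after_draws N.-1 (slot_pass Y) law))))); last first.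
  move=> s /(surely_uniform slots_gt0) s_lt.
  exact: leads_value cont (direct_leads _ c_settled f00 s_lt N_range) erefl inM.
rewrite expectZl expectZr expect_uniform // -/(table_mean (slot_pass Y)).
congr (_ * _); rewrite mulrCA; congr (_ * _).
rewrite -queries_valueZ; apply: eq_queries_value => gs.
rewrite /after_draws /law /stream_law f00 -[in RHS](prednK N_gt0) /=.
by rewrite big_cons.
Qed.

Lemma draw_value c Cont reports x N buf pos : settled c buf pos x -> (N <= J)%N ->
  in_memory reports -> agrees c (draw_budget buf pos x N) Cont ->
  expect (draw used rate_mul (view c) reports N x) (within c Cont) =
  all_safe Y c reports * (disk_value 0 Y *
    queries_value Ys (after_draws N (slot_pass Y) (stream_law None buf pos))).
Proof.
move=> c_settled NJ inM cont; have [_ _ _ _ x_le] := c_settled.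
rewrite /draw expect_bind; set live := (fan L * b - x)%N; pose k := minn N live.
pose pos' := set_node pos L 0 (x + k)%N.
rewrite (@expect_thin_safe c _ accept_word _ (all_safe Y c reports * (disk_value 0 Y *
   queries_value Ys (after_draws (N - k) (slot_pass Y) (stream_law None buf pos'))))).
- rewrite mulrCA; congr (_ * _); rewrite mulrCA; congr (_ * _).
  by rewrite -queries_valueZ; apply: eq_queries_value => gs; rewrite /after_draws
    (stream_law_pop _ _ _ c_settled).
- exact: accept_at_mem.
- apply/allP => a; rewrite mem_iota; have := fan_leb L; have mf := memory_fits.
  by have [cE _ _] := basesE; rewrite /live; lia.
move=> D DM; rewrite mulrA -[_ * all_safe _ _ _]big_cat -/(all_safe _ _ _).
have inM' : in_memory (D ++ reports) by rewrite /in_memory all_cat; apply/andP.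
rewrite {}/pos' /k; case: leqP => N_live.
  by rewrite expect_ret (finish_value c_settled) // subnn.
case: posnP => [f00|f0_gt0]; last first.
  by rewrite expect_ret (draw_label_value c_settled).
have x0 : x = 0%N by move: x_le; rewrite fan_root f00; lia.
have live0 : live = 0%N by rewrite /live fan_root f00.
rewrite live0 x0 in c_settled cont N_live *.
rewrite expect_map (direct_draw_value c_settled) ?N_live // subn0; congr (_ * (_ * _)).
by apply: eq_queries_value => gs; rewrite /after_draws /stream_law f00.
Qed.

Definition preserves_value s : Prop := forall c buf pos Cont, represents c s buf pos ->
  agrees c (budget s buf pos) Cont ->
  expect (step used rate_mul (view c) s) (within c Cont) =
  state_value Y Ys s (stream_law (discarded_node s) buf pos).

Lemma scanned_in_memory t : (t < b)%N -> (1 + t < M)%N.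
Proof. by have := junk_fits; case: junk_offset_cases => [[-> _]|[-> -> _]]; lia. Qed.

Lemma direct_preserves s N : preserves_value (Direct s N).
Proof.
move=> c buf pos Cont c_rep cont; have [_ c_stored wordE [sizes labels s_ok]] := c_rep.
have [f00 s_lt NJ pos0] := s_ok; have c_settled : settled c buf pos 0 by [].
rewrite expect_bind (@expect_thin_safe c _ accept_word _ (disk_value 0 Y *
  queries_value Ys (after_draws N (slot_pass Y) (stream_law None buf pos)))).
- by rewrite big_seq1 wordE.
- exact: accept_at_mem.
- by rewrite /in_memory /= scanned_in_memory ?ltn_pmod.
by move=> D DM; apply: draw_value => //; rewrite -(direct_draw_budget s).
Qed.

Lemma prod_iota (h : nat -> R) n k : \prod_(a <- iota n k) h a = \prod_(t < k) h (n + t)%N.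
Proof. by rewrite -{1}[n]addn0 iotaDl big_map -{1}[k]subn0 -/(index_iota 0 k) big_mkord. Qed.

Lemma heavy_scan_preserves j x : preserves_value (HeavyScan j x).
Proof.
move=> c buf pos Cont c_rep cont; have [_ c_stored wordE [sizes labels s_ok]] := c_rep.
have [j_used xE x_le] := s_ok; have c_settled : settled c buf pos x by [].
pose rest := disk_value j.+1 Y * queries_value Ys (stream_law None buf pos).
rewrite expect_map (@expect_thin_safe c _ prob_word _ rest) ?{}/rest.
- rewrite mulrA; congr (_ * _); rewrite /disk_value [RHS]big_ltn //; congr (_ * _).
  by rewrite (prod_iota (heavy_pass Y \o mem_at c.1)); apply: eq_bigr => t _; rewrite /= wordE.
- exact: prob_at_mem.
- apply/allP => a; rewrite mem_iota => a_range.
  by rewrite -(subnKC (_ : 1 <= a)%N) ?scanned_in_memory; lia.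
move=> D DM; case: ltnP => j_next.
  exact: leads_value cont (heavy_scan_leads _ c_settled j_next) erefl DM.
rewrite (leads_value cont (halt_leads _ _ c_settled) erefl DM) /=.
by rewrite /disk_value big_geq // mul1r.
Qed.

Lemma pass_rateS s : (s < slots)%N ->
  pass_rate s Y = pass_rate s.+1 Y + slot_rate P rate_mul * slot_pass Y (table s).
Proof. by move=> s_lt; rewrite /pass_rate big_ltn // addrC. Qed.

Lemma pass_rate_bounds s : 0 <= pass_rate s Y <= (slots - s)%:R * slot_rate P rate_mul.
Proof.
apply/andP; split.
  apply: sumr_ge0 => k _; have /andP[pass_ge0 _] := slot_pass01 Y (table k).
  by rewrite mulr_ge0 // ltW.
rewrite mulr_natl -sumr_const_nat; apply: ler_sum => k _.
by have /andP[_ pass_le1] := slot_pass01 Y (table k); rewrite ger_pMr.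
Qed.

Lemma table_scan_preserves s t x : preserves_value (TableScan s t x).
Proof.
move=> c buf pos Cont c_rep cont; have [_ c_stored wordE [sizes labels s_ok]] := c_rep.
have [s_lt tJ xE x_le] := s_ok; have c_settled : settled c buf pos x by [].
have aM := scanned_in_memory (ltn_pmod s b_gt0); set a := (1 + s %% b)%N in aM wordE *.
have accept01 := accept_at01 rate_mul (view c) a.
have later_ge0 : 0 <= (slots - s.+1)%:R * slot_rate P rate_mul by rewrite mulr_ge0 // ltW.
have reportE (z : bool) : in_memory (if z then [:: a] else [::]) /\
    all_safe Y c (if z then [:: a] else [::]) = (z ==> safe Y (table s))%:R :> R.
  by case: z; rewrite /all_safe ?big_seq1 ?big_nil ?wordE // /in_memory /= aM.
pose rest := disk_value 0 Y * queries_value Ys (stream_law None buf pos).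
have passE : slot_pass Y (table s) =
    1 - accept_at rate_mul (view c) a * (1 - (safe Y (table s))%:R) by rewrite accept_at_mem wordE.
have rateE : (slots - s)%:R * slot_rate P rate_mul =
    (slots - s.+1)%:R * slot_rate P rate_mul + slot_rate P rate_mul.
  by rewrite -(subnSK s_lt) -natr1 mulrDl mul1r.
rewrite expect_map or_elseE; last exact: fdist_scan_dist.
case: ltnP => s_next.
  rewrite (@eq_expect_in _ _ _ _ (fun z => (z.1 ==> safe Y (table s))%:R *
     scan_value z.2 ((slots - s.+1)%:R * slot_rate P rate_mul) (pass_rate s.+1 Y) * rest)).
    rewrite expectZr expect_scan_value ?pass_rate_bounds // -passE -pass_rateS //.
    by rewrite /= /table_scan_value rateE.
  move=> z /surely_scan_dist z_le; have [inM <-] := reportE z.1; rewrite -mulrA.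
  exact: leads_value cont (table_scan_leads _ _ c_settled s_next (leq_trans z_le tJ)) erefl inM.
have later0 : (slots - s.+1)%:R * slot_rate P rate_mul = 0.
  by rewrite (_ : (slots - s.+1)%N = 0%N) ?mul0r //; lia.
rewrite (@eq_expect_in _ _ _ _ (fun z => (z.1 ==> safe Y (table s))%:R * rest)).
  rewrite expectZr expect_scan_last // -passE /= /table_scan_value rateE later0 add0r.
  by rewrite pass_rateS // [pass_rate s.+1 Y]big_geq // add0r.
move=> z _; have [inM <-] := reportE z.1.
have leads := leads_le (last_scan_budget s t _ _ _) (finish_leads _ c_settled).
rewrite (leads_value cont (leads _) erefl inM).
by rewrite finish_state_value finish_discarded.
Qed.

Lemma silent_preserves c s Cont a s' buf pos buf' pos' :
  agrees c (budget s buf pos) Cont -> step used rate_mul (view c) s = dret R a ->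
  leads c (budget s buf pos) a s' buf' pos' ->
  a.1.1 = [set x : 'I_M | (x : nat) \in [::]] ->
  expect (step used rate_mul (view c) s) (within c Cont) =
  state_value Y Ys s' (stream_law (discarded_node s') buf' pos').
Proof.
by move=> cont -> a_leads aE; rewrite expect_ret (silent_leads_value cont a_leads).
Qed.

Lemma save_down_preserves l i d j N : preserves_value (SaveDown l i d j N).
Proof.
move=> c buf pos Cont c_rep cont.
rewrite (silent_preserves cont erefl (save_down_leads c_rep) erefl) /after_save_down.
by case: ifP.
Qed.

Lemma save_up_preserves l i j N : preserves_value (SaveUp l i j N).
Proof.
move=> c buf pos Cont c_rep cont.
rewrite (silent_preserves cont erefl (save_up_leads c_rep) erefl) /after_save_up.
by case: ifP.
Qed.

Lemma load_down_preserves l i j N : preserves_value (LoadDown l i j N).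
Proof.
move=> c buf pos Cont c_rep cont.
rewrite (silent_preserves cont erefl (load_down_leads c_rep) erefl) /after_load_down.
by case: ifP.
Qed.

Lemma load_up_preserves l i j N : preserves_value (LoadUp l i j N).
Proof.
move=> c buf pos Cont c_rep cont.
rewrite (silent_preserves cont erefl (load_up_leads c_rep) erefl) /after_load_up.
by case: ifP.
Qed.

Lemma live_buffers_set n buf pos l i ws l' i' : pos l i = 0%N -> n != Some (l, i) ->
  live_buffers n (set_node buf l i ws) pos l' i' =
  set_node (live_buffers n buf pos) l i ws l' i'.
Proof.
move=> pos0 ne; rewrite /live_buffers.
case: (boolP ((l' == l) && (i' == i))) => [/andP[/eqP-> /eqP->]|other].
  by rewrite (negPf ne) !set_node_same pos0 drop0.
by rewrite !set_node_other.
Qed.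

Lemma label_preserves l i N : preserves_value (Label l i N).
Proof.
move=> c buf pos Cont c_rep cont; have [_ _ _ [_ _ [nd _ pos0]]] := c_rep.
have f_gt0 := node_fanout nd; have f0_gt0 := depth_gt0 (node_depth nd).
pose buf' ds := set_node buf l i (map label_word ds).
rewrite expect_map (@eq_expect_in _ _ _ _ (fun ds => disk_value 0 Y *
  queries_value Ys (after_draws N (slot_pass Y) (stream_law None (buf' ds) pos)))); last first.
  move=> ds /(surely_iid_uniform (node_fan_gt0 nd))[ds_size ds_lt].
  exact: silent_leads_value cont (label_leads c_rep ds_size ds_lt) erefl.
rewrite expectZl expect_queries_value; congr (_ * _); apply: eq_queries_value => gs.
rewrite /after_draws /stream_law gtn_eqF //.
have liveE ws : (fun l' i' => set_node (live_buffers (Some (l, i)) buf pos) l i ws l' i') =2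
    live_buffers None (set_node buf l i ws) pos.
  move=> l' i'; rewrite live_buffers_set // /set_node /live_buffers.
  by case: ifP => // ne; rewrite ifF //; apply/negP => /eqP[? ?]; subst; rewrite !eqxx in ne.
transitivity (tree_law (set_node (live_buffers (Some (l, i)) buf pos) l i [::]) L 0
  (nseq N (slot_pass Y) ++ gs)); last first.
  apply: eq_tree_law => l' i'; rewrite /set_node /live_buffers.
  by case: ifP => // /andP[/eqP-> /eqP->]; rewrite eqxx.
have /and3P[l_gt0 lL _] := nd.
rewrite -(tree_law_labels table f_gt0 f0_gt0 f0_le b_gt0 _ (fan l * b) (mk := label_word)) //.
- by apply: eq_expect => ds; apply: eq_tree_law => l' i'; rewrite -liveE.
- exact: node_lt_expn.
by move=> d df; apply: label_of_label_word => //; exact: fan_leq.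
Qed.

Lemma gather_preserves l i N : preserves_value (Gather l i N).
Proof.
move=> c buf pos Cont c_rep cont; have [_ c_stored _ [sizes labels [nd NJ]]] := c_rep.
have stepE : step used rate_mul (view c) (Gather l i N) =
    if first_label (fan l) (buf l i) is Some d
    then dret R (descend_act used rate_mul (view c) l i d N)
    else if l == L then draw used rate_mul (view c) [::] N 0
    else dret R (goto [::] (SaveUp l i 0 N) (read_table P 0)).
  by rewrite -(first_label_buffer c_stored nd sizes).
case fl : (first_label (fan l) (buf l i)) stepE => [d|].
  have [df d_pending] := first_label_some fl; move=> stepE.
  have silent : (descend_act used rate_mul (view c) l i d N).1.1 =
      [set x : 'I_M | (x : nat) \in [::]].
    by rewrite /descend_act; do 2?case: ifP.
  have [l1|l1] := leqP l 1.
    have lE : l = 1%N by case/and3P: nd; lia.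
    exact: silent_preserves cont stepE (descend_leads c_rep fl (or_introl lE)) silent.
  have [pos_ge|pos_lt] := leqP (fan l.-1 * b) (pos l.-1 (i * f + d)).
    rewrite (silent_preserves cont stepE (descend_refill_leads c_rep l1 fl pos_ge) silent) /=.
    congr (_ * _); apply: eq_queries_value => gs; apply: stream_law_discard.
    by have [-> _] := sizes _ _ (node_child nd l1 df).
  exact: silent_preserves cont stepE (descend_leads c_rep fl (or_intror (conj l1 pos_lt))) silent.
case: eqP => [lE|ne] stepE; last first.
  have lL : (l < L)%N by case/and3P: nd; lia.
  exact: silent_preserves cont stepE (save_up_start_leads c_rep fl lL) erefl.
subst l; have i0 := root_index nd; subst i; rewrite stepE.
rewrite gather_draw_budget in cont.
by rewrite (draw_value (gathered_settled c_rep fl)) // /all_safe big_nil mul1r.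
Qed.

Lemma pick_preserves i d N : preserves_value (Take 1 i d N).
Proof.
move=> c buf pos Cont c_rep cont; have [_ _ _ [sizes labels [nd NJ df d_pending _]]] := c_rep.
have f_gt0 := node_fanout nd; have f0_gt0 := depth_gt0 (node_depth nd).
have pos0 := labels_ok_pos0 labels nd; have [sz _] := sizes _ _ nd.
rewrite expect_map (@eq_expect_in _ _ _ _ (fun ts => disk_value 0 Y *
  queries_value Ys (after_draws N (slot_pass Y)
    (stream_law None (set_node buf 1 i (picked buf 1 i d ts)) pos)))); last first.
  move=> ts /(surely_iid_uniform b_gt0)[ts_size ts_lt].
  exact: silent_leads_value cont (pick_leads c_rep ts_size ts_lt) erefl.
rewrite expectZl expect_queries_value; congr (_ * _); apply: eq_queries_value => gs.
rewrite /after_draws /stream_law gtn_eqF //.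
have liveE : live_buffers None buf pos 1 i = buf 1%N i by rewrite /live_buffers pos0 drop0.
rewrite -(tree_law_pick f_gt0 f0_gt0 f0_le b_gt0 (d := d) (i := i) (m := fan 1 * b)) //.
- by apply: eq_expect => ts; apply: eq_tree_law => l' i'; rewrite live_buffers_set // liveE.
- exact: node_depth nd.
- exact: node_lt_expn.
- exact: leq_trans df (fan_leq _).
- by move=> s; apply: table_nolabel; exact: fan_leq.
by rewrite liveE -sz; exact: label_count_le.
Qed.

Lemma take_preserves l i d N : (1 < l)%N -> preserves_value (Take l i d N).
Proof.
move=> l1 c buf pos Cont c_rep cont; have [_ _ _ s_ok] := c_rep.
have [sizes labels [nd NJ df d_pending _]] := s_ok.
have f_gt0 := node_fanout nd; have f0_gt0 := depth_gt0 (node_depth nd).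
have pos0 := labels_ok_pos0 labels nd; have lL := child_level nd.
have stepE : step used rate_mul (view c) (Take l i d N) =
    dret R (take_act used rate_mul (view c) l i d N).
  by rewrite /= gtn_eqF.
rewrite (silent_preserves cont stepE (take_leads c_rep l1) erefl) /=.
congr (_ * _); apply: eq_queries_value => gs; rewrite /after_draws /stream_law gtn_eqF //.
have words_size := size_taken_words s_ok l1.
have words_nolab := taken_words_nolabel c_rep l1.
have lS : l = l.-1.+1 by rewrite prednK // ltnW.
rewrite /taken; set x := pos _ _ in words_size *; set k := take_count _ _ _ _ _ in words_size *.
set ws := taken_words _ _ _ _ _ in words_size words_nolab *.
have liveE : live_buffers None buf pos l i = buf l i by rewrite /live_buffers pos0 drop0.
have l_neq : (l.-1 == l) = false by lia.
have := @tree_law_take R _ f f0 L b _ table f_gt0 f0_gt0 f0_le b_gt0 (live_buffers None buf pos)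
  l.-1 i d ws (drop (x + k) (buf l.-1 (i * f + d)%N)).
rewrite -lS liveE => <- //.
- apply: eq_tree_law => l' i'; rewrite /live_buffers /set_node /=.
  case: (boolP ((l' == l.-1) && (i' == (i * f + d)%N))) => [/andP[/eqP-> /eqP->]|_].
    by rewrite l_neq.
  by case: ifP => // /andP[/eqP-> /eqP->]; rewrite pos0 drop0.
- by lia.
- by case/and3P: nd.
- exact: node_lt_expn.
- exact: leq_trans df (fan_leq _).
- by rewrite /live_buffers /= [(x + k)%N]addnC -drop_drop cat_take_drop.
by rewrite words_size geq_minr.
Qed.

Lemma step_preserves s : ~~ is_idle s -> preserves_value s.
Proof.
case: s => [x|s N|j x|s t x|l i N|l i N|l i d N|l i d j N|l i j N|l i j N|l i j N] // _.
- exact: direct_preserves.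
- exact: heavy_scan_preserves.
- exact: table_scan_preserves.
- exact: label_preserves.
- exact: gather_preserves.
- move=> c buf pos Cont c_rep; have [l1|l1] := ltnP 1 l; first exact: take_preserves c_rep.
  have lE : l = 1%N by have [_ _ _ [_ _ [/and3P[]]]] := c_rep; lia.
  by subst l; exact: pick_preserves c_rep.
- exact: save_down_preserves.
- exact: save_up_preserves.
- exact: load_down_preserves.
exact: load_up_preserves.
Qed.

Lemma start_value c Cont reports x N buf pos : settled c buf pos x -> (N <= J.+1)%N ->
  in_memory reports -> agrees c (start_budget buf pos x N) Cont ->
  expect (start used rate_mul (view c) reports N x) (within c Cont) =
  all_safe Y c reports * (disk_value 0 Y *
    (if N == J.+1 then table_scan_value 0 J.+1 Y * queries_value Ys (stream_law None buf pos)
     else queries_value Ys (after_draws N (slot_pass Y) (stream_law None buf pos)))).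
Proof.
move=> c_settled NJ inM cont; rewrite /start; case: eqP => [NE|ne].
  rewrite NE in cont; rewrite expect_ret.
  rewrite (leads_value cont (table_scan_start_leads _ c_settled) erefl inM) /=.
  by congr (_ * _); exact: mulrCA.
apply: draw_value => //; first by lia.
by move: cont; rewrite /start_budget (introF eqP ne) addnAC.
Qed.

Lemma table_rate_gt0 : 0 < table_rate P rate_mul.
Proof. by rewrite mulr_gt0 // ltr0n. Qed.

Lemma idle_value c x buf pos Cont : represents c (Idle x) buf pos ->
  agrees c max_ios.-2 Cont ->
  expect (step used rate_mul (view c) (Idle x)) (within c Cont) =
  queries_value (Y :: Ys) (stream_law None buf pos).
Proof.
move=> c_rep cont; have c_settled := idle_settled c_rep.
have [[[heavy_mem _ _] _] _ _ _ _] := c_settled.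
pose law := stream_law None buf pos.
pose rest := disk_value 0 Y *
  (\sum_(N < J.+1) poisson (table_rate P rate_mul) N *
     queries_value Ys (after_draws N (slot_pass Y) law) +
   poisson_tail J.+1 (table_rate P rate_mul) * table_scan_value 0 J.+1 Y * queries_value Ys law).
rewrite expect_bind (@expect_thin_safe c _ prob_word _ rest).
- congr (_ * _); rewrite (prod_iota (heavy_pass Y \o mem_at c.1)).
  by apply: eq_bigr => t _; rewrite /= heavy_mem.
- exact: prob_at_mem.
- apply/allP => a; rewrite mem_iota => a_range; apply: leq_trans memory_fits.
  by have [cE bE hE] := basesE; lia.
move=> D DM; rewrite expect_bind or_elseE; last first.
  exact: fdist_truncated_poisson (ltW table_rate_gt0).
have start_cont N : (N <= J.+1)%N -> agrees c (start_budget buf pos x N) Cont.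
  by move=> NJ; apply: agrees_le cont; have := start_budget_lt c_settled NJ; lia.
have start_valueE N (NJ : (N <= J.+1)%N) := start_value c_settled NJ DM (start_cont N NJ).
rewrite expect_truncated_poisson start_valueE // eqxx /rest [in RHS]mulrA mulrDr mulr_sumr.
congr (_ + _); last by rewrite -/law; ring.
apply: eq_bigr => N _; have NJ := ltn_ord N.
rewrite start_valueE; last exact: ltnW.
by rewrite (ltn_eqF NJ) -mulrA mulrCA; congr (_ * _); rewrite mulrCA.
Qed.

Notation query_gf := (query_gf (@sampler R P) p).
Notation queries_gf := (queries_gf (@sampler R P) p max_ios).

Section Run.
Hypothesis queries_gf_tail : forall c x buf pos, represents c (Idle x) buf pos ->
  (queries_gf Ys c).[1] = queries_value Ys (stream_law None buf pos).

Lemma agrees_gf k c bound :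
  (forall c s buf pos, represents c s buf pos -> ~~ is_idle s -> (budget s buf pos < k)%N ->
   (query_gf k c Y (queries_gf Ys)).[1] =
     state_value Y Ys s (stream_law (discarded_node s) buf pos)) ->
  (bound <= k)%N ->
  agrees c bound (fun a => if halts a.2 then (queries_gf Ys (next c a)).[1]
    else (query_gf k (next c a) Y (queries_gf Ys)).[1]).
Proof.
move=> gfE bound_le a s buf pos [a_rep -> budget_le].
case: (boolP (is_idle s)) budget_le => [idle_s _|not_idle budget_le].
  by case: s idle_s a_rep => // x _; exact: queries_gf_tail.
by apply: gfE => //; rewrite mul1n in budget_le; have := b_gt0; lia.
Qed.

Lemma query_gf_state_value k c s buf pos : represents c s buf pos -> ~~ is_idle s ->
  (budget s buf pos < k)%N ->
  (query_gf k c Y (queries_gf Ys)).[1] =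
  state_value Y Ys s (stream_law (discarded_node s) buf pos).
Proof.
elim: k c s buf pos => [|k IH] c s buf pos // c_rep not_idle budget_lt.
rewrite query_gf_at1 (sampler_step c_rep).
by apply: (step_preserves not_idle c_rep); apply: agrees_gf.
Qed.

Lemma queries_gf_cons c x buf pos : represents c (Idle x) buf pos ->
  (queries_gf (Y :: Ys) c).[1] = queries_value (Y :: Ys) (stream_law None buf pos).
Proof.
move=> c_rep; rewrite -[LHS]/(query_gf max_ios.-1.+1 c Y (queries_gf Ys)).[1].
rewrite query_gf_at1 (sampler_step c_rep); apply: (idle_value c_rep).
apply: agrees_gf; first exact: query_gf_state_value.
by lia.
Qed.

End Run.
End Queries.

Notation queries_gf := (queries_gf (@sampler R P) p max_ios).

Lemma queries_gf_value Ys c x buf pos : represents c (Idle x) buf pos ->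
  (queries_gf Ys c).[1] = queries_value Ys (stream_law None buf pos).
Proof.
elim: Ys c x buf pos => [|Y Ys IH] c x buf pos c_rep; last exact: queries_gf_cons IH _ _ _ _ c_rep.
by rewrite /= hornerC /stream_law; case: eqP => _; rewrite ?big_nil ?tree_law_nil.
Qed.

Lemma queries_value_iid Ys : queries_value Ys (fun gs => \prod_(g <- gs) table_mean g) =
  \prod_(Y <- Ys) (resident_value Y * (disk_value 0 Y *
    expR (- (table_rate P rate_mul - pass_rate 0 Y)))).
Proof.
elim: Ys => [|Y Ys IH]; first by rewrite /= !big_nil.
rewrite [LHS]/= big_cons -IH -!mulrA; congr (_ * (_ * _)).
set rest := queries_value Ys _; set mean := table_mean (slot_pass Y).
have slots_neq0 : slots%:R != 0 :> R by rewrite pnatr_eq0 -lt0n.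
have meanE : table_rate P rate_mul * mean = pass_rate 0 Y.
  by rewrite /mean /table_mean /pass_rate big_mkord -big_distrr /= mulrACA mulfV // mul1r.
rewrite (eq_bigr (fun N : 'I_J.+1 => expR (- (table_rate P rate_mul - pass_rate 0 Y)) *
    poisson (pass_rate 0 Y) N * rest)).
  rewrite -big_distrl /= -big_distrr /= /table_scan_value /scan_value subn0.
  rewrite -/(table_rate P rate_mul).
  have tail_neq0 : poisson_tail J.+1 (table_rate P rate_mul) != 0.
    by rewrite gt_eqF // poisson_tail_gt0 // table_rate_gt0.
  have -> : \sum_(i < J.+1) poisson (pass_rate 0 Y) i = 1 - poisson_tail J.+1 (pass_rate 0 Y).
    by rewrite /poisson_tail; ring.
  by field.
move=> N _; rewrite (@eq_queries_value Ys _ (fun gs => mean ^+ N * \prod_(g <- gs) table_mean g));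
  last by move=> gs; rewrite /after_draws big_cat big_nseq iter_mulr_1.
rewrite queries_valueZ -/rest mulrA; congr (_ * _); rewrite /poisson opprB -meanE.
rewrite [RHS]mulrA -expRD addrAC subrr sub0r [(_ * mean) ^+ N]exprMn -mulrA.
by congr (_ * _); rewrite mulrAC.
Qed.

Definition query_cost : R :=
  used%:R + draw_price%:R * table_rate P rate_mul / b%:R +
  slots%:R * poisson_tail J.+1 (table_rate P rate_mul).

Section Cost.
Variables (q : nat) (bound : R).
Notation gf_tail := (queries_gf (nseq q [set: S])).
Notation query_gf := (query_gf (@sampler R P) p).
Hypothesis tail_cost : forall c x buf pos, represents c (Idle x) buf pos ->
  (gf_tail c)^`().[1] <= (budget (Idle x) buf pos)%:R / b%:R + bound.

Definition cost_after k c (a : act) : R :=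
  if halts a.2 then (gf_tail (next c a))^`().[1]
  else 1 + (query_gf k (next c a) [set: S] gf_tail)^`().[1].

Lemma ler_budget (m n : nat) : (m <= n)%N -> m%:R / b%:R + bound <= n%:R / b%:R + bound.
Proof. by move=> mn; rewrite lerD2r ler_pM2r ?invr_gt0 ?ltr0n // ler_nat. Qed.

Lemma advances_cost k c n a :
  (forall c s buf pos, represents c s buf pos -> ~~ is_idle s -> (budget s buf pos < k)%N ->
   (query_gf k c [set: S] gf_tail)^`().[1] <= (budget s buf pos)%:R / b%:R + bound) ->
  (n <= k)%N -> advances c n a -> cost_after k c a <= n%:R / b%:R + bound.
Proof.
move=> gf_cost nk [s [buf [pos [a_rep a_halts budget_le]]]]; rewrite /cost_after a_halts.
case: (boolP (is_idle s)) budget_le => [idle_s|not_idle]; rewrite ?mul0n ?addn0 => budget_le.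
  case: s idle_s a_rep budget_le {a_halts} => // x _ a_rep budget_le.
  exact: le_trans (tail_cost a_rep) (ler_budget budget_le).
rewrite mul1n in budget_le; apply: le_trans (ler_budget budget_le).
rewrite natrD mulrDl divff ?pnatr_eq0 -?lt0n // addrAC [_ + 1]addrC lerD2l.
by apply: gf_cost => //; have := b_gt0; lia.
Qed.

Lemma query_gf_cost_le k c s buf pos : represents c s buf pos -> ~~ is_idle s ->
  (budget s buf pos < k)%N ->
  (query_gf k c [set: S] gf_tail)^`().[1] <= (budget s buf pos)%:R / b%:R + bound.
Proof.
elim: k c s buf pos => [|k IH] c s buf pos // c_rep not_idle budget_lt.
have c_running : running c by exists s, buf, pos.
rewrite (query_gf_cost sampler_terminating q c_running (step_stops c_rep not_idle budget_lt)).
rewrite (sampler_step c_rep); apply: expect_le => [|a a_drawn]; first exact: fdist_step.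
by apply: advances_cost => //; exact: (step_advances c_rep not_idle a_drawn).
Qed.

Definition idle_budget buf pos x : R :=
  (consumed_potential pos + labels_potential buf + sample_price L * x + b * used)%:R / b%:R + bound.

Lemma start_cost c reports x N buf pos : settled c buf pos x -> (N <= J.+1)%N ->
  expect (start used rate_mul (view c) reports N x) (cost_after max_ios.-1 c) <=
  idle_budget buf pos x + (if N == J.+1 then slots%:R else draw_price%:R / b%:R * N%:R).
Proof.
move=> c_settled NJ; apply: expect_le => [|a a_drawn]; first exact: fdist_start.
have le_max : (start_budget buf pos x N <= max_ios.-1)%N.
  by have := start_budget_lt c_settled NJ; lia.
apply: le_trans (advances_cost (@query_gf_cost_le _) le_max
  (start_advances c_settled NJ a_drawn)) _.
rewrite /start_budget /idle_budget natrD mulrDl addrAC lerD2l.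
case: eqP => _; first by rewrite natrM mulrAC divff ?mul1r // pnatr_eq0 -lt0n.
by rewrite natrM mulrAC.
Qed.

Lemma mean_start_cost c reports x buf pos : settled c buf pos x ->
  expect (truncated_poisson J (table_rate P rate_mul))
    (fun N => expect (start used rate_mul (view c) reports N x) (cost_after max_ios.-1 c)) <=
  (budget (Idle x) buf pos)%:R / b%:R + (bound + query_cost).
Proof.
move=> c_settled; have rate_ge0 := ltW table_rate_gt0.
pose w := draw_price%:R / b%:R : R; pose idle := idle_budget buf pos x.
rewrite expect_truncated_poisson.
apply: le_trans (_ : \sum_(N < J.+1) poisson (table_rate P rate_mul) N * (idle + w * N%:R) +
  poisson_tail J.+1 (table_rate P rate_mul) * (idle + slots%:R) <= _).
  apply: lerD.
    apply: ler_sum => N _; rewrite ler_wpM2l ?poisson_ge0 //; have NJ := ltn_ord N.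
    by have := start_cost reports c_settled (ltnW NJ); rewrite ltn_eqF.
  rewrite ler_wpM2l ?poisson_tail_ge0 //.
  by have := start_cost reports c_settled (leqnn _); rewrite eqxx.
have mean_le : w * (\sum_(N < J.+1) poisson (table_rate P rate_mul) N * N%:R) <=
    w * table_rate P rate_mul.
  by rewrite ler_wpM2l ?divr_ge0 // poisson_mean_le.
have tailE : poisson_tail J.+1 (table_rate P rate_mul) =
  1 - \sum_(N < J.+1) poisson (table_rate P rate_mul) N by [].
have -> : \sum_(N < J.+1) poisson (table_rate P rate_mul) N * (idle + w * N%:R) =
    (\sum_(N < J.+1) poisson (table_rate P rate_mul) N) * idle +
    w * \sum_(N < J.+1) poisson (table_rate P rate_mul) N * N%:R.
  by rewrite big_distrl big_distrr -big_split; apply: eq_bigr => N _ /=; ring.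
have idleE : idle = (budget (Idle x) buf pos)%:R / b%:R + used%:R + bound.
  rewrite /idle /idle_budget /budget subn0 natrD mulrDl natrM [_ * _ / _]mulrAC divff ?mul1r //.
  by rewrite pnatr_eq0 -lt0n.
rewrite /query_cost; move: idleE mean_le tailE; rewrite [_ * table_rate P rate_mul / _]mulrAC -/w.
by move=> idleE mean_le ->; lra.
Qed.

Lemma queries_gf_cost_cons c x buf pos : represents c (Idle x) buf pos ->
  (queries_gf (nseq q.+1 [set: S]) c)^`().[1] <=
  (budget (Idle x) buf pos)%:R / b%:R + (bound + query_cost).
Proof.
move=> c_rep; have c_idle : idle c by exists x, buf, pos.
rewrite -[leLHS]/(query_gf max_ios.-1.+1 c [set: S] gf_tail)^`().[1].
rewrite (query_gf_cost sampler_terminating q (ready_inv sampler_terminating c_idle)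
  (ready_stops sampler_terminating c_idle)) (sampler_step c_rep) expect_bind.
apply: expect_le => [|D _]; first by apply: fdist_thin_map => a; exact: prob_of_word01.
rewrite expect_bind or_elseE; last exact: fdist_truncated_poisson (ltW table_rate_gt0).
exact: mean_start_cost (idle_settled c_rep).
Qed.

End Cost.

Lemma queries_gf_cost q c x buf pos : represents c (Idle x) buf pos ->
  (queries_gf (nseq q [set: S]) c)^`().[1] <=
  (budget (Idle x) buf pos)%:R / b%:R + q%:R * query_cost.
Proof.
elim: q c x buf pos => [|q IH] c x buf pos c_rep.
  by rewrite /= derivC horner0 mul0r addr0 divr_ge0.
apply: le_trans (queries_gf_cost_cons IH c_rep) _.
by rewrite -natr1 mulrDl mul1r.
Qed.

(** * The initial configuration *)

Definition node_list : seq (nat * nat) :=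
  sort (fun n n' => n'.1 <= n.1)%N
    (undup [seq (l, i) | l <- iota 1 L, i <- iota 0 (level_size l)]).

Lemma mem_node_list l i : ((l, i) \in node_list) = is_node l i.
Proof.
rewrite mem_sort mem_undup.
apply/allpairsPdep/and3P => [[l' [i' [l_mem i_mem [-> ->]]]]|[l_gt0 lL il]].
  by move: l_mem i_mem; rewrite !mem_iota; split; lia.
by exists l, i; rewrite !mem_iota; split=> //; lia.
Qed.

Definition filled buf : Prop := forall l i, is_node l i ->
  exists2 ys, buf l i = map table ys & size ys = (fan l * b)%N.

Definition unread : nat -> nat -> nat := fun _ _ => 0%N.

Definition init_mem buf : mem :=
  [ffun x : 'I_M => if x == 0 :> nat then inr (number (control_word (Idle 0)))
    else if (x < buffer_base)%N then heavy (x - heavy_base)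
    else if (x < counter_base)%N then nth null_word (buf L 0%N) (x - buffer_base)
    else inr (number 0)].

Definition init_disk buf : dsk :=
  [ffun be : 'I_K => [ffun j : 'I_B =>
    if (be < tb)%N then table (be * b + j)
    else if (be < tb + hmax)%N then heavy (hm + (be - tb) * b + j)
    else if [pick z : 'I_L * 'I_K |
        (z.2 < level_size z.1)%N && (be == block (part_block z.1 z.2))] is Some z
    then part_word buf unread z.1.+1 (z.2 %/ f) (z.2 %% f) j
    else null_word]].

Definition init_config buf : cfg := (init_mem buf, init_disk buf).

Lemma init_disk_part buf l i d t : is_node l i -> (d < fan l)%N -> (t <= b)%N ->
  init_disk buf (block (part_block l.-1 (i * f + d))) (inord t) = part_word buf unread l i d t.
Proof.
move=> nd df t_le; have l_gt0 : (0 < l)%N by case/and3P: nd.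
have bB := node_chunk nd; have lL := child_level nd; have il := node_child_size nd df.
have blockK := part_block_lt lL il; have block_inord := inordK blockK.
have t_inord : (inord t : 'I_B) = t :> nat by rewrite inordK; lia.
have childK : (i * f + d < K)%N by move: blockK; rewrite /part_block; lia.
have df' := leq_trans df (fan_leq _).
rewrite !ffunE t_inord block_inord.
rewrite ifF; last by rewrite /part_block; lia.
rewrite ifF; last by rewrite /part_block; lia.
case: pickP => [[l' i'] /= /andP[il' /eqP blockE]|/(_ (Ordinal lL, Ordinal childK))].
  have [lE iE] := part_block_inj lL il (ltn_ord l') il' blockE.
  by rewrite -lE -iE prednK // child_parent // modnMDl modn_small.
by rewrite /= il eqxx.
Qed.

Lemma mem_at_init buf a : (a < M)%N -> mem_at (init_mem buf) a =
  if a == 0%N then inr (number (control_word (Idle 0)))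
  else if (a < buffer_base)%N then heavy (a - heavy_base)
  else if (a < counter_base)%N then nth null_word (buf L 0%N) (a - buffer_base)
  else inr (number 0).
Proof. by move=> aM; rewrite /mem_at ffunE /cell inordK. Qed.

Lemma init_records_stored buf : records_stored (init_mem buf) (init_disk buf).
Proof.
have [cE bE hE] := basesE; have mf := memory_fits; have df := disk_fits; have hl := used_le.
split=> [t t_hm|be t be_tb t_lt|j t j_used t_lt].
- rewrite mem_at_init; last by lia.
  by rewrite ifT ?addKn //; lia.
- by rewrite !ffunE !inordK ?be_tb //; lia.
rewrite !ffunE !inordK; try lia.
rewrite ifF; last by lia.
by rewrite ifT ?addKn //; lia.
Qed.

Lemma init_root_part buf d : (d < f)%N -> part_in_memory buf unread (init_mem buf) L 0 d.
Proof.
move=> df t t_le; have [cE bE hE] := basesE.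
have cell_range := part_cell_range df t_le.
rewrite mem_at_init; last by case/andP: cell_range.
rewrite ifF; last by lia.
rewrite ifF; last by lia.
rewrite /part_cell /part_word.
case: (ltngtP t b) t_le => // [t_lt|_] _; last by rewrite ifF //; lia.
rewrite -addnA ifT ?addKn //; have := ltn_muladd t_lt df; lia.
Qed.

Lemma init_represents buf : filled buf -> represents (init_config buf) (Idle 0) buf unread.
Proof.
move=> buf_filled; split=> //; first by rewrite mem_at_init.
  split; first exact: init_records_stored.
  move=> l i d nd df /=; case: (eqVneq (Some (L, 0%N)) (Some (l, i))) => [[<- <-]|_].
    by apply: init_root_part; exact: leq_trans df (fan_leq _).
  by move=> t t_le; exact: init_disk_part.
split=> // l i nd; have [ys bufE ys_size] := buf_filled l i nd.
  by rewrite bufE size_map ys_size.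
rewrite not_below_deeper; last by case/and3P: nd; rewrite /=; lia.
by rewrite bufE /no_labels all_map; apply/allP => s _ /=; rewrite table_nolabel // fan_leq.
Qed.

Lemma sum_nodes0 h : (forall l i, is_node l i -> h l i = 0%N) -> sum_nodes h = 0%N.
Proof.
move=> h0; apply/eqP; rewrite -leqn0.
apply: leq_trans (leq_sum_nodes (_ : forall l i, is_node l i -> h l i <= 0)%N) _.
  by move=> l i nd; rewrite h0.
by rewrite leqn0; apply/eqP; apply: big1 => l _; apply: big1 => i _; case: ifP.
Qed.

Lemma init_budget buf : filled buf -> budget (Idle 0) buf unread = 0%N.
Proof.
move=> buf_filled; rewrite /budget /consumed_potential /labels_potential !sum_nodes0 ?muln0 //.
  move=> l i nd; have [ys -> _] := buf_filled l i nd; apply: big1 => d _.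
  have -> : pending_labels l d (map table ys) = 0%N.
    rewrite /pending_labels /label_count /label_mask -map_comp; apply/eqP.
    rewrite eqn0Ngt -has_count has_map; apply/hasPn => s _ /=.
    by rewrite table_nolabel // fan_leq.
  by rewrite /label_cost !muln0.
by move=> l i _; rewrite /consumed_credit muln0 mod0n muln0; case: eqP.
Qed.

Definition init : fdist R cfg :=
  dmap init_config (@fill_nodes R _ f f0 L b table node_list (fun _ _ => [::])).

Lemma surely_filled :
  surely (@fill_nodes R _ f f0 L b table node_list (fun _ _ => [::])) filled.
Proof.
by move=> buf /surely_fill_nodes buf_fill l i nd; have := buf_fill l i; rewrite mem_node_list nd.
Qed.

Lemma expect_init_queries_gf Ys : expect init (fun c => (queries_gf Ys c).[1]) =
  \prod_(Y <- Ys) (resident_value Y * (disk_value 0 Y *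
    expR (- (table_rate P rate_mul - pass_rate 0 Y)))).
Proof.
rewrite expect_map (@eq_expect_in _ _ _ _ (fun buf =>
  queries_value Ys (stream_law None buf unread))); last first.
  by move=> buf /surely_filled buf_filled; exact: queries_gf_value (init_represents buf_filled).
rewrite expect_queries_value -queries_value_iid; apply: eq_queries_value => gs.
rewrite /stream_law; case: eqP => [_|/eqP f0_neq0].
  by rewrite expect_cst //; exact: fdist_fill_nodes.
have f0_gt0 : (0 < f0)%N by rewrite lt0n.
have L_gt0 : (0 < L)%N by rewrite depthE.
have f_gt0 := fanout_gt0 L_gt0.
rewrite (@eq_expect _ _ _ _ (fun buf => tree_law buf L 0 gs)); last first.
  by move=> buf; apply: eq_tree_law => l i; rewrite /live_buffers drop0.
rewrite expect_fill_nodes //.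
- rewrite tree_law_empty //; apply: eq_bigr => g _; rewrite root_meanE // /table_mean.
  by rewrite /slots table_blocksE // /level_size ltn_eqF // subn0 -mulnA.
- by rewrite sort_uniq undup_uniq.
- by apply: sort_sorted => n n'; exact: leq_total.
- move=> [l i]; rewrite mem_node_list => nd; have [l_gt0 lL _] := and3P nd.
  by split=> //; exact: node_lt_expn.
by move=> l s; apply: table_nolabel; exact: fan_leq.
Qed.

Theorem sampler_samples (bound : R) :
  (forall Y, resident_value Y * (disk_value 0 Y *
     expR (- (table_rate P rate_mul - pass_rate 0 Y))) = \prod_(v in ~: Y) (1 - p v)) ->
  query_cost <= bound ->
  samples_subsets (program_of (@sampler R P)) p bound.
Proof.
move=> valueE cost_le; apply: (samples_of_queries_gf sampler_terminating (init := init)).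
- by move=> _ /mapP[_ /mapP[buf buf_drawn ->] ->]; exists 0%N, buf.2, unread;
    exact/init_represents/surely_filled/map_f.
- by apply: fdist_map; exact: fdist_fill_nodes.
- by move=> Ys; rewrite expect_init_queries_gf; apply: eq_bigr.
move=> q; rewrite expect_map; apply: expect_le => [|buf /surely_filled buf_filled].
  exact: fdist_fill_nodes.
apply: le_trans (queries_gf_cost q (init_represents buf_filled)) _.
by rewrite init_budget // mul0r add0r ler_wpM2l.
Qed.

Lemma heavy_valueE Y :
  resident_value Y * disk_value 0 Y = \prod_(t < hm + used * b) heavy_pass Y (heavy t).
Proof.
rewrite big_split_ord; congr (_ * _); rewrite /disk_value big_mkord.
rewrite [RHS](big_ord_mul _ (fun t => heavy_pass Y (heavy (hm + t)))).
by apply: eq_bigr => j _; apply: eq_bigr => t _; rewrite addnA.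
Qed.

Lemma reject_rateE Y : table_rate P rate_mul - pass_rate 0 Y =
  \sum_(s < slots) slot_rate P rate_mul * (accept_word (table s) * (1 - (safe Y (table s))%:R)).
Proof.
rewrite /pass_rate big_mkord /table_rate mulr_natl -[X in _ *+ X]card_ord -sumr_const -sumrB.
by apply: eq_bigr => s _; rewrite /slot_pass; ring.
Qed.

Section Instance.
Variables heavies lights : seq S.
Hypothesis p01 : forall v, 0 <= p v <= 1.
Hypothesis lights_lt1 : {in lights, forall v, p v < 1}.
Hypothesis partitionE : perm_eq (heavies ++ lights) (enum S).

Definition slot_records : seq S :=
  flatten [seq nseq (slot_count (slot_rate P rate_mul) (p v)) v | v <- lights].

Hypothesis heavyE : forall t, heavy t = nth null_word (map inl heavies) t.
Hypothesis tableE : forall s, table s = nth null_word (map inl slot_records) s.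
Hypothesis heavies_fit : (size heavies <= hm + used * b)%N.
Hypothesis slot_records_fit : (size slot_records <= slots)%N.

Lemma safe_record Y v : 1 - (safe Y (inl v : word))%:R = (v \notin Y)%:R :> R.
Proof. by rewrite /=; case: (v \in Y); rewrite ?subrr ?subr0. Qed.

Lemma heavies_value Y : \prod_(t < hm + used * b) heavy_pass Y (heavy t) =
  \prod_(v <- heavies) (if v \in ~: Y then 1 - p v else 1).
Proof.
rewrite (eq_bigr (fun t : 'I_(hm + used * b) =>
  heavy_pass Y (nth null_word (map inl heavies) t))); last by move=> t _; rewrite heavyE.
rewrite (big_ord_nth _ (F := heavy_pass Y)) ?size_map //; last by rewrite /heavy_pass mul0r subr0.
rewrite big_map; apply: eq_bigr => v _; rewrite /heavy_pass safe_record /= clampE // finset.in_setC.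
by case: (v \in Y); rewrite /= ?mulr0 ?subr0 ?mulr1.
Qed.

Lemma lights_value Y : expR (- \sum_(s < slots) slot_rate P rate_mul *
    (accept_word (table s) * (1 - (safe Y (table s))%:R))) =
  \prod_(v <- lights) (if v \in ~: Y then 1 - p v else 1).
Proof.
pose rate w := slot_rate P rate_mul * (accept_word w * (1 - (safe Y w)%:R)).
rewrite (eq_bigr (fun s : 'I_slots => rate (nth null_word (map inl slot_records) s)));
  last by move=> s _; rewrite -tableE.
rewrite (big_ord_nth _ (F := rate)) ?size_map //; last by rewrite /rate mul0r mulr0.
rewrite big_map big_flatten big_map -sumrN (big_morph _ (@expRD R) (@expR0 R)).
rewrite !big_seq; apply: eq_bigr => v v_light; rewrite big_nseq iter_addr_0 /rate safe_record.
have /andP[p_ge0 _] := p01 v.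
rewrite [slot_rate P rate_mul * _]mulrA -mulrnAl -mulr_natl accept_probE // finset.in_setC.
by case: (v \in Y); rewrite ?mulr0 ?oppr0 ?expR0 // mulr1 expR_rate_of_prob // lights_lt1.
Qed.

Theorem sampler_samples_instance (bound : R) : query_cost <= bound ->
  samples_subsets (program_of (@sampler R P)) p bound.
Proof.
apply: sampler_samples => Y; rewrite mulrA heavy_valueE reject_rateE heavies_value lights_value.
by rewrite -big_cat (perm_big _ partitionE) big_enum -big_mkcond.
Qed.

End Instance.
End Machine.

(** * Instances that fit in memory *)

Section InMemory.
Variables (R : realType) (M B W : nat).

Definition report_act (reports : seq 'I_M) : action M B 0 W :=
  ([set x in reports], [ffun x => inl x], Halt _ _ _).

Definition thin_memory (u : view R M W) : fdist R (action M B 0 W) :=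
  dmap report_act (thin [seq (prob_of_word (u x), x) | x <- enum 'I_M]).

Lemma fdist_thin_memory u : is_fdist (thin_memory u).
Proof.
apply: fdist_map; apply: fdist_thin; rewrite all_map; apply/allP => x _.
exact: prob_of_word01.
Qed.

Variables (S : finType) (p : S -> R).
Hypothesis p01 : forall v, 0 <= p v <= 1.
Hypotheses (W_gt0 : (0 < W)%N) (S_fits : (#|S| <= M)%N).

Definition memory_config : config M B 0 W S :=
  ([ffun x : 'I_M => nth (inr (Ordinal W_gt0)) (map inl (enum S)) x],
   [ffun=> [ffun=> inr (Ordinal W_gt0)]]).

Lemma next_report_act reports (c : config M B 0 W S) :
  next_config (report_act reports) c = c.
Proof.
by case: c => m d; rewrite /next_config /=; congr (_, _); apply/ffunP => x; rewrite !ffunE.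
Qed.

Lemma surely_thin_memory u (c : config M B 0 W S) : surely (thin_memory u)
  (fun a => halts a.2 /\ next_config a c = c).
Proof. by apply: surely_map => reports _; split=> //; exact: next_report_act. Qed.

Lemma expect_thin_memory (Y : {set S}) :
  expect (thin_memory (view_of p memory_config.1))
    (fun a => (reported a memory_config.1 \subset Y)%:R) = \prod_(v in ~: Y) (1 - p v).
Proof.
pose pass (w : S + 'I_W) := if w is inl v then if v \in ~: Y then 1 - p v else 1 else 1.
rewrite expect_map (@eq_expect _ _ _ _ (fun reports =>
  \prod_(x <- reports) (safe Y (memory_config.1 x))%:R)); last first.
  by move=> reports; apply: reported_subset => x; rewrite inE.
rewrite expect_thin_prod big_map big_enum /= (eq_bigl xpredT) //.
rewrite (eq_bigr (fun x : 'I_M => pass (nth (inr (Ordinal W_gt0)) (map inl (enum S)) x))).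
  rewrite (big_ord_nth _ (F := pass)) //; last by rewrite size_map -cardE.
  by rewrite big_map big_enum -big_mkcond.
move=> x _; rewrite !ffunE; case: nth => [v|i] /=; last by rewrite mul0r subr0.
by rewrite clampE // finset.in_setC; case: (v \in Y); rewrite ?subrr ?mulr0 ?subr0 ?mulr1.
Qed.

Lemma thin_memory_terminating :
  terminating thin_memory p (eq memory_config) (eq memory_config) 1.
Proof.
split=> // [u|c cE a|c cE a]; first exact: fdist_thin_memory.
  by move=> /(surely_thin_memory c)[-> ->].
by move=> /(surely_thin_memory c)[-> _]; left.
Qed.

Notation queries_gf := (queries_gf thin_memory p 1).

Lemma thin_memory_value Ys :
  (queries_gf Ys memory_config).[1] = \prod_(Y <- Ys) \prod_(v in ~: Y) (1 - p v).
Proof.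
elim: Ys => [|Y Ys IH]; first by rewrite big_nil /= hornerC.
rewrite -[LHS]/(query_gf thin_memory p 1 memory_config Y (queries_gf Ys)).[1] query_gf_at1.
rewrite big_cons -IH -expect_thin_memory -expectZr; apply: eq_expect_in => a.
by move=> /(surely_thin_memory memory_config)[-> ->].
Qed.

Lemma thin_memory_cost q : (queries_gf (nseq q [set: S]) memory_config)^`().[1] = 0.
Proof.
elim: q => [|q IH]; first by rewrite /= derivC horner0.
rewrite -[LHS]/(query_gf thin_memory p 1 memory_config [set: S]
  (queries_gf (nseq q [set: S])))^`().[1] query_gf_deriv_at1 (@eq_expect_in _ _ _ _ (fun=> 0)).
  by rewrite expect_cst //; exact: fdist_thin_memory.
by move=> a /(surely_thin_memory memory_config)[-> ->].
Qed.

Theorem thin_memory_samples (bound : R) : 0 <= bound ->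
  samples_subsets (program_of thin_memory) p bound.
Proof.
move=> bound_ge0.
apply: (samples_of_queries_gf thin_memory_terminating (init := dret R memory_config)).
- exact: surely_ret.
- exact: fdist_ret.
- by move=> Ys; rewrite expect_ret thin_memory_value.
by move=> q; rewrite expect_ret thin_memory_cost mulr_ge0.
Qed.

End InMemory.

(** * Choice of the parameters *)

Lemma ceil_div_ge n d : (0 < d)%N -> (n <= ceil_div n d * d)%N.
Proof.
move=> d_gt0; rewrite /ceil_div; have := divn_eq (n + d.-1) d; have := ltn_pmod (n + d.-1) d_gt0.
by move: (_ %/ _)%N (_ %% _)%N => q r; lia.
Qed.

Lemma ceil_div_lt n d : (0 < d)%N -> (ceil_div n d * d < n + d)%N.
Proof.
by move=> d_gt0; rewrite /ceil_div; have := leq_divM (n + d.-1) d; lia.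
Qed.

Lemma leq_ceil_div n n' d : (n <= n')%N -> (ceil_div n d <= ceil_div n' d)%N.
Proof. by move=> nn'; rewrite leq_div2r // leq_add2r. Qed.

Lemma ceil_div0 d : ceil_div 0 d = 0%N.
Proof. by case: d => // d; rewrite /ceil_div add0n divn_small. Qed.

Lemma rate_of_prob_le (R : realType) (x : R) : 0 <= x <= 2^-1 -> rate_of_prob x <= 2 * x.
Proof.
move=> /andP[x_ge0 x_le]; have x_lt1 : 0 < 1 - x by lra.
have -> : rate_of_prob x = ln (1 + x / (1 - x)).
  by rewrite /rate_of_prob -lnV ?posrE //; congr ln; field; exact: lt0r_neq0.
apply: le_trans (le_ln1Dx _) _; first by apply: lt_le_trans (divr_ge0 x_ge0 (ltW x_lt1)); lra.
by rewrite ler_pdivrMr //; nra.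
Qed.

Lemma size_slot_records (R : realType) (P : layout R) (S : finType) (p : S -> R) rate_mul s :
  0 < slot_rate P rate_mul -> (forall v, 0 <= p v) ->
  (size (slot_records P p rate_mul s))%:R <=
  (\sum_(v <- s) rate_of_prob (p v)) / slot_rate P rate_mul + (size s)%:R.
Proof.
move=> rate_gt0 p_ge0; elim: s => [|v s IH]; first by rewrite big_nil mul0r add0r.
have ratio_ge0 : 0 <= rate_of_prob (p v) / slot_rate P rate_mul.
  by rewrite divr_ge0 ?rate_of_prob_ge0 ?p_ge0 // ltW.
have /andP[count_le _] := truncn_itv ratio_ge0.
have -> : size (slot_records P p rate_mul (v :: s)) =
    (slot_count (slot_rate P rate_mul) (p v) + size (slot_records P p rate_mul s))%N.
  by rewrite /slot_records /= size_cat size_nseq.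
by rewrite big_cons mulrDl natrD /slot_count [size (v :: s)]/= -!natr1; lra.
Qed.

(* Folded, because arithmetic tactics try to evaluate the power. *)
Definition word_fits (n W : nat) : bool := (n.+2 ^ 64 <= W)%N.

(* Rounding in [slot_count] costs each record at most one slot, so that [2 * n] slots
   hold [n] records whose total rate is at most that of [n] slots. *)
Record fits (R : realType) (P : layout R) (n : nat) : Prop := {
  fits_chunk : (0 < chunk P <= (block_pred P).+1)%N;
  fits_counter : (0 < root_fanout P)%N -> (chunk P < (block_pred P).+1)%N;
  fits_flat : root_fanout P = 0%N -> chunk P = 1%N;
  fits_fanout : (root_fanout P <= fanout P)%N;
  fits_branching : (0 < depth P)%N -> (1 < fanout P)%N;
  fits_tree : (0 < depth P)%N = (0 < root_fanout P)%N;
  fits_memory : (counter_base P + fanout P <= (mem_pred P).+1)%N;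
  fits_disk : (table_blocks P + heavy_blocks P + level_start P (depth P) <= (disk_pred P).+1)%N;
  fits_word : word_fits n (word_pred P).+1;
  fits_leaves : (0 < root_fanout P)%N -> table_blocks P = level_size P 0;
  fits_slots : (2 * n <= slots P <= 4 * n)%N;
  fits_resident : ((chunk P).-1 <= resident P)%N;
  fits_heavy : (ceil_div n (chunk P) <= heavy_blocks P)%N;
  fits_buffer : (fanout P <= n)%N && (fanout P * chunk P <= n)%N;
  fits_depth : (depth P <= 2 * n)%N;
  fits_radix : radix P = (n.+2 ^ 8)%N;
  fits_draws : max_draws P = (36 * n.+2 ^ 3)%N;
  fits_rate_unit : rate_unit P = (n.+2 ^ 3)%:R^-1
}.

Lemma four_div_sqr_le (R : realType) n : 4 / n.+2%:R ^+ 2 <= 1 :> R.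
Proof.
rewrite ler_pdivrMr ?exprn_gt0 ?ltr0n // mul1r -natrX ler_nat.
by rewrite -[4%N]/(2 ^ 2)%N leq_exp2r.
Qed.

Section Fitting.
Variables (R : realType) (P : layout R) (n : nat).
Hypotheses (n_gt0 : (0 < n)%N) (P_fits : fits P n).
Variables (S : finType) (p : S -> R).
Hypotheses (cardS : #|S| = n) (p01 : forall v, 0 <= p v <= 1).

Definition heavies : seq S := [seq v <- enum S | 2^-1 < p v].
Definition lights : seq S := [seq v <- enum S | ~~ (2^-1 < p v)].
Definition light_rate : R := \sum_(v <- lights) rate_of_prob (p v).

Definition used_heavy_blocks : nat := ceil_div (size heavies - resident P) (chunk P).

(* Just enough for [n] slots to have a rate larger than that of the light records. *)
Definition rate_multiple : nat := (Num.truncn (light_rate / (n%:R * rate_unit P))).+1.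

Lemma p_ge0 v : 0 <= p v. Proof. by case/andP: (p01 v). Qed.

Lemma light_half v : v \in lights -> 0 <= p v <= 2^-1.
Proof. by rewrite mem_filter -leNgt p_ge0 => /andP[]. Qed.

Lemma mu_ge0 : 0 <= mu p. Proof. by apply: sumr_ge0 => v _; exact: p_ge0. Qed.

Lemma mu_le : mu p <= n%:R.
Proof.
rewrite -cardS /mu -[leRHS]mulr1 mulr_natl -sumr_const; apply: ler_sum => v _.
by case/andP: (p01 v).
Qed.

Lemma size_heavies_le : (size heavies)%:R <= 2 * mu p.
Proof.
have -> : (size heavies)%:R = \sum_(v <- heavies) 1 :> R.
  by rewrite big_const_seq count_predT iter_addr_0.
rewrite /mu -big_enum big_distrr /heavies big_filter big_mkcond; apply: ler_sum => v _.
by have := p_ge0 v; case: ifP => heavy_v /=; lra.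
Qed.

Lemma light_rate_ge0 : 0 <= light_rate.
Proof. by apply: sumr_ge0 => v _; rewrite rate_of_prob_ge0 ?p_ge0. Qed.

Lemma light_rate_le : light_rate <= 2 * mu p.
Proof.
rewrite /light_rate /mu -big_enum big_distrr /lights big_filter big_mkcond; apply: ler_sum => v _.
have p_v := p_ge0 v; case: ifP => [|_] /=; last by rewrite mulr_ge0.
by rewrite -leNgt => p_v_le; rewrite rate_of_prob_le // p_v p_v_le.
Qed.

Lemma size_heavies : (size heavies <= n)%N.
Proof. by rewrite -cardS cardE size_filter count_size. Qed.

Lemma size_lights : (size lights <= n)%N.
Proof. by rewrite -cardS cardE size_filter count_size. Qed.

Lemma used_heavy_blocks_fit : (size heavies <= resident P + used_heavy_blocks * chunk P)%N.
Proof.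
have /andP[chunk_gt0 _] := fits_chunk P_fits.
by have := ceil_div_ge (size heavies - resident P) chunk_gt0; rewrite -/used_heavy_blocks; lia.
Qed.

Lemma used_heavy_blocks_size : (used_heavy_blocks * chunk P <= size heavies)%N.
Proof.
have /andP[chunk_gt0 _] := fits_chunk P_fits; rewrite /used_heavy_blocks.
have [few|many] := leqP (size heavies) (resident P).
  by rewrite (eqP few) ceil_div0.
by have := ceil_div_lt (size heavies - resident P) chunk_gt0; have := fits_resident P_fits; lia.
Qed.

Lemma used_heavy_blocks_le : (used_heavy_blocks <= heavy_blocks P)%N.
Proof.
apply: leq_trans (fits_heavy P_fits); apply: leq_ceil_div.
exact: leq_trans (leq_subr _ _) size_heavies.
Qed.

Lemma power_bounds : [/\ (27 <= n.+2 ^ 3)%N, (243 * n.+2 ^ 3 <= n.+2 ^ 8)%N & (n <= n.+2 ^ 3)%N].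
Proof.
split.
- by rewrite -[27%N]/(3 ^ 3)%N leq_exp2r.
- by rewrite (expnD _ 5 3) leq_mul2r -[243%N]/(3 ^ 5)%N leq_exp2r // orbC n_gt0.
by apply: leq_trans (_ : n.+2 ^ 1 <= _)%N; [rewrite expn1; lia | rewrite leq_exp2l].
Qed.

Lemma n_gt0R : 0 < n%:R :> R. Proof. by rewrite ltr0n. Qed.

Lemma rate_unit_gt0 : 0 < rate_unit P.
Proof. by rewrite (fits_rate_unit P_fits) invr_gt0 ltr0n expn_gt0. Qed.

Lemma slot_rate_gt0 : 0 < slot_rate P rate_multiple.
Proof. by rewrite mulr_gt0 ?ltr0n // rate_unit_gt0. Qed.

Lemma slot_rate_bounds : light_rate < n%:R * slot_rate P rate_multiple <=
  light_rate + n%:R * rate_unit P.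
Proof.
have unit_gt0 := rate_unit_gt0; have n0 := n_gt0R.
have nu_gt0 : 0 < n%:R * rate_unit P by rewrite mulr_gt0.
pose y := light_rate / (n%:R * rate_unit P).
have y_ge0 : 0 <= y by rewrite divr_ge0 ?light_rate_ge0 // ltW.
have /andP[y_trunc y_lt] := truncn_itv y_ge0.
have -> : n%:R * slot_rate P rate_multiple = rate_multiple%:R * (n%:R * rate_unit P).
  by rewrite /slot_rate mulrCA.
rewrite -ltr_pdivrMr // y_lt /= /rate_multiple -natr1 mulrDl mul1r lerD2r.
by rewrite -ler_pdivlMr.
Qed.

Lemma rate_multiple_le : (rate_multiple <= 2 * n.+2 ^ 3 + 1)%N.
Proof.
rewrite addn1 ltnS -(ler_nat R).
have unit_gt0 := rate_unit_gt0; have n0 := n_gt0R.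
have y_ge0 : 0 <= light_rate / (n%:R * rate_unit P).
  by rewrite divr_ge0 ?light_rate_ge0 ?mulr_ge0 // ltW.
have /andP[y_trunc _] := truncn_itv y_ge0; apply: le_trans y_trunc _.
rewrite ler_pdivrMr ?mulr_gt0 // (fits_rate_unit P_fits) natrM mulrACA divff ?mulr1.
  by apply: le_trans light_rate_le _; rewrite ler_pM2l // mu_le.
by rewrite pnatr_eq0 expn_eq0.
Qed.

Lemma slot_records_fit : (size (slot_records P p rate_multiple lights) <= slots P)%N.
Proof.
have /andP[slots_ge _] := fits_slots P_fits; apply: leq_trans slots_ge; rewrite -(ler_nat R).
apply: le_trans (size_slot_records lights slot_rate_gt0 p_ge0) _.
rewrite -/light_rate mul2n -addnn natrD lerD ?ler_nat ?size_lights //.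
rewrite ler_pdivrMr ?slot_rate_gt0 // ltW //.
by have /andP[] := slot_rate_bounds.
Qed.

Lemma slots_gt0 : (0 < slots P)%N.
Proof. by have /andP[slots_ge _] := fits_slots P_fits; lia. Qed.

Lemma n_rate_unit_le : n%:R * rate_unit P <= 1 / n.+2%:R ^+ 2.
Proof.
have n2_gt0 : 0 < n.+2%:R :> R by rewrite ltr0n.
rewrite (fits_rate_unit P_fits) natrX ler_pdivrMr ?exprn_gt0 // mulrAC ler_pdivlMr ?exprn_gt0 //.
by rewrite mul1r exprS ler_pM2r ?exprn_gt0 // ler_nat ltnW.
Qed.

Lemma table_rate_le : table_rate P rate_multiple <= 8 * mu p + 4 / n.+2%:R ^+ 2.
Proof.
have /andP[_ slots_le] := fits_slots P_fits; have /andP[_ rate_le] := slot_rate_bounds.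
apply: le_trans (_ : 4 * (n%:R * slot_rate P rate_multiple) <= _).
  by rewrite mulrA ler_pM2r ?slot_rate_gt0 // -natrM ler_nat.
have := n_rate_unit_le; have := light_rate_le; move: rate_le.
by rewrite mul1r; move: (_ ^+ 2)^-1 => v; lra.
Qed.



Lemma tail_cost_le :
  (slots P)%:R * poisson_tail (max_draws P).+1 (table_rate P rate_multiple) <= n%:R^-1.
Proof.
set rate := table_rate P rate_multiple; set J1 := (max_draws P).+1.
have rate_ge0 : 0 <= rate by rewrite mulr_ge0 // ltW // slot_rate_gt0.
have J1_gt0 : 0 < J1%:R :> R by rewrite ltr0n.
have n0 := n_gt0R.
have rate_le : rate <= 9 * n%:R.
  have := table_rate_le; have := mu_le; have := four_div_sqr_le R n; rewrite -/rate.
  have : 1 <= n%:R :> R by rewrite ler1n.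
  by move: (4 / _) => v; lra.
have /andP[_ slots_le] := fits_slots P_fits.
apply: le_trans (_ : 4 * n%:R * (9 * n%:R / J1%:R) <= _).
  apply: ler_pM; rewrite ?poisson_tail_ge0 // -?natrM ?ler_nat //.
  rewrite ler_pdivlMr // mulrC; apply: le_trans (poisson_tail_markov _ rate_ge0) _.
  by rewrite natrM.
rewrite -[leRHS]mul1r ler_pdivlMr // mulrA mulrAC ler_pdivrMr // mul1r.
rewrite -!natrM ler_nat /J1 (fits_draws P_fits) leqW //.
apply: leq_trans (_ : 36 * n ^ 3 <= _)%N; first by rewrite !expnS expn0; lia.
by rewrite leq_mul2l leq_exp2r // !leqW.
Qed.

Lemma query_cost_le : query_cost P used_heavy_blocks rate_multiple <=
  (2 * mu p + (draw_price P)%:R * (8 * mu p + 4 / n.+2%:R ^+ 2)) / (chunk P)%:R + n%:R^-1.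
Proof.
have /andP[chunk_gt0 _] := fits_chunk P_fits.
have chunk_gt0R : 0 < (chunk P)%:R :> R by rewrite ltr0n.
rewrite /query_cost; apply: lerD tail_cost_le; rewrite mulrDl; apply: lerD.
  rewrite ler_pdivlMr // -natrM; apply: le_trans size_heavies_le.
  by rewrite ler_nat used_heavy_blocks_size.
by rewrite ler_pM2r ?invr_gt0 // ler_wpM2l // table_rate_le.
Qed.

Lemma radix_bounds : [/\ (10 < radix P)%N, ((max_draws P).+1 < radix P)%N,
  (4 * n < radix P)%N & (rate_multiple < radix P)%N].
Proof.
rewrite (fits_radix P_fits) (fits_draws P_fits); have := rate_multiple_le.
have [] := power_bounds; move: (n.+2 ^ 3)%N (n.+2 ^ 8)%N => T Q *.
by split; lia.
Qed.

Lemma used_heavy_blocks_le_n : (used_heavy_blocks <= n)%N.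
Proof.
have /andP[chunk_gt0 _] := fits_chunk P_fits.
apply: leq_trans size_heavies; apply: leq_trans used_heavy_blocks_size.
by rewrite leq_pmulr.
Qed.

Lemma word_large : (radix P ^ 8 <= (word_pred P).+1)%N.
Proof. by rewrite (fits_radix P_fits) -expnM; exact: fits_word P_fits. Qed.

Lemma slot_words_nolabel k s : (k <= fanout P)%N ->
  label_of k (nth (null_word P S) (map inl (slot_records P p rate_multiple lights)) s) = None.
Proof.
move=> k_le; have [s_lt|s_ge] := ltnP s (size (slot_records P p rate_multiple lights)).
  by case records : (slot_records _ _ _ _) s_lt => [|v r] // s_lt; rewrite (nth_map v).
rewrite nth_default ?size_map //= ifF //.
have /andP[fanout_le _] := fits_buffer P_fits; have [_ _ radix_gt _] := radix_bounds.
have := word_large; apply: contraTF => word_lt; rewrite -ltnNge.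
apply: leq_ltn_trans (leq_trans word_lt (leq_trans k_le fanout_le)) _.
by apply: leq_trans (_ : radix P ^ 1 <= _)%N; [rewrite expn1; lia | rewrite leq_pexp2l //; lia].
Qed.

Theorem fits_samples (bound : R) :
  (2 * mu p + (draw_price P)%:R * (8 * mu p + 4 / n.+2%:R ^+ 2)) / (chunk P)%:R + n%:R^-1 <=
    bound ->
  samples_subsets (program_of (@sampler R P)) p bound.
Proof.
move=> bound_ge; have [radix10 draws_lt n_lt multiple_lt] := radix_bounds.
have /andP[chunk_gt0 chunk_le] := fits_chunk P_fits.
have /andP[slots_ge slots_le] := fits_slots P_fits.
have /andP[fanout_le buffer_le] := fits_buffer P_fits.
have used_le := used_heavy_blocks_le_n; have depth_le := fits_depth P_fits.
apply: (@sampler_samples_instance R P S p chunk_gt0 chunk_le (fits_counter P_fits)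
  (fits_flat P_fits) (fits_fanout P_fits) (fits_tree P_fits) (fits_memory P_fits)
  (fits_disk P_fits) (fits_leaves P_fits) used_heavy_blocks rate_multiple
  (nth (null_word P S) (map inl heavies))
  (nth (null_word P S) (map inl (slot_records P p rate_multiple lights)))
  used_heavy_blocks_le slot_words_nolabel radix10 draws_lt _ _ _ _ _ multiple_lt word_large
  slots_gt0 (fits_branching P_fits) slot_rate_gt0 heavies lights p01) => //; try by lia.
- by move=> v /light_half; lra.
- by rewrite perm_filterC.
- exact: used_heavy_blocks_fit.
- exact: slot_records_fit.
exact: le_trans query_cost_le bound_ge.
Qed.

End Fitting.

Lemma ler_query_bound (R : realType) (n M B : nat) (m : R) : (0 < B)%N -> (2 * B <= M)%N ->
  (M < n)%N -> 0 <= m ->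
  B%:R^-1 + m / B%:R * (ln (n%:R / B%:R) / ln (M%:R / B%:R)) <= query_bound M B n m.
Proof.
move=> B_gt0 BM Mn m_ge0; rewrite /query_bound; apply: lerD.
  rewrite -[leLHS]mul1r ler_pM2r ?invr_gt0 ?ltr0n // ler1n /log_star.
  by case: ex_minnP => [[|t]] //=; rewrite ler_nat => nB; lia.
by rewrite ler_wpM2l ?divr_ge0 // le_max lexx orbT.
Qed.

Lemma query_bound_ge0 (R : realType) (n M B : nat) (m : R) : 0 <= m -> 0 <= query_bound M B n m.
Proof.
move=> m_ge0; rewrite addr_ge0 ?divr_ge0 // mulr_ge0 ?divr_ge0 //.
by rewrite le_max lexx.
Qed.

Lemma ln_ratio_ge1 (R : realType) (n M B : nat) : (0 < B)%N -> (2 * B <= M)%N -> (M < n)%N ->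
  1 <= ln (n%:R / B%:R) / ln (M%:R / B%:R) :> R.
Proof.
move=> B_gt0 BM Mn; have B_gt0R : 0 < B%:R :> R by rewrite ltr0n.
have MB : 2 <= M%:R / B%:R :> R by rewrite ler_pdivlMr // -natrM ler_nat.
have nB : M%:R / B%:R <= n%:R / B%:R :> R by rewrite ler_pM2r ?invr_gt0 // ler_nat ltnW.
by rewrite ler_pdivlMr ?ln_gt0 ?mul1r ?ler_ln ?posrE //; lra.
Qed.

Lemma tree_shape n b f : (0 < b)%N -> (b < 2 * n)%N -> (1 < f)%N ->
  exists l f0, [/\ (b * f ^ l < 2 * n)%N, (0 < f0 <= f)%N,
    (2 * n <= f0 * f ^ l * b)%N & (f0 * f ^ l * b < 4 * n)%N].
Proof.
move=> b_gt0 b_lt f_gt1.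
have deep_enough : exists k, (2 * n <= b * f ^ k)%N.
  exists (2 * n)%N; apply: leq_trans (ltnW (ltn_expl (2 * n) f_gt1)) _.
  by rewrite leq_pmull.
case: (ex_minnP deep_enough) => [[|l]] leaves_ge l_min.
  by rewrite expn0 muln1 in leaves_ge; lia.
have leaves_lt : (b * f ^ l < 2 * n)%N by rewrite ltnNge; apply/negP => /l_min; rewrite ltnn.
exists l, (ceil_div (2 * n) (b * f ^ l)).
have leaves_gt0 : (0 < b * f ^ l)%N by rewrite muln_gt0 b_gt0 expn_gt0; lia.
have := ceil_div_ge (2 * n) leaves_gt0; have := ceil_div_lt (2 * n) leaves_gt0.
rewrite expnSr mulnA in leaves_ge; set f0 := ceil_div _ _.
have -> : (f0 * f ^ l * b = f0 * (b * f ^ l))%N by rewrite -mulnA [(f ^ l * b)%N]mulnC.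
move: (b * f ^ l)%N leaves_ge leaves_lt leaves_gt0 f0 => d leaves_ge leaves_lt d_gt0 f0 f0_lt f0_ge.
split=> //; last by lia.
apply/andP; split; first by rewrite lt0n; apply/eqP => f00; move: f0_ge; rewrite f00; lia.
by rewrite -ltnS -(ltn_pmul2r d_gt0) mulSn; lia.
Qed.

Lemma level_start_le (R : realType) (P : layout R) l : (1 < fanout P)%N -> depth P = l.+1 ->
  (level_start P l.+1 <= 2 * (root_fanout P * fanout P ^ l))%N.
Proof.
move=> f_gt1 depthE; have sizeE k : (k <= l)%N ->
    level_size P k = (root_fanout P * fanout P ^ (l - k))%N.
  by move=> kl; rewrite /level_size depthE ltn_eqF.
have start_le k : (k <= l)%N -> (level_start P k.+1 + root_fanout P * fanout P ^ (l - k) <=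
    2 * (root_fanout P * fanout P ^ l))%N.
  elim: k => [|k IH] kl; rewrite /level_start big_ord_recr /= sizeE //.
    by rewrite big_ord0 subn0; lia.
  apply: leq_trans (IH (ltnW kl)); rewrite -addnA leq_add2l addnn -mul2n.
  by rewrite -[(l - k)%N](subnSK kl) expnS mulnCA !leq_mul.
exact: leq_trans (leq_addr _ _) (start_le l (leqnn _)).
Qed.

Section DepthBound.
Variables (R : realType) (n M B b f l : nat).
Hypotheses (B_gt0 : (0 < B)%N) (BM : (2 * B <= M)%N) (Mn : (M < n)%N).
Hypotheses (f_gt1 : (1 < f)%N) (Mf : (M < f.+1 * B)%N) (Bb : (B <= 16 * b)%N).
Hypothesis leaves_lt : (b * f ^ l < 2 * n)%N.

Let B_gt0R : 0 < B%:R :> R. Proof. by rewrite ltr0n. Qed.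
Let n_gt0R : 0 < n%:R :> R. Proof. by rewrite ltr0n; lia. Qed.
Let f_gt0R : 0 < f%:R :> R. Proof. by rewrite ltr0n; lia. Qed.
Let M_gt0R : 0 < M%:R :> R. Proof. by rewrite ltr0n; lia. Qed.

Lemma ln_memory_le : ln (M%:R / B%:R) <= 2 * ln f%:R :> R.
Proof.
rewrite [2 * _]mulr_natl -lnXn // ler_ln ?posrE ?exprn_gt0 ?divr_gt0 //.
rewrite ler_pdivrMr // -natrX -natrM ler_nat; apply: leq_trans (ltnW Mf) _.
by rewrite leq_mul2r -mulnn; apply/orP; right; nia.
Qed.

Lemma ln_leaves_le : l%:R * ln f%:R <= ln (32 * (n%:R / B%:R)) :> R.
Proof.
rewrite [l%:R * _]mulr_natl -lnXn // ler_ln ?posrE ?exprn_gt0 ?mulr_gt0 ?invr_gt0 //.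
rewrite mulrA ler_pdivlMr // -natrX -!natrM ler_nat.
apply: leq_trans (_ : f ^ l * (16 * b) <= _)%N; first by rewrite leq_mul2l Bb orbT.
by move: leaves_lt; rewrite [(b * _)%N]mulnC; lia.
Qed.

Lemma depth_le : l.+1%:R <= 13 * (ln (n%:R / B%:R) / ln (M%:R / B%:R)) :> R.
Proof.
have MB : 2 <= M%:R / B%:R :> R by rewrite ler_pdivlMr // -natrM ler_nat.
have memory_gt0 : 0 < ln (M%:R / B%:R) :> R by apply: ln_gt0; lra.
have memory_le : ln (M%:R / B%:R) <= ln (n%:R / B%:R) :> R.
  have := ln_ratio_ge1 R B_gt0 BM Mn.
  by rewrite ler_pdivlMr // mul1r.
have ln32 : ln (32 * (n%:R / B%:R)) <= 5 * ln (M%:R / B%:R) + ln (n%:R / B%:R) :> R.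
  rewrite lnM ?posrE ?divr_gt0 // lerD2r (_ : 32 = 2 ^+ 5 :> R); last by rewrite -natrX.
  by rewrite lnXn // -(mulr_natl (ln 2)) ler_pM2l // ler_ln ?posrE //; lra.
rewrite mulrA ler_pdivlMr // -natr1.
have : l%:R * ln (M%:R / B%:R) <= l%:R * (2 * ln f%:R) :> R by rewrite ler_wpM2l // ln_memory_le.
by have := ln_leaves_le; lra.
Qed.

End DepthBound.

Section Solutions.
Variables (R : realType) (n M' B' W' : nat).
Notation M := M'.+1.
Notation B := B'.+1.
Notation W := W'.+1.
Notation ratio := (ln (n%:R / B%:R) / ln (M%:R / B%:R)).
Hypotheses (BM : (2 * B <= M)%N) (Mn : (M < n)%N) (W_fits : word_fits n W).

Definition sampler_layout K' chunk resident fanout root_fanout depth table_blocks heavy_blocks :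
    layout R :=
  Layout M' B' K' W' (n.+2 ^ 8) (36 * n.+2 ^ 3) (n.+2 ^ 3)%:R^-1
    chunk resident fanout root_fanout depth table_blocks heavy_blocks.

Definition solves (C K : nat) : Prop :=
  exists2 prog : program R M B K W, randomized_program prog &
  forall (S : finType) (p : S -> R), #|S| = n -> (forall v, 0 <= p v <= 1) ->
    samples_subsets prog p (C%:R * query_bound M B n (mu p)).

Let n_gt0 : (0 < n)%N. Proof. by lia. Qed.
Let B_gt0R : 0 < B%:R :> R. Proof. by rewrite ltr0n. Qed.
Let ratio_ge1 : 1 <= ratio :> R. Proof. exact: ln_ratio_ge1. Qed.

Let inv_n_le : n%:R^-1 <= B%:R^-1 :> R.
Proof. by rewrite lef_pV2 ?posrE ?ltr0n // ler_nat; lia. Qed.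

Lemma fits_solves C K' chunk resident fanout root_fanout depth table_blocks heavy_blocks :
  let P := sampler_layout K' chunk resident fanout root_fanout depth table_blocks heavy_blocks in
  fits P n ->
  (forall x : R, 0 <= x -> (2 * x + (draw_price P)%:R * (8 * x + 4 / n.+2%:R ^+ 2)) / chunk%:R +
     n%:R^-1 <= C%:R * (B%:R^-1 + x / B%:R * ratio)) ->
  solves C K'.+1.
Proof.
move=> P P_fits cost_le; exists (program_of (@sampler R P)).
  exact: program_of_randomized (@fdist_sampler R P).
move=> S p cardS p01; apply: (fits_samples n_gt0 P_fits cardS p01).
apply: le_trans (cost_le _ (mu_ge0 p01)) _.
by rewrite ler_wpM2l // ler_query_bound // mu_ge0.
Qed.

Definition flat_layout : layout R := sampler_layout (3 * n) 1 0 0 0 0 (2 * n) n.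

Lemma flat_layout_fits : fits flat_layout n.
Proof.
split=> //=.
- by rewrite /counter_base /buffer_base /heavy_base /junk_offset /=; lia.
- by rewrite /level_start big_ord0; lia.
- by rewrite /slots /= muln1; lia.
by rewrite /ceil_div addn0 divn1.
Qed.

Lemma flat_layout_blocks : (B < 8)%N -> ((3 * n).+1 <= 300 * ceil_div n B)%N.
Proof.
move=> B_lt8; have := ceil_div_ge n (ltn0Sn B').
have : (ceil_div n B * B <= ceil_div n B * 7)%N by rewrite leq_mul2l -ltnS B_lt8 orbT.
by lia.
Qed.

Lemma solves_small_blocks : (B < 8)%N -> solves (200 * 100) (3 * n).+1.
Proof.
move=> B_lt8; apply: fits_solves flat_layout_fits _ => x x_ge0.
have invB : 1 <= 7 * B%:R^-1 :> R by rewrite ler_pdivlMr // mul1r ler_nat.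
have small_term := four_div_sqr_le R n.
have x_small := ler_wpM2l x_ge0 invB; rewrite mulr1 mulrCA in x_small.
have x_ratio : x / B%:R <= x / B%:R * ratio by rewrite ler_peMr // divr_ge0.
rewrite divr1 mul1r natrM; have := inv_n_le.
move: x_small x_ratio invB small_term.
move: (n%:R^-1) (B%:R^-1) (4 / _) (x / B%:R) (_ * ratio) => n_inv B_inv w y z.
by lra.
Qed.

Lemma tree_cost_le (b l : nat) (x : R) : (B <= 16 * b)%N -> (l <= 2 * n)%N ->
  l.+1%:R <= 13 * ratio :> R -> 0 <= x ->
  (2 * x + (10 * l.+1)%:R * (8 * x + 4 / n.+2%:R ^+ 2)) / b%:R + n%:R^-1 <=
  (200 * 100)%:R * (B%:R^-1 + x / B%:R * ratio).
Proof.
move=> Bb l_le depth_le x_ge0; set w := 4 / _.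
have b_gt0R : 0 < b%:R :> R by rewrite ltr0n; lia.
have inv_b_le : b%:R^-1 <= 16 * B%:R^-1 :> R.
  by rewrite ler_pdivlMr // mulrC ler_pdivrMr // -natrM ler_nat.
have depth_w : l.+1%:R * w <= 8.
  rewrite /w mulrA ler_pdivrMr ?exprn_gt0 ?ltr0n // -natrX -!natrM ler_nat.
  by rewrite -mulnn mulSn; nia.
have depth_x : l.+1%:R * x <= 13 * ratio * x by rewrite ler_wpM2r.
have x_ratio : x <= x * ratio by rewrite ler_peMr.
have numerator_le : 2 * x + (10 * l.+1)%:R * (8 * x + w) <= 1042 * (x * ratio) + 80.
  by rewrite natrM; lra.
have bound_ge0 : 0 <= 1042 * (x * ratio) + 80 by lra.
apply: le_trans (_ : (1042 * (x * ratio) + 80) * (16 * B%:R^-1) + B%:R^-1 <= _).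
  apply: lerD => //; apply: le_trans (_ : (1042 * (x * ratio) + 80) * b%:R^-1 <= _).
    by rewrite ler_pM2r ?invr_gt0.
  by rewrite ler_wpM2l.
have -> : (1042 * (x * ratio) + 80) * (16 * B%:R^-1) =
  16 * 1042 * (x / B%:R * ratio) + 16 * 80 * B%:R^-1 by ring.
have inv_B_gt0 : 0 < B%:R^-1 :> R by rewrite invr_gt0.
have : 0 <= x / B%:R * ratio.
  by apply: mulr_ge0; [rewrite divr_ge0 | exact: le_trans ler01 ratio_ge1].
by rewrite natrM; move: inv_B_gt0; move: (B%:R^-1) (_ * ratio) => y z; lra.
Qed.

Section TreeLayout.
Variables (b f f0 l : nat).
Hypotheses (b_gt0 : (0 < b)%N) (bB : (8 * b <= B)%N) (Bb : (B <= 16 * b)%N).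
Hypotheses (f_gt1 : (1 < f)%N) (fM : (f * B <= M)%N) (Mf : (M < f.+1 * B)%N).
Hypotheses (f0_range : (0 < f0 <= f)%N) (leaves_lt : (b * f ^ l < 2 * n)%N).

Definition leaf_count : nat := (f0 * f ^ l)%N.

Hypotheses (slots_ge : (2 * n <= leaf_count * b)%N) (slots_lt : (leaf_count * b < 4 * n)%N).

Definition tree_layout : layout R :=
  sampler_layout (3 * leaf_count + ceil_div n b) b b f f0 l.+1 leaf_count (ceil_div n b).

Let buffer_le : (8 * (f * b) <= M)%N.
Proof. by apply: leq_trans fM; rewrite mulnCA leq_mul2l bB orbT. Qed.

Lemma depth_le_size : (l < 2 * n)%N.
Proof.
apply: leq_trans (ltn_expl l f_gt1) _; apply: leq_trans (ltnW leaves_lt).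
by rewrite leq_pmull.
Qed.

Lemma tree_layout_fits : fits tree_layout n.
Proof.
have /andP[f0_gt0 f0_le] := f0_range; have f_le : (f <= f * b)%N by rewrite leq_pmulr.
have memory_ge := buffer_le; have l_lt := depth_le_size.
split=> //=; rewrite ?f0_gt0 //.
- by lia.
- by lia.
- by lia.
- by rewrite /counter_base /buffer_base /heavy_base /junk_offset /=; lia.
- have := @level_start_le R tree_layout l f_gt1 erefl.
  by rewrite -/leaf_count /=; lia.
- by rewrite /level_size /= subn0.
- by rewrite slots_ge ltnW.
- exact: leq_pred.
by lia.
Qed.

Lemma tree_layout_blocks :
  ((3 * leaf_count + ceil_div n b).+1 <= 300 * ceil_div n B)%N.
Proof.
have n_le : (n <= 16 * ceil_div n B * b)%N.
  apply: leq_trans (ceil_div_ge n (ltn0Sn B')) _.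
  by rewrite [(16 * _)%N]mulnC -mulnA leq_mul2l Bb orbT.
have leaves_le : (leaf_count < 64 * ceil_div n B)%N.
  by rewrite -(ltn_pmul2r b_gt0); apply: leq_trans slots_lt _; lia.
have heavy_lt : (ceil_div n b < 16 * ceil_div n B + 1)%N.
  rewrite -(ltn_pmul2r b_gt0) mulnDl mul1n.
  by apply: leq_trans (ceil_div_lt n b_gt0) _; rewrite leq_add2r.
by lia.
Qed.

Lemma tree_layout_solves :
  solves (200 * 100) (3 * leaf_count + ceil_div n b).+1.
Proof.
apply: fits_solves tree_layout_fits _ => x x_ge0.
have /andP[f0_gt0 _] := f0_range.
rewrite /draw_price /= gtn_eqF //; apply: tree_cost_le => //; first exact: ltnW depth_le_size.
exact: depth_le Mf Bb leaves_lt.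
Qed.

End TreeLayout.

Lemma solves_on_disk :
  exists2 K, (K <= 200 * 100 * ceil_div n B)%N & solves (200 * 100) K.
Proof.
have blocks_le c : (300 * c <= 200 * 100 * c)%N by rewrite leq_mul2r orbT.
have [B_ge8|B_lt8] := leqP 8 B; last first.
  exists (3 * n).+1; last exact: solves_small_blocks.
  exact: leq_trans (flat_layout_blocks B_lt8) (blocks_le _).
have b_gt0 : (0 < B %/ 8)%N by rewrite divn_gt0.
have Bb : (B <= 16 * (B %/ 8))%N by lia.
have bB : (8 * (B %/ 8) <= B)%N by lia.
have f_gt1 : (1 < M %/ B)%N by rewrite leq_divRL.
have [l [f0 [leaves_lt f0_range slots_ge slots_lt]]] :=
  tree_shape b_gt0 (ltac:(lia) : (B %/ 8 < 2 * n)%N) f_gt1.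
have fM : (M %/ B * B <= M)%N := leq_divM _ _.
have Mf : (M < (M %/ B).+1 * B)%N by exact: ltn_ceil.
exists (3 * leaf_count (M %/ B) f0 l + ceil_div n (B %/ 8)).+1.
  by apply: leq_trans (blocks_le _); exact: tree_layout_blocks.
exact: tree_layout_solves.
Qed.

End Solutions.

Theorem theorem2 (R : realType) :
  exists C w : nat, forall n M B : nat,
    (0 < B)%N -> (2 * B <= M)%N ->
    exists2 K : nat, (K <= C * ceil_div n B)%N &
    exists2 prog : program R M B K (n.+2 ^ w)%N, randomized_program prog &
    forall (S : finType) (p : S -> R),
      #|S| = n -> (forall v, 0 <= p v <= 1) ->
      exists init : config M B K (n.+2 ^ w)%N S -> R,
        [/\ is_distribution init,
            answers_subset_sampling prog p init &
            amortized_expected_cost prog p init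
              (C%:R * query_bound M B n (mu p))].
Proof.
exists (200 * 100)%N, 64%N => n [|M'] [|B'] // _ BM.
have : word_fits n (n.+2 ^ 64) by exact: leqnn.
have : (0 < n.+2 ^ 64)%N by rewrite expn_gt0.
case: (n.+2 ^ 64)%N => // W' _ W_fits.
have [nM|Mn] := leqP n M'.+1; last exact: solves_on_disk.
exists 0%N => //; exists (program_of (@thin_memory R M'.+1 B'.+1 W'.+1)).
  exact: program_of_randomized (@fdist_thin_memory R M'.+1 B'.+1 W'.+1).
move=> S p cardS p01; apply: (thin_memory_samples _ p01 (ltn0Sn _)); first by rewrite cardS.
by apply: mulr_ge0; [exact: ler0n | exact: query_bound_ge0 (mu_ge0 p01)].
Qed.
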